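(* Let $M$ be a pseudo-finite model of $T^0_Q$ (respectively of $T^0_{Q,\omega}$) with $Q(M)\neq\emptyset$. Then $\mathrm{Th}(M)$ is axiomatized, modulo $T^0_Q$ (respectively $T^0_{Q,\omega}$), by one of the following: (1) the theory asserting that $K$ is a finite field of cardinality $2^k$ (for some $k\ge 1$), $V$ has infinite dimension, and $Q\neq\emptyset$; (2) the theory asserting that $\mathrm{Th}(K)$ is a given completion of the theory of pseudo-finite fields, $Q\neq\emptyset$, and either (a) $V$ has finite dimension $2n$, or (b) $V$ has infinite dimension. Moreover, all of these possibilities are realized.
   Context: $L_{V,K}$ is the two-sorted language with sorts $V$ and $K$, consisting of the language of rings on $K$, the language of abelian groups on $V$, a scalar multiplication $\cdot:K\times V\to V$, for each $n\ge 1$ an $n$-ary predicate $\theta_n$ on $V$, and for each $1\le i\le n$ a function $\pi_{n,i}:V^{n+1}\to K$, with $T^0_{V,K}$ saying that $K$ is a field, $V$ is a $K$-vector space, $\theta_n$ holds exactly of linearly independent tuples, and $\pi_{n,i}(v_1,\dots,v_n,w)=\alpha_i$ when $v_1,\dots,v_n$ are linearly independent and $w=\sum_i\alpha_iv_i$ (and $0$ otherwise). $L_Q$ extends $L_{V,K}$ by a sort $Q$ and functions $\beta_V:V^2\to K$, $+_Q:Q\times V\to Q$, $-_Q:Q^2\to V$, $\beta_Q:Q\times V\to K$. $T^0_Q$ extends $T^0_{V,K}$ by: $K$ has characteristic $2$; $\beta_V$ is a non-degenerate alternating bilinear form; each $\beta_Q(q,\cdot)$ is a quadratic form with associated bilinear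 form $\beta_V$; $+_Q$ is a regular action of $(V,+)$ on $Q$ with $\beta_Q(q+_Qv,w)=\beta_Q(q,w)+\beta_V(v,w)^2$; and $q-_Qq'$ is the unique $v$ with $q'+_Qv=q$. Let $\wp(x)=x^2-x$. $L_{Q,\omega}$ adds $\omega:Q\to K$, and $T^0_{Q,\omega}$ adds to $T^0_Q$: $\omega(q)\in\{0,1\}$; for all $q_1,q_2$, $\omega(q_1)=\omega(q_2)$ iff $\beta_Q(q_1,q_1-_Qq_2)\in\wp(K)$; and, for each $n$, if $\dim V=2n$ then $\omega(q)$ is the Witt defect of $(V,\beta_Q(q,\cdot))$ ($0$ if it is an orthogonal direct sum of hyperbolic planes, $1$ otherwise). A model is pseudo-finite if it is infinite and every sentence true in it holds in some finite model of the same base theory. *)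

(* Defs.v *)
From HB Require Import structures.
From mathcomp Require Import all_boot.
From mathcomp Require Import classical_sets cardinality.
From Stdlib Require List.

Set Implicit Arguments.
Unset Strict Implicit.
Unset Printing Implicit Defensive.

Local Open Scope classical_set_scope.

(* Variables are named: a variable is a sort together with a natural number.
   A sort may be empty in a structure, so assignments are partial. A sentence
   is evaluated under the empty assignment, and each of its variables has been
   given a value by the quantifier that binds it. *)
Record signature := Signature {
  sg_sort : eqType;
  sg_func : seq sg_sort -> sg_sort -> Type;
  sg_rel : seq sg_sort -> Type }.

Inductive term (S : signature) : sg_sort S -> Type :=
  | Var s of nat : term s
  | App d s of sg_func d s & args d : term s
with args (S : signature) : seq (sg_sort S) -> Type :=
  | ANil : args [::]
  | ACons s d of term s & args d : args (s :: d).

Arguments Var {S} s _.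
Arguments ANil {S}.

Inductive formula (S : signature) : Type :=
  | Bot
  | Eq s of term (S:=S) s & term (S:=S) s
  | Rel d of sg_rel (s:=S) d & args (S:=S) d
  | Imp of formula S & formula S
  | All (s : sg_sort S) of nat & formula S.

Arguments Bot {S}.

Definition Neg S (f : formula S) := Imp f Bot.
Definition Top S : formula S := Neg Bot.
Definition And S (f g : formula S) := Neg (Imp f (Neg g)).
Definition Or S (f g : formula S) := Imp (Neg f) g.
Definition Iff S (f g : formula S) := And (Imp f g) (Imp g f).
Definition Ex S (s : sg_sort S) x (f : formula S) := Neg (All s x (Neg f)).

Definition Conj S (fs : seq (formula S)) := foldr (@And S) (Top S) fs.
Definition Disj S (fs : seq (formula S)) := foldr (@Or S) Bot fs.
Definition Alls S (s : sg_sort S) (xs : seq nat) f := foldr (All s) f xs.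
Definition Exs S (s : sg_sort S) (xs : seq nat) f := foldr (Ex s) f xs.

Fixpoint term_scoped S (G : seq (sg_sort S * nat)) s (t : term s) : bool :=
  match t with
  | Var s x => (s, x) \in G
  | App _ _ _ ts => args_scoped G ts
  end
with args_scoped S (G : seq (sg_sort S * nat)) d (ts : args d) : bool :=
  match ts with
  | ANil => true
  | ACons _ _ t ts => term_scoped G t && args_scoped G ts
  end.

Fixpoint scoped S (G : seq (sg_sort S * nat)) (f : formula S) : bool :=
  match f with
  | Bot => true
  | Eq _ t u => term_scoped G t && term_scoped G u
  | Rel _ _ ts => args_scoped G ts
  | Imp f g => scoped G f && scoped G g
  | All s x f => scoped ((s, x) :: G) f
  end.

Definition sentence S (f : formula S) : bool := scoped [::] f.

Fixpoint htuple (I : Type) (A : I -> Type) (d : seq I) : Type :=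
  if d is s :: d' then (A s * htuple A d')%type else unit.

Record structure (S : signature) := Structure {
  carrier :> sg_sort S -> Type;
  interp_func : forall d s, sg_func d s -> htuple carrier d -> carrier s;
  interp_rel : forall d, sg_rel (s:=S) d -> htuple carrier d -> Prop }.

Definition assignment S (M : structure S) := forall s : sg_sort S, nat -> option (M s).

Definition no_assignment S (M : structure S) : assignment M := fun _ _ => None.

Definition update S (M : structure S) (e : assignment M) s x (a : M s) :
    assignment M :=
  fun t y => match @eqP _ s t with
             | ReflectT st => if x == y then Some (ecast u (M u) st a) else e t y
             | ReflectF _ => e t y
             end.

Fixpoint eval S (M : structure S) (e : assignment M) s (t : term s) : option (M s) :=
  match t with
  | Var s x => e s x
  | App _ _ g ts => omap (interp_func g) (evals e ts)
  end
with evals S (M : structure S) (e : assignment M) d (ts : args d) : option (htuple M d) :=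
  match ts with
  | ANil => Some tt
  | ACons _ _ t ts => obind (fun a => omap (pair a) (evals e ts)) (eval e t)
  end.

Fixpoint sat S (M : structure S) (e : assignment M) (f : formula S) : Prop :=
  match f with
  | Bot => False
  | Eq _ t u => exists a, eval e t = Some a /\ eval e u = Some a
  | Rel _ r ts => exists a, evals e ts = Some a /\ interp_rel r a
  | Imp f g => sat e f -> sat e g
  | All s x f => forall a : M s, sat (update e x a) f
  end.

Definition holds S (M : structure S) (f : formula S) : Prop := sat (no_assignment M) f.

Definition theory S := set (formula S).

Definition model S (T : theory S) (M : structure S) : Prop :=
  forall f, T f -> holds M f.

Definition Th S (M : structure S) : theory S := [set f | sentence f /\ holds M f].

Definition axiomatized_modulo S (T0 T A : theory S) : Prop :=
  forall N : structure S, model (T0 `|` A) N <-> model T N.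

Definition finite_structure S (M : structure S) : Prop :=
  finite_set [set: {s : sg_sort S & M s}].

Definition pseudofinite S (T0 : theory S) (M : structure S) : Prop :=
  [/\ model T0 M,
      ~ finite_structure M
    & forall f, sentence f -> holds M f ->
      exists N : structure S, [/\ model T0 N, finite_structure N & holds N f]].

Definition completion S (T C : theory S) : Prop :=
  [/\ C `<=` [set f | sentence f],
      T `<=` C,
      exists M : structure S, model C M
    & forall f, sentence f -> C f \/ C (Neg f)].

Definition App1 S s1 s (g : sg_func [:: s1] s) (t1 : term (S:=S) s1) : term s :=
  App g (ACons t1 ANil).
Definition App2 S s1 s2 s (g : sg_func [:: s1; s2] s)
    (t1 : term (S:=S) s1) (t2 : term s2) : term s :=
  App g (ACons t1 (ACons t2 ANil)).

Fixpoint nargs S (s : sg_sort S) n (t : nat -> term s) : args (nseq n s) :=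
  if n is m.+1 then ACons (t 0) (nargs m (fun i => t i.+1)) else ANil.

Definition card_eq S (s : sg_sort S) n : formula S :=
  Exs s (iota 0 n)
    (And (Conj [seq Neg (Eq (Var s ij.1) (Var s ij.2)) |
                 ij <- [seq (i, j) | i <- iota 0 n, j <- iota 0 n] & ij.1 != ij.2])
         (All s n (Disj [seq Eq (Var s n) (Var s i) | i <- iota 0 n]))).

Definition nonempty S (s : sg_sort S) : formula S := Ex s 0 (Top S).

Inductive ring_func : seq unit -> unit -> Type :=
  | RZero : ring_func [::] tt
  | ROne : ring_func [::] tt
  | RAdd : ring_func [:: tt; tt] tt
  | ROpp : ring_func [:: tt] tt
  | RMul : ring_func [:: tt; tt] tt.

Definition Lring := @Signature unit ring_func (fun _ => void).

Section FieldTheory.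

Local Notation x := (Var (S:=Lring) tt 0).
Local Notation y := (Var (S:=Lring) tt 1).
Local Notation z := (Var (S:=Lring) tt 2).

Definition rzero : term (S:=Lring) tt := App (S:=Lring) RZero ANil.
Definition rone : term (S:=Lring) tt := App (S:=Lring) ROne ANil.
Definition radd (t u : term (S:=Lring) tt) := App2 (S:=Lring) RAdd t u.
Definition ropp (t : term (S:=Lring) tt) := App1 (S:=Lring) ROpp t.
Definition rmul (t u : term (S:=Lring) tt) := App2 (S:=Lring) RMul t u.

Local Notation all_xyz f := (Alls (S:=Lring) tt [:: 0; 1; 2] f).

Definition field_axioms : seq (formula Lring) :=
  [:: all_xyz (Eq (radd x (radd y z)) (radd (radd x y) z));
      all_xyz (Eq (radd x y) (radd y x));
      all_xyz (Eq (radd rzero x) x);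
      all_xyz (Eq (radd (ropp x) x) rzero);
      all_xyz (Eq (rmul x (rmul y z)) (rmul (rmul x y) z));
      all_xyz (Eq (rmul x y) (rmul y x));
      all_xyz (Eq (rmul rone x) x);
      all_xyz (Eq (rmul (radd x y) z) (radd (rmul x z) (rmul y z)));
      Neg (Eq rone rzero);
      All (S:=Lring) tt 0
        (Imp (Neg (Eq x rzero)) (Ex (S:=Lring) tt 1 (Eq (rmul y x) rone)))].

Definition field_theory : theory Lring := fun f => List.In f field_axioms.

Definition char2 : formula Lring := Eq (radd rone rone) rzero.

End FieldTheory.

Definition psf_field_theory : theory Lring :=
  [set f | sentence f /\
           forall F : structure Lring, pseudofinite field_theory F -> holds F f].

Inductive QSort := K | V | Q.

Definition QSort_eqb (s t : QSort) : bool :=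
  match s, t with K, K | V, V | Q, Q => true | _, _ => false end.

Lemma QSort_eqP : Equality.axiom QSort_eqb.
Proof. by case; case; constructor. Qed.

HB.instance Definition _ := hasDecEq.Build QSort QSort_eqP.

(* L_Q is the case w = false and L_{Q,omega} the case w = true.
   theta_n and pi_{n,i} exist for 1 <= i <= n, so [Theta n] and [Pi n i] stand
   for theta_{n+1} and pi_{n+1,i+1}. *)
Inductive Q_func (w : bool) : seq QSort -> QSort -> Type :=
  | KRing d s of ring_func d s : Q_func w [seq K | _ <- d] K
  | VZero : Q_func w [::] V
  | VAdd : Q_func w [:: V; V] V
  | VOpp : Q_func w [:: V] V
  | Scale : Q_func w [:: K; V] V
  | Pi n of 'I_n.+1 : Q_func w (nseq n.+2 V) K
  | BetaV : Q_func w [:: V; V] K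
  | QAdd : Q_func w [:: Q; V] Q
  | QSub : Q_func w [:: Q; Q] V
  | BetaQ : Q_func w [:: Q; V] K
  | Omega of w : Q_func w [:: Q] K.

Inductive Q_rel : seq QSort -> Type :=
  | Theta n : Q_rel (nseq n.+1 V).

Definition LQ (w : bool) := @Signature QSort (Q_func w) Q_rel.

Section RingToQ.
Variable w : bool.

Fixpoint K_term s (t : term (S:=Lring) s) : term (S:=LQ w) K :=
  match t with
  | Var _ x => Var (S:=LQ w) K x
  | App _ _ g ts => App (S:=LQ w) (KRing w g) (K_args ts)
  end
with K_args d (ts : args (S:=Lring) d) : args (S:=LQ w) [seq K | _ <- d] :=
  match ts with
  | ANil => ANil
  | ACons _ _ t ts => ACons (K_term t) (K_args ts)
  end.

Fixpoint K_formula (f : formula Lring) : formula (LQ w) :=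
  match f with
  | Bot => Bot
  | Eq _ t u => Eq (K_term t) (K_term u)
  | Rel _ r _ => match r with end
  | Imp f g => Imp (K_formula f) (K_formula g)
  | All _ x f => All (S:=LQ w) K x (K_formula f)
  end.

Definition K_theory (T : theory Lring) : theory (LQ w) := K_formula @` T.

End RingToQ.

Section TheoryQ.
Variable w : bool.

Local Notation tm := (@term (LQ w)).
Local Notation fm := (formula (LQ w)).

Local Notation k := (Var (S:=LQ w) K).
Local Notation v := (Var (S:=LQ w) V).
Local Notation q := (Var (S:=LQ w) Q).

Definition kzero : tm K := App (S:=LQ w) (KRing w RZero) ANil.
Definition kone : tm K := App (S:=LQ w) (KRing w ROne) ANil.
Definition kadd (a b : tm K) : tm K := App2 (S:=LQ w) (KRing w RAdd) a b.
Definition kopp (a : tm K) : tm K := App1 (S:=LQ w) (KRing w ROpp) a.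
Definition kmul (a b : tm K) : tm K := App2 (S:=LQ w) (KRing w RMul) a b.
Definition vzero : tm V := App (S:=LQ w) (VZero w) ANil.
Definition vadd (a b : tm V) : tm V := App2 (S:=LQ w) (VAdd w) a b.
Definition vopp (a : tm V) : tm V := App1 (S:=LQ w) (VOpp w) a.
Definition scale (a : tm K) (b : tm V) : tm V := App2 (S:=LQ w) (Scale w) a b.
Definition betaV (a b : tm V) : tm K := App2 (S:=LQ w) (BetaV w) a b.
Definition qadd (a : tm Q) (b : tm V) : tm Q := App2 (S:=LQ w) (QAdd w) a b.
Definition qsub (a b : tm Q) : tm V := App2 (S:=LQ w) (QSub w) a b.
Definition betaQ (a : tm Q) (b : tm V) : tm K := App2 (S:=LQ w) (BetaQ w) a b.

Local Notation "a '+k' b" := (kadd a b) (at level 50, left associativity).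
Local Notation "a '-k' b" := (kadd a (kopp b)) (at level 50, left associativity).
Local Notation "a '*k' b" := (kmul a b) (at level 40, left associativity).
Local Notation "a '+v' b" := (vadd a b) (at level 50, left associativity).
Local Notation "a '*v' b" := (scale a b) (at level 40, left associativity).
Local Notation "a '+q' b" := (qadd a b) (at level 50, left associativity).
Local Notation "a '-q' b" := (qsub a b) (at level 50, left associativity).
Local Notation "a '===' b" := (Eq a b) (at level 70, no associativity).

Local Notation all_K := (Alls (S:=LQ w) K).
Local Notation all_V := (Alls (S:=LQ w) V).
Local Notation all_Q := (Alls (S:=LQ w) Q).
Local Notation ex_K := (Exs (S:=LQ w) K).
Local Notation ex_V := (Exs (S:=LQ w) V).

Definition vector_space_axioms : seq fm :=
  [:: all_V [:: 0; 1; 2] (v 0 +v (v 1 +v v 2) === v 0 +v v 1 +v v 2);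
      all_V [:: 0; 1] (v 0 +v v 1 === v 1 +v v 0);
      all_V [:: 0] (vzero +v v 0 === v 0);
      all_V [:: 0] (vopp (v 0) +v v 0 === vzero);
      all_K [:: 0; 1] (all_V [:: 0] (k 0 *v (k 1 *v v 0) === (k 0 *k k 1) *v v 0));
      all_V [:: 0] (kone *v v 0 === v 0);
      all_K [:: 0] (all_V [:: 0; 1]
        (k 0 *v (v 0 +v v 1) === k 0 *v v 0 +v k 0 *v v 1));
      all_K [:: 0; 1] (all_V [:: 0]
        ((k 0 +k k 1) *v v 0 === k 0 *v v 0 +v k 1 *v v 0))].

Definition theta n (t : nat -> tm V) : fm :=
  Rel (S:=LQ w) (Theta n) (nargs (S:=LQ w) n.+1 t).

(* pi_{n+1,i+1}(t 0, ..., t n, u) *)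
Definition pi n (i : 'I_n.+1) (t : nat -> tm V) (u : tm V) : tm K :=
  App (S:=LQ w) (Pi w i)
    (nargs (S:=LQ w) n.+2 (fun j => if j <= n then t j else u)).

Definition lincomb n (a : nat -> tm K) (t : nat -> tm V) : tm V :=
  foldr (fun i u => a i *v t i +v u) vzero (iota 0 n).

Definition theta_axiom n : fm :=
  all_V (iota 0 n.+1)
    (Iff (theta n v)
         (all_K (iota 0 n.+1)
            (Imp (lincomb n.+1 k v === vzero)
                 (Conj [seq k i === kzero | i <- iota 0 n.+1])))).

Definition pi_axiom n (i : 'I_n.+1) : fm :=
  let u := v n.+1 in
  let coordinates := And (theta n v) (u === lincomb n.+1 k v) in
  all_V (iota 0 n.+2)
    (And (all_K (iota 0 n.+1) (Imp coordinates (pi i v u === k i)))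
         (Imp (Neg (ex_K (iota 0 n.+1) coordinates)) (pi i v u === kzero))).

Definition T0_VK : theory (LQ w) :=
  K_theory field_theory
  `|` [set f | List.In f vector_space_axioms]
  `|` range theta_axiom
  `|` [set f | exists n (i : 'I_n.+1), f = pi_axiom i].

Definition betaV_axioms : seq fm :=
  [:: all_K [:: 0] (all_V [:: 0; 1; 2]
        (betaV (k 0 *v v 0 +v v 1) (v 2)
           === k 0 *k betaV (v 0) (v 2) +k betaV (v 1) (v 2)));
      all_K [:: 0] (all_V [:: 0; 1; 2]
        (betaV (v 2) (k 0 *v v 0 +v v 1)
           === k 0 *k betaV (v 2) (v 0) +k betaV (v 2) (v 1)));
      all_V [:: 0] (betaV (v 0) (v 0) === kzero);
      all_V [:: 0]
        (Imp (all_V [:: 1] (betaV (v 0) (v 1) === kzero)) (v 0 === vzero))].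

Definition betaQ_axioms : seq fm :=
  [:: all_Q [:: 0] (all_K [:: 0] (all_V [:: 0]
        (betaQ (q 0) (k 0 *v v 0) === (k 0 *k k 0) *k betaQ (q 0) (v 0))));
      all_Q [:: 0] (all_V [:: 0; 1]
        (betaQ (q 0) (v 0 +v v 1)
           === betaQ (q 0) (v 0) +k betaQ (q 0) (v 1) +k betaV (v 0) (v 1)))].

Definition action_axioms : seq fm :=
  [:: all_Q [:: 0] (q 0 +q vzero === q 0);
      all_Q [:: 0] (all_V [:: 0; 1] (q 0 +q (v 0 +v v 1) === q 0 +q v 0 +q v 1));
      all_Q [:: 0; 1] (ex_V [:: 0]
        (And (q 0 +q v 0 === q 1)
             (all_V [:: 1] (Imp (q 0 +q v 1 === q 1) (v 1 === v 0)))));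
      all_Q [:: 0] (all_V [:: 0; 1]
        (betaQ (q 0 +q v 0) (v 1)
           === betaQ (q 0) (v 1) +k betaV (v 0) (v 1) *k betaV (v 0) (v 1)));
      all_Q [:: 0; 1] (all_V [:: 0]
        (Iff (v 0 === q 0 -q q 1) (q 1 +q v 0 === q 0)))].

Definition T0_Q : theory (LQ w) :=
  T0_VK
  `|` K_theory [set char2]
  `|` [set f | List.In f (betaV_axioms ++ betaQ_axioms ++ action_axioms)].

Definition indep n (t : nat -> tm V) : fm := if n is m.+1 then theta m t else Top _.

Definition dim_ge n : fm := ex_V (iota 0 n) (indep n v).
Definition dim_eq n : fm := And (dim_ge n) (Neg (dim_ge n.+1)).

(* (V, beta_Q(q 0, .)) is an orthogonal direct sum of n hyperbolic planes, the
   i-th plane having the singular vectors v i and v (n + i) as a basis. This is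
   only used when dim V = 2n, where 2n independent vectors span V. *)
Definition sum_of_hyperbolic_planes n : fm :=
  let e i := v i in
  let f i := v (n + i) in
  ex_V (iota 0 (2 * n))
    (And (indep (2 * n) v)
    (And (Conj [seq And (betaQ (q 0) (e i) === kzero)
                   (And (betaQ (q 0) (f i) === kzero)
                        (betaV (e i) (f i) === kone)) | i <- iota 0 n])
         (Conj [seq And (betaV (e ij.1) (e ij.2) === kzero)
                   (And (betaV (e ij.1) (f ij.2) === kzero)
                        (betaV (f ij.1) (f ij.2) === kzero)) |
                 ij <- [seq (i, j) | i <- iota 0 n, j <- iota 0 n] & ij.1 != ij.2]))).

Definition omega (ww : w) (a : tm Q) : tm K := App1 (S:=LQ w) (Omega ww) a.

Definition omega_axioms (ww : w) : seq fm :=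
  [:: all_Q [:: 0] (Or (omega ww (q 0) === kzero) (omega ww (q 0) === kone));
      all_Q [:: 0; 1]
        (Iff (omega ww (q 0) === omega ww (q 1))
             (ex_K [:: 0] (betaQ (q 0) (q 0 -q q 1) === k 0 *k k 0 -k k 0)))].

Definition witt_axiom (ww : w) n : fm :=
  Imp (dim_eq (2 * n))
    (all_Q [:: 0]
      (And (Imp (sum_of_hyperbolic_planes n) (omega ww (q 0) === kzero))
           (Imp (Neg (sum_of_hyperbolic_planes n)) (omega ww (q 0) === kone)))).

Definition infinite_dim : theory (LQ w) := range dim_ge.

Definition theory_finite (m : nat) : theory (LQ w) :=
  [set card_eq (S:=LQ w) K (2 ^ m); nonempty (S:=LQ w) Q] `|` infinite_dim.

Definition theory_psf_finite_dim (C : theory Lring) (n : nat) : theory (LQ w) :=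
  K_theory C `|` [set nonempty (S:=LQ w) Q; dim_eq (2 * n)].

Definition theory_psf_infinite_dim (C : theory Lring) : theory (LQ w) :=
  K_theory C `|` [set nonempty (S:=LQ w) Q] `|` infinite_dim.

End TheoryQ.

Arguments T0_VK w : clear implicits.
Arguments T0_Q w : clear implicits.
Arguments theory_finite w m : clear implicits.
Arguments theory_psf_finite_dim w C n : clear implicits.
Arguments theory_psf_infinite_dim w C : clear implicits.

Definition T0_Qomega : theory (LQ true) :=
  T0_Q true
  `|` [set f | List.In f (omega_axioms isT)]
  `|` range (witt_axiom isT).

Definition T0 (w : bool) : theory (LQ w) :=
  if w is true then T0_Qomega else T0_Q false.

Arguments T0 w : clear implicits.

(* Main.v *)
(** Choosing a base point [q0] of [Q] turns a model into a symplectic space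
    over a perfect field with a quadratic form polarizing to the symplectic form.
    Translating [q0] makes a given finite symplectic frame singular; when [V] has
    infinite dimension it also adjusts the value of [omega] at [q0]. Two such spaces
    of the same finite dimension, or both of infinite dimension, are related by a
    back-and-forth system whose states consist of a correspondence between the
    fields and of two hyperbolic frames of the same size: every vector lies in the
    span of a larger hyperbolic frame. If [K] is finite the correspondence is an
    isomorphism; otherwise it comes from elementary equivalence, after passing to
    ultrapowers over [nat] so that partial correspondences extend. The realizations
    are ultraproducts of finite hyperbolic spaces; these satisfy the Witt defect
    axioms because a quadratic form [q + beta(a, -)^2] on such a space is again
    hyperbolic exactly when [q a] has the form [t^2 - t], by Gauss sums. *)

From HB Require Import structures.
From mathcomp Require Import all_boot all_fingroup all_algebra all_solvable all_field ring zify.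
From mathcomp Require Import boolp classical_sets cardinality filter.
From Stdlib Require List.
From Stdlib Require Import Eqdep_dec.
Require Import Defs.

Set Implicit Arguments.
Unset Strict Implicit.
Unset Printing Implicit Defensive.

Import GRing.Theory.
Local Open Scope classical_set_scope.
Local Open Scope nat_scope.

(** * Satisfaction *)

(** Two models are compared directly, so choices made on the two sides have to agree. For [omega],
    moving the base point by [v] changes the value exactly when the form takes at [v] a value
    outside the image of x^2 - x. In finite dimension the Witt defect fixes the value at a base
    point for which a spanning frame is singular. In infinite dimension nothing fixes it, but over a
    perfect field a nonsingular vector can be scaled to any value, and some value lies outside that
    image: x^2 - x vanishes at 0 and at 1, so it is not onto over a finite field. Both facts are
    first-order and pass to pseudo-finite fields. For [pi], the coordinates of related vectors may
    be field elements without a partner, so applying a function symbol may enlarge the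
    correspondence. Elementary equivalence only wins games of each finite length; a nonprincipal
    ultrafilter turns these wins into one answer that is good for all lengths. *)

Lemma mem_iota0 n i : (i \in iota 0 n) = (i < n).
Proof. by rewrite mem_iota add0n. Qed.

Section ConstantTuples.
Variables (I : Type) (A : I -> Type).
Implicit Types (s : I).

(** The symbols [Theta] and [Pi] take tuples of constant sort; these two maps exchange such tuples
    with initial segments of functions on [nat], the form in which variables and linear combinations
    are indexed. *)
Fixpoint hmk s n (t : nat -> A s) : htuple A (nseq n s) :=
  match n return htuple A (nseq n s) with
  | 0 => tt
  | m.+1 => (t 0, hmk m (fun i => t i.+1))
  end.

Fixpoint hnth s (a0 : A s) n : htuple A (nseq n s) -> nat -> A s :=
  match n return htuple A (nseq n s) -> nat -> A s with
  | 0 => fun _ _ => a0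
  | m.+1 => fun t i => if i is j.+1 then hnth a0 t.2 j else t.1
  end.

Lemma hnth_mk s (a0 : A s) n t i : i < n -> hnth a0 (hmk n t) i = t i.
Proof. by elim: n t i => // n IH t [|i] //= ?; rewrite IH. Qed.

Lemma hmk_nth s (a0 : A s) n (t : htuple A (nseq n s)) : hmk n (hnth a0 t) = t.
Proof. by elim: n t => [[]|n IH [a t]] //=; rewrite IH. Qed.

End ConstantTuples.

Section Satisfaction.
Variables (S : signature) (M : structure S).
Implicit Types (e : assignment M) (f g : formula S).

Lemma updateE e s x a y : @update S M e s x a s y = if x == y then Some a else e s y.
Proof.
rewrite /update; case: eqP => [st|//].
by rewrite (eq_axiomK st).
Qed.

Lemma update_neq e s t x a y : s != t -> @update S M e s x a t y = e t y.
Proof. by rewrite /update; case: eqP. Qed.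

Lemma assignment_ext e1 e2 : (forall s x, e1 s x = e2 s x) -> e1 = e2.
Proof. by move=> h; apply: functional_extensionality_dep => s; apply: funext. Qed.

Lemma satN e f : sat e (Neg f) <-> ~ sat e f. Proof. by []. Qed.

Lemma satImp e f g : sat e (Imp f g) <-> (sat e f -> sat e g). Proof. by []. Qed.

Lemma evalV e s x : eval e (Var (S:=S) s x) = e s x. Proof. by []. Qed.

Lemma eval_App e d s (g : sg_func d s) ts a :
  evals e ts = Some a -> eval e (App g ts) = Some (interp_func g a).
Proof. by move=> /= ->. Qed.

Lemma satA e f g : sat e (And f g) <-> sat e f /\ sat e g.
Proof.
split=> [/= h|[hf hg] /=]; last by move/(_ hf).
by split; apply: contrapT => h'; apply: h => // ? ?.
Qed.

Lemma satO e f g : sat e (Or f g) <-> sat e f \/ sat e g.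
Proof.
split=> [/= h|[] //=].
by have [|nf] := pselect (sat e f); [left|right; apply: h].
Qed.

Lemma satI e f g : sat e (Iff f g) <-> (sat e f <-> sat e g).
Proof. by rewrite /Iff satA /=; split=> [[]|[]]. Qed.

Lemma satAll e s x f :
  sat e (All s x f) <-> forall a : M s, sat (update e x a) f.
Proof. by []. Qed.

Lemma satE e s x f : sat e (Ex s x f) <-> exists a : M s, sat (update e x a) f.
Proof.
split=> /= [h|[a ha] /(_ a)//].
apply: contrapT => h'; apply: h => a ha; apply: h'; by exists a.
Qed.

Lemma sat_Conj e fs : sat e (Conj fs) <-> List.Forall (sat e) fs.
Proof.
elim: fs => [|f fs IH]; first by split=> // _.
rewrite [Conj _]/(And f (Conj fs)) satA IH List.Forall_cons_iff; tauto.
Qed.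

Lemma sat_Disj e fs : sat e (Disj fs) <-> List.Exists (sat e) fs.
Proof.
elim: fs => [|f fs IH]; first by rewrite List.Exists_nil.
by rewrite [Disj _]/(Or f (Disj fs)) satO IH List.Exists_cons.
Qed.

Lemma Forall_map_mem (I : eqType) (r : seq I) T (F : I -> T) (P : T -> Prop) :
  List.Forall P [seq F i | i <- r] <-> forall i, i \in r -> P (F i).
Proof.
elim: r => [|i r IH] //=; rewrite List.Forall_cons_iff IH.
split=> [[Pi Pr] j|h]; first by rewrite inE => /orP[/eqP->|/Pr].
by split=> [|j jr]; apply: h; rewrite inE ?eqxx ?jr ?orbT.
Qed.

Lemma Exists_map_mem (I : eqType) (r : seq I) T (F : I -> T) (P : T -> Prop) :
  List.Exists P [seq F i | i <- r] <-> exists2 i, i \in r & P (F i).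
Proof.
elim: r => [|i r IH] /=; first by rewrite List.Exists_nil; split=> // -[].
rewrite List.Exists_cons IH; split=> [[Pi|[j jr Pj]]|[j]].
- by exists i; rewrite ?inE ?eqxx.
- by exists j; rewrite ?inE ?jr ?orbT.
- by rewrite inE => /orP[/eqP->|jr]; [left|right; exists j].
Qed.

Lemma sat_Conj_map e (I : eqType) (r : seq I) F :
  sat e (Conj [seq F i | i <- r]) <-> forall i, i \in r -> sat e (F i).
Proof. by rewrite sat_Conj Forall_map_mem. Qed.

Lemma sat_Disj_map e (I : eqType) (r : seq I) F :
  sat e (Disj [seq F i | i <- r]) <-> exists2 i, i \in r & sat e (F i).
Proof. by rewrite sat_Disj Exists_map_mem. Qed.

Lemma sat_Eq e s (t u : term s) a b :
  eval e t = Some a -> eval e u = Some b -> sat e (Eq t u) <-> a = b.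
Proof. by move=> /= -> ->; split=> [[c [[<-] [<-]]]|->]; [|exists b]. Qed.

Lemma sat_Rel e d (r : sg_rel d) (ts : args d) a :
  evals e ts = Some a -> sat e (Rel r ts) <-> interp_rel r a.
Proof. by move=> /= ->; split=> [[c [[<-]]]|h]; [|exists a]. Qed.

Definition updates e s (xs : seq nat) (a : nat -> M s) : assignment M :=
  foldl (fun e x => update e x (a x)) e xs.

Lemma updatesE e s xs a y :
  @updates e s xs a s y = if y \in xs then Some (a y) else e s y.
Proof.
rewrite /updates; elim: xs e => [|x xs IH] e //=.
rewrite IH updateE inE eq_sym; case: (y \in xs); rewrite ?orbT ?orbF //.
by case: eqP => // ->.
Qed.

Lemma updates_neq e s xs a t y : s != t -> @updates e s xs a t y = e t y.
Proof.
move=> st; rewrite /updates; elim: xs e => [|x xs IH] e //=.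
by rewrite IH update_neq.
Qed.

Lemma updates_ext e s xs (a b : nat -> M s) :
  (forall x, x \in xs -> a x = b x) -> updates e xs a = updates e xs b.
Proof.
move=> ab; apply: assignment_ext => t y.
have [<-|st] := eqVneq s t; last by rewrite !updates_neq.
by rewrite !updatesE; case: ifP => // /ab ->.
Qed.

Lemma sat_Alls_cons e s x xs f : sat e (Alls s (x :: xs) f) <->
  forall a : M s, sat (update e x a) (Alls s xs f).
Proof. by []. Qed.

Lemma sat_Alls_nil e (s : sg_sort S) f : sat e (Alls s [::] f) <-> sat e f.
Proof. by []. Qed.

Lemma sat_Exs1 e s x f : sat e (Exs s [:: x] f) <-> exists a : M s, sat (update e x a) f.
Proof. exact: satE. Qed.

(** A block of quantifiers becomes one quantifier over functions from names to values. Such a total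
    function must exist even for an empty block, whence the inhabited sort; distinct names let one
    function carry all the values. *)
Lemma sat_Alls e s xs f : inhabited (M s) -> uniq xs ->
  sat e (Alls s xs f) <-> forall a : nat -> M s, sat (updates e xs a) f.
Proof.
move=> [a0]; rewrite /updates; elim: xs e => [|x xs IH] e /=.
  by move=> _; split=> // /(_ (fun=> a0)).
move=> /andP[xxs uxs]; split=> [h a|h b].
  by move/(IH _ uxs): (h (a x)); apply.
apply/(IH _ uxs) => a.
have := h (fun y => if y == x then b else a y); rewrite /= eqxx.
rewrite -!/(updates _ _ _) (@updates_ext _ _ _ _ a) // => y yxs.
by case: eqP => // yx; rewrite -yx yxs in xxs.
Qed.

Lemma sat_Exs e s xs f : inhabited (M s) -> uniq xs ->
  sat e (Exs s xs f) <-> exists a : nat -> M s, sat (updates e xs a) f.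
Proof.
move=> [a0]; rewrite /updates; elim: xs e => [|x xs IH] e.
  by move=> _; split=> [h|[]//]; exists (fun=> a0).
have -> : Exs s (x :: xs) f = Ex s x (Exs s xs f) by [].
rewrite satE cons_uniq => /andP[xxs uxs].
split=> [[b /(IH _ uxs)[a h]]|[a h]]; last first.
  by exists (a x); apply/(IH _ uxs); exists a.
exists (fun y => if y == x then b else a y); rewrite /= eqxx.
rewrite -!/(updates _ _ _) (@updates_ext _ _ _ _ a) // => y yxs.
by case: eqP => // yx; rewrite -yx yxs in xxs.
Qed.

Lemma evals_nargs e s n (t : nat -> term s) a :
  (forall i, i < n -> eval e (t i) = Some (a i)) ->
  evals e (nargs n t) = Some (hmk n a).
Proof.
elim: n t a => // n IH t a h /=; rewrite h //=.
by rewrite (IH _ (fun i => a i.+1)) // => i ?; apply: h.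
Qed.

End Satisfaction.

Arguments updates : simpl never.

Scheme term_args_ind := Induction for term Sort Prop
  with args_term_ind := Induction for args Sort Prop.
Combined Scheme term_args_mutind from term_args_ind, args_term_ind.

(** * Back and forth *)

Fixpoint hrel I (A B : I -> Type) (R : forall s, A s -> B s -> Prop) d :
    htuple A d -> htuple B d -> Prop :=
  match d return htuple A d -> htuple B d -> Prop with
  | [::] => fun _ _ => True
  | s :: d' => fun a b => R s a.1 b.1 /\ hrel R a.2 b.2
  end.

Definition orel A B (R : A -> B -> Prop) (x : option A) (y : option B) : Prop :=
  match x, y with
  | None, None => True
  | Some a, Some b => R a b
  | _, _ => False
  end.

Section BackAndForth.
Variables (S : signature) (M N : structure S) (I : Type).
Variables (le : I -> I -> Prop) (R : I -> forall s, M s -> N s -> Prop).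

(** An index stands for a partial correspondence that need not be closed under the function symbols;
    [bf_func] therefore allows a larger index, while [bf_eq] and [bf_rel] are decided where they
    stand. *)
Record back_and_forth : Prop := BackAndForth {
  bf_refl : forall i, le i i;
  bf_trans : forall i j k, le i j -> le j k -> le i k;
  bf_mono : forall i j s a b, le i j -> @R i s a b -> @R j s a b;
  bf_eq : forall i s a b c d, @R i s a b -> @R i s c d -> (a = c <-> b = d);
  bf_func : forall i d s (g : sg_func d s) a b, hrel (R i) a b ->
    exists j, le i j /\ R j (interp_func g a) (interp_func g b);
  bf_rel : forall i d (r : sg_rel d) a b, hrel (R i) a b ->
    (interp_rel r a <-> interp_rel r b);
  bf_forth : forall i s (a : M s), exists j b, le i j /\ R j a b;
  bf_back : forall i s (b : N s), exists j a, le i j /\ R j a b }.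

Hypothesis H : back_and_forth.

Definition related i (e1 : assignment M) (e2 : assignment N) :=
  forall s x, orel (@R i s) (e1 s x) (e2 s x).

Lemma related_mono i j e1 e2 : le i j -> related i e1 e2 -> related j e1 e2.
Proof.
move=> ij h s x; have := h s x; case: (e1 s x) (e2 s x) => [a|] [b|] //=.
exact: (bf_mono H).
Qed.

Lemma related_eval :
  (forall s (t : term (S:=S) s) i e1 e2, related i e1 e2 ->
    exists j, le i j /\ orel (@R j s) (eval e1 t) (eval e2 t)) /\
  (forall d (ts : args (S:=S) d) i e1 e2, related i e1 e2 ->
    exists j, le i j /\ orel (hrel (R j) (d:=d)) (evals e1 ts) (evals e2 ts)).
Proof.
apply: (@term_args_mutind S
  (fun s t => forall i e1 e2, related i e1 e2 ->
    exists j, le i j /\ orel (@R j s) (eval e1 t) (eval e2 t))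
  (fun d ts => forall i e1 e2, related i e1 e2 ->
    exists j, le i j /\ orel (hrel (R j) (d:=d)) (evals e1 ts) (evals e2 ts))).
- by move=> s n i e1 e2 h; exists i; split; [exact: (bf_refl H)|exact: h].
- move=> d s g ts IH i e1 e2 /IH[j [ij]] /=.
  case: (evals e1 ts) (evals e2 ts) => [a|] [b|] //= r; last by exists j.
  have [k [jk r']] := bf_func H g r; exists k; split=> //; exact: (bf_trans H) jk.
- by move=> i e1 e2 _; exists i; split=> //; exact: (bf_refl H).
- move=> d s t IHt ts IHts i e1 e2 h /=.
  have [j [ij rt]] := IHt _ _ _ h.
  have [k [jk rts]] := IHts _ _ _ (related_mono ij h).
  exists k; split; first exact: (bf_trans H) jk.
  case: (eval e1 t) (eval e2 t) rt => [a|] [b|] //= rt.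
  case: (evals e1 ts) (evals e2 ts) rts => [as_|] [bs|] //= rts.
  by split=> //; exact: (bf_mono H) rt.
Qed.

Lemma related_update i e1 e2 s x a b :
  related i e1 e2 -> R i a b -> related i (@update S M e1 s x a) (@update S N e2 s x b).
Proof.
move=> h ab t y; have [<-|st] := eqVneq s t.
  by rewrite !updateE; case: eqP => // _; exact: h.
by rewrite !update_neq //; exact: h.
Qed.

(** Assignments stay related at larger indices, so the enlargements made while terms are evaluated
    do no harm. *)
Lemma related_sat f i e1 e2 : related i e1 e2 -> (sat e1 f <-> sat e2 f).
Proof.
elim: f i e1 e2 => [|s t u|d r ts|f IHf g IHg|s x f IH] i e1 e2 h //=.
- have [j [ij]] := related_eval.1 _ t _ _ _ h.
  have [k [jk]] := related_eval.1 _ u _ _ _ (related_mono ij h).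
  case: (eval e1 u) (eval e2 u) => [b1|] [b2|] //=; last first.
    by move=> _ _; split=> -[? []].
  move=> r; case: (eval e1 t) (eval e2 t) => [a1|] [a2|] //=; last first.
    by move=> _; split=> -[? []].
  move=> /(bf_mono H jk) r'; have eqab := bf_eq H r r'.
  by split=> -[? [[<-] [/eqab->]]]; eexists; split.
- have [j [ij]] := related_eval.2 _ ts _ _ _ h.
  case: (evals e1 ts) (evals e2 ts) => [a1|] [a2|] //= r'; last by split=> -[? []].
  have eqr := bf_rel H r r'.
  by split=> -[? [[<-] /eqr ?]]; eexists; split.
- by rewrite (IHf _ _ _ h) (IHg _ _ _ h).
- split=> sf b.
    have [j [a [ij ab]]] := bf_back H i b.
    exact/(IH _ _ _ (related_update x (related_mono ij h) ab))/sf.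
  have [j [a [ij ab]]] := bf_forth H i b.
  exact/(IH _ _ _ (related_update x (related_mono ij h) ab))/sf.
Qed.

Lemma back_and_forth_holds (i : I) f : holds M f <-> holds N f.
Proof. exact: (@related_sat f i). Qed.

End BackAndForth.

(** * Ultraproducts *)

Section Ultraproduct.
Variables (S : signature) (I : Type) (M : I -> structure S) (U : set_system I).
Hypothesis (UU : UltraFilter U) (M_inh : forall i s, inhabited (M i s)).

Local Notation PM s := (forall i, M i s).

(** Elements are the equivalence classes themselves, as sets of functions, so that equality in the
    structure is equality in the logic, which is how [Eq] is interpreted. *)
Definition ultra_carrier (s : sg_sort S) : Type :=
  {A : set (PM s) | exists f, A = [set g | U [set i | f i = g i]]}.

Definition ucls s (f : PM s) : ultra_carrier s :=
  exist _ [set g | U [set i | f i = g i]] (ex_intro _ f erefl).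

Definition urepr s (a : ultra_carrier s) : PM s := projT1 (cid (proj2_sig a)).

Lemma ucls_eq s (f g : PM s) : ucls f = ucls g <-> U [set i | f i = g i].
Proof.
split=> [|fg].
  move=> /(congr1 (fun A => proj1_sig A g)) /= ->.
  by apply: filterS filterT => i _.
apply: eq_exist; rewrite predeqE => h /=; split=> fh.
  by apply: filterS2 fg fh => i /= -> ->.
by apply: filterS2 fg fh => i /= -> ->.
Qed.

Lemma urepr_cls s (f : PM s) : U [set i | urepr (ucls f) i = f i].
Proof.
rewrite /urepr; case: cid => g /= /(congr1 (fun A => A g)) /= e.
have: U [set i | f i = g i] by rewrite e; apply: filterS filterT => i _.
by apply: filterS => i /= ->.
Qed.

Lemma ucls_repr s (a : ultra_carrier s) : ucls (urepr a) = a.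
Proof.
case: a => A ex; rewrite /urepr /=; case: cid => g /= eA.
by apply: eq_exist; rewrite /= eA.
Qed.

Fixpoint hpoint i d : htuple ultra_carrier d -> htuple (M i) d :=
  match d return htuple ultra_carrier d -> htuple (M i) d with
  | [::] => fun _ => tt
  | s :: d' => fun a => (urepr a.1 i, hpoint i a.2)
  end.

Definition ultraproduct : structure S := @Structure S ultra_carrier
  (fun d s g a => ucls (fun i => interp_func g (hpoint i a)))
  (fun d r a => U [set i | interp_rel r (hpoint i a)]).

Definition epoint i (e : assignment ultraproduct) : assignment (M i) :=
  fun s x => omap (fun a => urepr a i) (e s x).

(** Whether a term has a value depends only on which variables are assigned, hence not on the index:
    an undefined value is undefined everywhere, a defined one is matched almost everywhere. *)
Definition onear A (B : I -> Type) (F : forall i, A -> B i -> Prop) (x : option A)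
    (y : forall i, option (B i)) :=
  match x with
  | None => forall i, y i = None
  | Some a => U [set i | exists2 b, y i = Some b & F i a b]
  end.

Lemma eval_ultraproduct (e : assignment ultraproduct) :
  (forall s (t : term (S:=S) s),
    onear (fun i a b => urepr a i = b) (eval e t) (fun i => eval (epoint i e) t)) /\
  (forall d (ts : args (S:=S) d),
    onear (fun i a b => hpoint i a = b) (evals e ts) (fun i => evals (epoint i e) ts)).
Proof.
apply: (@term_args_mutind S
  (fun s t => onear (fun i a b => urepr a i = b) (eval e t) (fun i => eval (epoint i e) t))
  (fun d ts => onear (fun i a b => hpoint i a = b) (evals e ts)
    (fun i => evals (epoint i e) ts))).
- move=> s n /=; rewrite /epoint; case: (e s n) => [a|] //=.
  by apply: filterS filterT => i _; eexists.
- move=> d s g ts /=; case: (evals e ts) => [a|] /= h; last by move=> i; rewrite h.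
  apply: filterS2 (urepr_cls (fun i => interp_func g (hpoint i a))) h => i /= -> [b -> ->] /=.
  by eexists.
- by apply: filterS filterT => i _; eexists.
- move=> d s t + ts /=; case: (eval e t) => [a|] /= ht; last by move=> _ i; rewrite ht.
  case: (evals e ts) => [b|] /= hts.
    by apply: filterS2 ht hts => i /= [? -> <-] [? -> <-]; eexists.
  by move=> i; rewrite hts; case: eval.
Qed.

Lemma epoint_update (e : assignment ultraproduct) s x (a : ultraproduct s) i :
  epoint i (update e x a) = update (epoint i e) x (urepr a i).
Proof.
apply: assignment_ext => t y; rewrite /epoint.
have [<-|st] := eqVneq s t; last by rewrite !update_neq.
by rewrite !updateE; case: eqP.
Qed.

Lemma ultra_not (P : I -> Prop) : U [set i | ~ P i] <-> ~ U [set i | P i].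
Proof.
split=> [h1 h2|h].
  by have /filter_ex[i []] : U ([set i | ~ P i] `&` [set i | P i]) by apply: filterI.
by have [|] := in_ultra_setVsetC [set i | P i] UU.
Qed.

Lemma ultra_imp (P Q : I -> Prop) :
  U [set i | P i -> Q i] <-> (U [set i | P i] -> U [set i | Q i]).
Proof.
split=> [h hP|h]; first by apply: filterS2 h hP => i /= h; apply: h.
have [UP|nP] := pselect (U [set i | P i]).
  by apply: filterS (h UP) => i /= ? _.
by apply: filterS ((ultra_not P).2 nP) => i /= nPi /nPi.
Qed.

Lemma ultra_all s (P : forall i, M i s -> Prop) :
  U [set i | forall x, P i x] <->
  forall a : ultraproduct s, U [set i | P i (urepr a i)].
Proof.
split=> [h a|h]; first by apply: filterS h => i /= h; apply: h.
(* At each index [f] picks a counterexample to [P] if there is one, and an arbitrary element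
   otherwise. *)
have [f hf] : exists f : PM s, forall i, P i (f i) -> forall x, P i x.
  suff ex : forall i, exists x : M i s, P i x -> forall y, P i y.
    by exists (fun i => projT1 (cid (ex i))) => i; case: cid.
  move=> i; have [a0] := M_inh i s.
  have [//|/existsNP[x nP]] := pselect (forall y, P i y); first by exists a0.
  by exists x.
by apply: filterS2 (h (ucls f)) (urepr_cls f) => i /= h1 h2; apply: hf; rewrite -h2.
Qed.

Theorem los (f : formula S) (e : assignment ultraproduct) :
  sat e f <-> U [set i | sat (epoint i e) f].
Proof.
elim: f e => [|s t u|d r ts|f IHf g IHg|s x f IH] e /=.
- by split=> // /filter_ex[].
- have := (eval_ultraproduct e).1 _ t; have := (eval_ultraproduct e).1 _ u.
  case: (eval e u) => [b|] /= hu; last first.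
    move=> _; split=> [[? []]//|h]; have [i /= [c []]] := filter_ex h.
    by rewrite hu.
  case: (eval e t) => [a|] /= ht; last first.
    split=> [[? []]//|h]; have [i /= [c []]] := filter_ex h.
    by rewrite ht.
  split=> [[c [[ac] [bc]]]|h].
    rewrite -ac in bc; rewrite bc in hu.
    by apply: filterS2 ht hu => i /= [? -> <-] [? -> <-]; eexists; split.
  suff -> : a = b by exists b.
  rewrite -(ucls_repr a) -(ucls_repr b); apply/ucls_eq.
  apply: filterS3 ht hu h => i /= [? -> ->] [? -> ->] [c [[->] [->]]] //.
- have := (eval_ultraproduct e).2 _ ts.
  case: (evals e ts) => [a|] /= h; last first.
    split=> [[? []]//|hr]; have [i /= [c []]] := filter_ex hr.
    by rewrite h.
  split=> [[c [[<-] /= hr]]|hr].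
    by apply: filterS2 h hr => i /= [? -> ->] ?; eexists; split.
  exists a; split=> //.
  by apply: filterS2 h hr => i /= [? -> ->] [? [[<-]]].
- by rewrite IHf IHg ultra_imp.
- rewrite (ultra_all (fun i x' => sat (update (epoint i e) x x') f)).
  by split=> h a; have := h a; rewrite IH; apply: filterS => i /=; rewrite epoint_update.
Qed.

Lemma ultraproduct_holds f : holds ultraproduct f <-> U [set i | holds (M i) f].
Proof. exact: los. Qed.

End Ultraproduct.

(* The ultraproduct over the finite lists of sentences of [A] of their finite models. *)
Lemma pseudofinite_compactness S (T A : theory S) :
  (forall l : seq (formula S), List.Forall A l -> exists N : structure S,
     [/\ model T N, finite_structure N, forall s, inhabited (N s) & List.Forall (holds N) l]) ->
  exists M : structure S, [/\ model T M, model A M & forall f, holds M f ->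
    exists N : structure S, [/\ model T N, finite_structure N & holds N f]].
Proof.
move=> fin.
pose I := {l : seq (formula S) | List.Forall A l}.
have /choice[N hN] : forall i : I, exists N : structure S,
    [/\ model T N, finite_structure N, forall s, inhabited (N s)
      & List.Forall (holds N) (sval i)].
  by move=> i; apply: fin; exact: (svalP i).
pose F : set_system I :=
  [set P | exists l0 : I, forall l : I, List.incl (sval l0) (sval l) -> P l].
have FF : ProperFilter F.
  apply: Build_ProperFilter_ex => [P [l0 h]|]; first by exists l0; exact: h.
  split=> [|P Q [l1 h1] [l2 h2]|P Q PQ [l h]].
  - by exists (exist _ [::] (List.Forall_nil _)).
  - have h12 : List.Forall A (sval l1 ++ sval l2).
      by apply/List.Forall_app; split; apply: svalP.
    exists (exist _ _ h12) => l /= h.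
    by split; [apply: h1|apply: h2] => f fi; apply: h; apply/List.in_app_iff; tauto.
  - by exists l => l' /h/PQ.
have [U [UU FU]] := ultraFilterLemma FF.
have inh i s : inhabited (N i s) by have [_ _ /(_ s)] := hN i.
exists (ultraproduct N U); split=> f hf.
- apply/ultraproduct_holds => //; apply: filterS filterT => i _ /=.
  by have [/(_ f hf)] := hN i.
- apply/ultraproduct_holds => //; apply: FU.
  have h1 : List.Forall A [:: f] by constructor.
  exists (exist _ _ h1) => l hl /=; have [_ _ _] := hN l.
  by move/List.Forall_forall; apply; apply: hl; left.
- move: hf => /(ultraproduct_holds UU inh) /filter_ex[i hi].
  by exists (N i); have [] := hN i.
Qed.

(** * Back and forth between fields *)

Definition fzero (F : structure Lring) : F tt := @interp_func Lring F _ _ RZero tt.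
Definition fone (F : structure Lring) : F tt := @interp_func Lring F _ _ ROne tt.
Definition fadd (F : structure Lring) (x y : F tt) : F tt :=
  @interp_func Lring F _ _ RAdd (x, (y, tt)).
Definition fopp (F : structure Lring) (x : F tt) : F tt :=
  @interp_func Lring F _ _ ROpp (x, tt).
Definition fmul (F : structure Lring) (x y : F tt) : F tt :=
  @interp_func Lring F _ _ RMul (x, (y, tt)).

(** Each relation is closed under the ring operations without being enlarged, so values of forms
    computed from related coordinates are related at once. Only a new element calls for a larger
    relation. *)
Record field_system (F1 F2 : structure Lring) (G : (F1 tt -> F2 tt -> Prop) -> Prop) : Prop :=
  FieldSystem {
    fs_ex : exists g, G g;
    fs_zero : forall g, G g -> g (fzero F1) (fzero F2);
    fs_one : forall g, G g -> g (fone F1) (fone F2);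
    fs_add : forall g, G g -> forall a a' b b', g a a' -> g b b' -> g (fadd a b) (fadd a' b');
    fs_opp : forall g, G g -> forall a a', g a a' -> g (fopp a) (fopp a');
    fs_mul : forall g, G g -> forall a a' b b', g a a' -> g b b' -> g (fmul a b) (fmul a' b');
    fs_eq : forall g, G g -> forall a a' b b', g a a' -> g b b' -> (a = b <-> a' = b');
    fs_forth : forall g, G g -> forall a, exists g' a',
      [/\ G g', forall x y, g x y -> g' x y & g' a a'];
    fs_back : forall g, G g -> forall a', exists g' a,
      [/\ G g', forall x y, g x y -> g' x y & g' a a'] }.

Lemma field_system_sym (F1 F2 : structure Lring) (G : (F1 tt -> F2 tt -> Prop) -> Prop) :
  field_system G -> @field_system F2 F1 (fun g => G (fun a b => g b a)).
Proof.
move=> H; split.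
- by have [g] := fs_ex H; exists (fun a b => g b a).
- by move=> g /(fs_zero H).
- by move=> g /(fs_one H).
- by move=> g /(fs_add H) h *; apply: h.
- by move=> g /(fs_opp H) h *; apply: h.
- by move=> g /(fs_mul H) h *; apply: h.
- by move=> g /(fs_eq H) h a a' b b' ga gb; rewrite (h _ _ _ _ ga gb).
- move=> g /(fs_back H) h a; have [g' [a' [? h' ?]]] := h a.
  by exists (fun a b => g' b a), a'; split=> // x y; apply: h'.
- move=> g /(fs_forth H) h a; have [g' [a' [? h' ?]]] := h a.
  by exists (fun a b => g' b a), a'; split=> // x y; apply: h'.
Qed.

(** * Ehrenfeucht-Fraisse games on fields *)

Section EF.
Variables (F1 F2 : structure Lring).

(** Only atoms with at most one operation symbol are compared, so that finitely many formulas
    describe a list of given length; a nested term costs additional rounds. *)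
Definition same_atoms (l : seq (F1 tt * F2 tt)) : Prop :=
  forall x y z, List.In x l -> List.In y l -> List.In z l ->
  [/\ x.1 = y.1 <-> x.2 = y.2, x.1 = fzero F1 <-> x.2 = fzero F2 & x.1 = fone F1 <-> x.2 = fone F2] /\
  [/\ x.1 = fopp y.1 <-> x.2 = fopp y.2, x.1 = fadd y.1 z.1 <-> x.2 = fadd y.2 z.2
    & x.1 = fmul y.1 z.1 <-> x.2 = fmul y.2 z.2].

(* Duplicator wins the [r]-round Ehrenfeucht-Fraisse game from [l]. *)
Fixpoint EFeq r (l : seq (F1 tt * F2 tt)) : Prop :=
  if r is r'.+1 then
    (forall a, exists b, EFeq r' ((a, b) :: l)) /\
    (forall b, exists a, EFeq r' ((a, b) :: l))
  else same_atoms l.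

Lemma EFeq_incl r l l' : List.incl l' l -> EFeq r l -> EFeq r l'.
Proof.
elim: r l l' => [|r IH] l l' sl /=.
  by move=> h x y z /sl ? /sl ? /sl ?; apply: h.
have sl' p : List.incl (p :: l') (p :: l).
  by move=> q [->|/sl]; [left|right].
move=> [h1 h2]; split=> [a|b].
  by have [b hb] := h1 a; exists b; apply: IH hb.
by have [a ha] := h2 b; exists a; apply: IH ha.
Qed.

Lemma EFeq_pred r l : EFeq r.+1 l -> EFeq r l.
Proof.
elim: r l => [|r IH] l.
  move=> [/(_ (fzero F1))[b hb] _]; apply: (@EFeq_incl 0 _ _ _ hb).
  by move=> x ?; right.
move=> [h1 h2]; split=> [a|b].
  by have [b hb] := h1 a; exists b; apply: IH.
by have [a ha] := h2 b; exists a; apply: IH.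
Qed.

Lemma EFeq_le r m l : r <= m -> EFeq m l -> EFeq r l.
Proof.
move=> /subnK <-; elim: (m - r) => // k IH h; apply: IH; exact: EFeq_pred.
Qed.

End EF.

Lemma EFeq_sym (F1 F2 : structure Lring) r (l : seq (F1 tt * F2 tt)) :
  EFeq r l -> EFeq r [seq (p.2, p.1) | p <- l].
Proof.
elim: r l => [|r IH] l /=.
  move=> h x y z /List.in_map_iff[x' [<- /h hx]] /List.in_map_iff[y' [<- /hx hy]].
  by move=> /List.in_map_iff[z' [<- /hy[[? ? ?] [? ? ?]]]] /=; do 2?split; apply: iff_sym.
move=> [h1 h2]; split=> a.
  by have [b /IH] := h2 a; exists b.
by have [b /IH] := h1 a; exists b.
Qed.

(** The list is reversed so that putting an element in front gives a value to the fresh variable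
    [size l] and renames no other. *)
Definition list_env (F : structure Lring) (l : seq (F tt)) : assignment F :=
  fun s x => match s with tt => onth (rev l) x end.

Lemma list_env_cons (F : structure Lring) (a : F tt) l :
  list_env (a :: l) = @update Lring F (list_env l) tt (size l) a.
Proof.
apply: assignment_ext => -[] y; rewrite updateE /= rev_cons -(size_rev l).
by elim: (rev l) y => [|b s IH] [|y] //=; case: y.
Qed.

Fixpoint first_vars m : seq (sg_sort Lring * nat) :=
  if m is m'.+1 then (tt, m') :: first_vars m' else [::].

Lemma mem_first_vars m i : i < m -> ((tt, i) : sg_sort Lring * nat) \in first_vars m.
Proof.
elim: m => // m IH; rewrite ltnS leq_eqVlt inE => /orP[/eqP->|/IH->].
  by rewrite eqxx.
by rewrite orbT.
Qed.

(** The last component selects one of the six clauses of [same_atoms]. *)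
Definition atomic m (t : 'I_m * 'I_m * 'I_m * 'I_6) : formula Lring :=
  let v (i : 'I_m) := Var (S:=Lring) tt i in
  let: (i, j, k, n) := t in
  match nat_of_ord n with
  | 0 => Eq (v i) (v j)
  | 1 => Eq (v i) rzero
  | 2 => Eq (v i) rone
  | 3 => Eq (v i) (ropp (v j))
  | 4 => Eq (v i) (radd (v j) (v k))
  | _ => Eq (v i) (rmul (v j) (v k))
  end.

Lemma atomic_scoped m t : scoped (first_vars m) (@atomic m t).
Proof.
case: t => [[[i j] k] [n lt6]]; rewrite /atomic /=.
by do 6?[case: n lt6 => [|n] lt6 //=]; rewrite !mem_first_vars.
Qed.

Lemma list_envP (F1 F2 : structure Lring) (l : seq (F1 tt * F2 tt)) x : List.In x l ->
  exists i : 'I_(size l), eval (list_env (map fst l)) (Var (S:=Lring) tt i) = Some x.1 /\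
    eval (list_env (map snd l)) (Var (S:=Lring) tt i) = Some x.2.
Proof.
elim: l => // p l IH.
have E1 : list_env (map fst (p :: l)) = _ := list_env_cons p.1 (map fst l).
have E2 : list_env (map snd (p :: l)) = _ := list_env_cons p.2 (map snd l).
rewrite E1 E2; move=> [->|/IH[i [h1 h2]]].
  by exists ord_max; rewrite /= !updateE !size_map eqxx.
by exists (widen_ord (leqnSn _) i); rewrite /= !updateE !size_map eq_sym ltn_eqF.
Qed.

(** Hintikka formulas: if [L] decides the game with one round less on lists with one element more,
    then the existence of an element with a prescribed pattern of truth values on [L] decides the
    present game. *)
Lemma EFeq_formulas r m : exists L : seq (formula Lring),
  List.Forall (scoped (first_vars m)) L /\
  forall (F1 F2 : structure Lring) (l : seq (F1 tt * F2 tt)), size l = m ->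
    List.Forall (fun f => sat (list_env (map fst l)) f <-> sat (list_env (map snd l)) f) L ->
    EFeq r l.
Proof.
elim: r m => [|r IH] m.
  exists [seq atomic t | t <- enum {: 'I_m * 'I_m * 'I_m * 'I_6}]; split.
    by apply/Forall_map_mem => t _; apply: atomic_scoped.
  move=> F1 F2 l szl /Forall_map_mem h x y z; subst m.
  move=> /list_envP[i [i1 i2]] /list_envP[j [j1 j2]] /list_envP[k [k1 k2]].
  have {}h n : sat (list_env (map fst l)) (atomic (i, j, k, n)) <->
      sat (list_env (map snd l)) (atomic (i, j, k, n)) by apply: h; rewrite mem_enum.
  do 2?split.
  - by have := h (inord 0); rewrite /atomic inordK // (sat_Eq i1 j1) (sat_Eq i2 j2).
  - have := h (inord 1); rewrite /atomic inordK //.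
    by rewrite (sat_Eq (b:=fzero _) i1) // (sat_Eq (b:=fzero _) i2).
  - have := h (inord 2); rewrite /atomic inordK //.
    by rewrite (sat_Eq (b:=fone _) i1) // (sat_Eq (b:=fone _) i2).
  - have := h (inord 3); rewrite /atomic inordK //.
    rewrite (sat_Eq (b:=fopp y.1) i1); last by move: j1 => /= ->.
    by rewrite (sat_Eq (b:=fopp y.2) i2) //; move: j2 => /= ->.
  - have := h (inord 4); rewrite /atomic inordK //.
    rewrite (sat_Eq (b:=fadd y.1 z.1) i1); last by move: j1 k1 => /= -> ->.
    by rewrite (sat_Eq (b:=fadd y.2 z.2) i2) //; move: j2 k2 => /= -> ->.
  - have := h (inord 5); rewrite /atomic inordK //.
    rewrite (sat_Eq (b:=fmul y.1 z.1) i1); last by move: j1 k1 => /= -> ->.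
    by rewrite (sat_Eq (b:=fmul y.2 z.2) i2) //; move: j2 k2 => /= -> ->.
have [L [scL hL]] := IH m.+1.
(* There are finitely many patterns [p], and each element realizes one of them, so the new list of
   formulas is again finite. *)
pose patt (p : bitseq) :=
  Conj [seq if fb.2 then fb.1 else Neg fb.1 | fb <- zip L p].
exists [seq Ex (S:=Lring) tt m (patt (tval p)) | p <- enum {: (size L).-tuple bool}]; split.
  apply/Forall_map_mem => p _ /=; rewrite !andbT /patt.
  elim: (L) (tval p) scL => [|f L' IHL] [|b q] //= /List.Forall_cons_iff[scf /IHL scq].
  by rewrite scq; case: b; rewrite /= ?scf ?andbT.
move=> F1 F2 l szl /Forall_map_mem h.
have patP F (e : assignment F) : sat e (patt [seq `[< sat e f >] | f <- L]).
  rewrite /patt; apply/sat_Conj; elim: (L) => [|f L' IHL] /=; first by constructor.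
  by constructor=> //; case: asboolP.
have patE F F' (e : assignment F) (e' : assignment F') :
    sat e' (patt [seq `[< sat e f >] | f <- L]) ->
    List.Forall (fun f => sat e f <-> sat e' f) L.
  rewrite /patt => /sat_Conj; elim: (L) => [|f L' IHL] /=; first by constructor.
  move=> /List.Forall_cons_iff[h1 /IHL h2]; constructor=> //; move: h1.
  by case: asboolP => /=; tauto.
have {}h p : size p = size L -> sat (list_env (map fst l)) (Ex (S:=Lring) tt m (patt p)) <->
    sat (list_env (map snd l)) (Ex (S:=Lring) tt m (patt p)).
  by move=> szp; apply: (h (Tuple (introT eqP szp))); rewrite mem_enum.
split=> [a|b].
  have [|b hb] := (satE _ _ _ _).1 ((h [seq `[< sat (list_env (a :: map fst l)) f >] | f <- L]
    (size_map _ _)).1 _).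
    apply/satE; exists a.
    by rewrite -szl -(size_map fst) -(list_env_cons a); apply: patP.
  exists b; apply: hL; rewrite /= ?szl //.
  move: hb; rewrite -szl -(size_map snd) -(list_env_cons b); exact: patE.
have [|a ha] := (satE _ _ _ _).1 ((h [seq `[< sat (list_env (b :: map snd l)) f >] | f <- L]
  (size_map _ _)).2 _).
  apply/satE; exists b.
  by rewrite -szl -(size_map snd) -(list_env_cons b); apply: patP.
exists a; apply: hL; rewrite /= ?szl //.
move: ha; rewrite -szl -(size_map fst) -(list_env_cons a) => /patE.
by apply: List.Forall_impl => f; tauto.
Qed.

(** One implication suffices: applied to a negation it gives the converse. *)
Lemma elementary_EFeq (F1 F2 : structure Lring) :
  (forall f, sentence f -> holds F1 f -> holds F2 f) -> forall r, @EFeq F1 F2 r [::].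
Proof.
move=> h r; have [L [scL hL]] := EFeq_formulas r 0.
apply: hL => //; apply: List.Forall_impl scL => f scf /=.
have env0 (F : structure Lring) : @list_env F [::] = no_assignment F.
  by apply: assignment_ext => -[] [].
rewrite !env0; split=> [|hf]; first exact: h.
apply: contrapT => nf; have := h (Neg f); rewrite /sentence /= andbT => /(_ scf nf).
exact.
Qed.

(** * Saturation of ultrapowers over the natural numbers *)

Section Saturation.
Variables (F1 F2 : structure Lring) (U : set_system nat).
Hypotheses (UU : UltraFilter U) (U_inf : forall n, U [set i | n <= i]).

Local Notation P1 := (ultraproduct (fun=> F1) U).
Local Notation P2 := (ultraproduct (fun=> F2) U).

Definition points i (l : seq (P1 tt * P2 tt)) : seq (F1 tt * F2 tt) :=
  [seq (urepr p.1 i, urepr p.2 i) | p <- l].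

(** The set of indices may shrink as [r] grows; no single index is asked to win games of every
    length. *)
Definition ultra_EFeq (l : seq (P1 tt * P2 tt)) : Prop :=
  forall r, U [set i | EFeq r (points i l)].

Lemma ultra_EFeq_incl l l' : List.incl l' l -> ultra_EFeq l -> ultra_EFeq l'.
Proof.
move=> sl h r; apply: filterS (h r) => i /=; apply: EFeq_incl.
by move=> _ /List.in_map_iff[p [<- /sl ?]]; apply/List.in_map_iff; exists p.
Qed.

(* At index [i] answer for as many rounds [r <= i] as possible. *)
Lemma ultra_EFeq_forth l a : ultra_EFeq l -> exists b, ultra_EFeq ((a, b) :: l).
Proof.
move=> hl.
have ans i m : exists b, forall r, r <= m -> EFeq r.+1 (points i l) ->
    EFeq r ((urepr a i, b) :: points i l).
  elim: m => [|m [b IH]].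
    have [[h1 _]|n1] := pselect (EFeq 1 (points i l)).
      by have [b hb] := h1 (urepr a i); exists b => r; rewrite leqn0 => /eqP->.
    by exists (fzero F2) => r; rewrite leqn0 => /eqP-> /n1.
  have [[h1 _]|n1] := pselect (EFeq m.+2 (points i l)).
    by have [b' hb] := h1 (urepr a i); exists b' => r /EFeq_le le _; apply: le.
  by exists b => r; rewrite leq_eqVlt => /orP[/eqP-> /n1|/IH].
have /choice[b hb] := fun i => ans i i.
exists (ucls U b) => r.
apply: filterS3 (U_inf r) (hl r.+1) (urepr_cls UU b) => i /= ri hi bi.
by rewrite bi; apply: hb.
Qed.

(** The pairs of a finite list are not closed under the field operations. Forced pairs are: they can
    be added to every extension of [l], and the atoms leave no choice for the partner of a sum, a
    product or an opposite. *)
Definition forced l a b :=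
  forall l', List.incl l l' -> ultra_EFeq l' -> ultra_EFeq ((a, b) :: l').

Definition forced_system (g : P1 tt -> P2 tt -> Prop) :=
  exists2 l, ultra_EFeq l & g = forced l.

Lemma ultra_EFeq_atoms l x y z : ultra_EFeq l ->
  List.In x l -> List.In y l -> List.In z l ->
  [/\ x.1 = y.1 <-> x.2 = y.2, x.1 = fzero P1 <-> x.2 = fzero P2 & x.1 = fone P1 <-> x.2 = fone P2] /\
  [/\ x.1 = fopp y.1 <-> x.2 = fopp y.2, x.1 = fadd y.1 z.1 <-> x.2 = fadd y.2 z.2
    & x.1 = fmul y.1 z.1 <-> x.2 = fmul y.2 z.2].
Proof.
move=> /(_ 0) hl xl yl zl.
have {}hl : U [set i | let X := (urepr x.1 i, urepr x.2 i) in
    let Y := (urepr y.1 i, urepr y.2 i) in let Z := (urepr z.1 i, urepr z.2 i) in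
  [/\ X.1 = Y.1 <-> X.2 = Y.2, X.1 = fzero F1 <-> X.2 = fzero F2 & X.1 = fone F1 <-> X.2 = fone F2] /\
  [/\ X.1 = fopp Y.1 <-> X.2 = fopp Y.2, X.1 = fadd Y.1 Z.1 <-> X.2 = fadd Y.2 Z.2
    & X.1 = fmul Y.1 Z.1 <-> X.2 = fmul Y.2 Z.2]].
  by apply: filterS hl => i; apply; apply/List.in_map_iff; eexists; split.
have eqU (F : structure Lring) (u : ultraproduct (fun=> F) U tt) (f : nat -> F tt) :
    u = ucls U f <-> U [set i | urepr u i = f i].
  by rewrite -{1}(ucls_repr u) ucls_eq.
have eqUU (F : structure Lring) (u v : ultraproduct (fun=> F) U tt) :
    u = v <-> U [set i | urepr u i = urepr v i].
  by rewrite -eqU ucls_repr.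
do 2?split.
- by rewrite !eqUU; split=> h; apply: filterS2 hl h => i /= [[-> _ _] _].
- by rewrite !eqU; split=> h; apply: filterS2 hl h => i /= [[_ -> _] _].
- by rewrite !eqU; split=> h; apply: filterS2 hl h => i /= [[_ _ ->] _].
- by rewrite !eqU; split=> h; apply: filterS2 hl h => i /= [_ [-> _ _]].
- by rewrite !eqU; split=> h; apply: filterS2 hl h => i /= [_ [_ -> _]].
- by rewrite !eqU; split=> h; apply: filterS2 hl h => i /= [_ [_ _ ->]].
Qed.

Lemma forced_intro l a a' : 
  (forall l' b, List.incl l l' -> ultra_EFeq ((a, b) :: l') -> b = a') -> forced l a a'.
Proof.
move=> h l' ll' hl'; have [b hb] := ultra_EFeq_forth a hl'.
by rewrite -(h _ _ ll' hb).
Qed.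

(** Once [(a, a')] has been added, some answer to [f1 a] exists, and by hypothesis it can only be
    [f2 a']; the auxiliary pair is then dropped. *)
Lemma forced_func1 l a a' (f1 : P1 tt -> P1 tt) f2 :
  (forall l' b b', ultra_EFeq l' -> List.In (a, a') l' -> List.In (b, b') l' ->
     b = f1 a -> b' = f2 a') -> 
  forced l a a' -> forced l (f1 a) (f2 a').
Proof.
move=> h fa l' ll' hl'.
have [b hb] := ultra_EFeq_forth (f1 a) (fa _ ll' hl').
have <- : b = f2 a' by apply: (h _ _ _ hb); [right; left|left|].
by apply: ultra_EFeq_incl hb => x [<-|?]; [left|right; right].
Qed.

Lemma forced_func2 l a a' b b' (f1 : P1 tt -> P1 tt -> P1 tt) f2 :
  (forall l' c c', ultra_EFeq l' -> List.In (a, a') l' -> List.In (b, b') l' ->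
     List.In (c, c') l' -> c = f1 a b -> c' = f2 a' b') -> 
  forced l a a' -> forced l b b' -> forced l (f1 a b) (f2 a' b').
Proof.
move=> h fa fb l' ll' hl'.
have hab : ultra_EFeq [:: (b, b'), (a, a') & l'].
  by apply: fb; [move=> x /ll'; right|exact: fa].
have [c hc] := ultra_EFeq_forth (f1 a b) hab.
have <- : c = f2 a' b' by apply: (h _ _ _ hc); [right; right; left|right; left|left|].
by apply: ultra_EFeq_incl hc => x [<-|?]; [left|right; right; right].
Qed.


End Saturation.

Lemma ultra_EFeq_sym (F1 F2 : structure Lring) U l :
  UltraFilter U -> @ultra_EFeq F1 F2 U l -> @ultra_EFeq F2 F1 U [seq (p.2, p.1) | p <- l].
Proof.
move=> UU h r; apply: filterS (h r) => i /= /EFeq_sym.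
by rewrite /points -!map_comp.
Qed.

Lemma ultrapower_field_system (F1 F2 : structure Lring) (U : set_system nat) :
  UltraFilter U -> (forall n, U [set i | n <= i]) -> (forall r, @EFeq F1 F2 r [::]) ->
  field_system (@forced_system F1 F2 U).
Proof.
move=> UU U_inf EF0.
have in1 T (x : T) l : List.In x (x :: l) by left.
have in2 T (x y : T) l : List.In x [:: y, x & l] by right; left.
split.
- by exists (forced [::]); exists [::] => // r; apply: filterS filterT => i _; apply: EF0.
- move=> g [l hl ->]; apply: forced_intro => // l' b _ h.
  by have [[_ /= [e _] _] _] := ultra_EFeq_atoms UU h (in1 _ _ _) (in1 _ _ _) (in1 _ _ _); exact: e.
- move=> g [l hl ->]; apply: forced_intro => // l' b _ h.
  by have [[_ /= _ [e _]] _] := ultra_EFeq_atoms UU h (in1 _ _ _) (in1 _ _ _) (in1 _ _ _); exact: e.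
- move=> g [l hl ->] a a' b b'; apply: forced_func2 => // l' c c' h ina inb inc.
  by have [_ [_ /= -> _]] := ultra_EFeq_atoms UU h inc ina inb.
- move=> g [l hl ->] a a'; apply: forced_func1 => // l' b b' h ina inb.
  by have [_ [/= -> _ _]] := ultra_EFeq_atoms UU h inb ina ina.
- move=> g [l hl ->] a a' b b'; apply: forced_func2 => // l' c c' h ina inb inc.
  by have [_ [_ _ /= ->]] := ultra_EFeq_atoms UU h inc ina inb.
- move=> g [l hl ->] a a' b b' fa fb.
  have h : ultra_EFeq [:: (b, b'), (a, a') & l].
    by apply: fb => [x ?|]; [right|exact: fa].
  by have [[/= -> _ _] _] := ultra_EFeq_atoms UU h (in2 _ _ _ _) (in1 _ _ _) (in1 _ _ _).
- move=> g [l hl ->] a; have [b hb] := ultra_EFeq_forth UU U_inf a hl.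
  exists (forced ((a, b) :: l)), b; split; first by exists ((a, b) :: l).
    by move=> x y fxy l' al'; apply: fxy => z zl; apply: al'; right.
  move=> l' al' hl'; apply: ultra_EFeq_incl hl' => z [<-|//].
  by apply: al'; left.
- move=> g [l hl ->] b.
  have swK : [seq (p.2, p.1) | p <- [seq (p.2, p.1) | p <- l]] = l.
    by elim: (l) => //= -[x y] l' ->.
  have [a /(ultra_EFeq_sym UU)] := ultra_EFeq_forth UU U_inf b (ultra_EFeq_sym UU hl).
  rewrite /= swK => hb; exists (forced ((a, b) :: l)), a; split; first by exists ((a, b) :: l).
    by move=> x y fxy l' al'; apply: fxy => z zl; apply: al'; right.
  move=> l' al' hl'; apply: ultra_EFeq_incl hl' => z [<-|//].
  by apply: al'; left.
Qed.

(** * The axioms of [T0_Q] in a structure *)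

Section Reduct.
Variables (w : bool) (N : structure (LQ w)).

Fixpoint K_htuple (d : seq unit) : htuple (fun=> N K) d -> htuple N [seq K | _ <- d] :=
  match d return htuple (fun=> N K) d -> htuple N [seq K | _ <- d] with
  | [::] => fun _ => tt
  | _ :: d' => fun a => (a.1, K_htuple a.2)
  end.

Definition Kred : structure Lring := @Structure Lring (fun=> N K)
  (fun d s g a => @interp_func (LQ w) N _ _ (KRing w g) (K_htuple a))
  (fun d r => match r with end).

Definition Kred_env (e : assignment N) : assignment Kred := fun=> e K.

Lemma eval_K (e : assignment N) :
  (forall s (t : term (S:=Lring) s), eval e (K_term w t) = eval (Kred_env e) t) /\
  (forall d (ts : args (S:=Lring) d),
    evals e (K_args w ts) = omap (@K_htuple d) (evals (Kred_env e) ts)).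
Proof.
apply: (@term_args_mutind Lring
  (fun s t => eval e (K_term w t) = eval (Kred_env e) t)
  (fun d ts => evals e (K_args w ts) = omap (@K_htuple d) (evals (Kred_env e) ts))) => //=.
- by move=> d s g ts ->; case: evals.
- by move=> d s t -> ts ->; case: eval => //= a; case: evals.
Qed.

Lemma sat_K f (e : assignment N) : sat e (K_formula w f) <-> sat (Kred_env e) f.
Proof.
elim: f e => [|s t u|d []|f IHf g IHg|s x f IH] e //=.
- by rewrite !(eval_K e).1.
- by rewrite IHf IHg.
- have E (a : N K) : Kred_env (update e x a) = @update Lring Kred (Kred_env e) s x a.
    by apply: assignment_ext => -[] y; case: s; rewrite /Kred_env !updateE.
  by split=> h a; move: (h a); rewrite IH E.
Qed.

Lemma holds_K f : holds N (K_formula w f) <-> holds Kred f.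
Proof. exact: sat_K. Qed.

Lemma model_K T : model (K_theory (w:=w) T) N <-> model T Kred.
Proof.
split=> h f; first by move=> Tf; apply/holds_K/h; exists f.
by move=> [g Tg <-]; apply/holds_K/h.
Qed.

Definition vz : N V := @interp_func (LQ w) N _ _ (VZero w) tt.
Definition va (x y : N V) : N V := @interp_func (LQ w) N _ _ (VAdd w) (x, (y, tt)).
Definition vo (x : N V) : N V := @interp_func (LQ w) N _ _ (VOpp w) (x, tt).
Definition vs (a : N K) (x : N V) : N V := @interp_func (LQ w) N _ _ (Scale w) (a, (x, tt)).
Definition bv (x y : N V) : N K := @interp_func (LQ w) N _ _ (BetaV w) (x, (y, tt)).
Definition qa (q : N Q) (x : N V) : N Q := @interp_func (LQ w) N _ _ (QAdd w) (q, (x, tt)).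
Definition qs (q q' : N Q) : N V := @interp_func (LQ w) N _ _ (QSub w) (q, (q', tt)).
Definition bq (q : N Q) (x : N V) : N K := @interp_func (LQ w) N _ _ (BetaQ w) (q, (x, tt)).
Definition om (ww : w) (q : N Q) : N K := @interp_func (LQ w) N _ _ (Omega ww) (q, tt).
Definition lin (a : nat -> N K) (t : nat -> N V) n : N V :=
  foldr (fun i u => va (vs (a i) (t i)) u) vz (iota 0 n).

Definition rindep n (t : nat -> N V) : Prop :=
  forall a, lin a t n = vz -> forall i, i < n -> a i = fzero Kred.

Local Notation k0 := (fzero Kred).
Local Notation k1 := (fone Kred).
Local Notation "x +k y" := (@fadd Kred x y) (at level 50, left associativity).
Local Notation "x *k y" := (@fmul Kred x y) (at level 40, left associativity).

(** Tuples are given as functions on [nat] of which an initial segment is read, so that [t_theta]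
    and [t_pi] speak of the same sums [lin] for all lengths. *)
Record T0_Q_sem : Prop := T0QSem {
  t_field : model field_theory Kred;
  t_char2 : holds Kred char2;
  t_vaA : forall x y z, va x (va y z) = va (va x y) z;
  t_vaC : forall x y, va x y = va y x;
  t_va0 : forall x, va vz x = x;
  t_vaN : forall x, va (vo x) x = vz;
  t_vsA : forall a b x, vs a (vs b x) = vs (a *k b) x;
  t_vs1 : forall x, vs k1 x = x;
  t_vsDr : forall a x y, vs a (va x y) = va (vs a x) (vs a y);
  t_vsDl : forall a b x, vs (a +k b) x = va (vs a x) (vs b x);
  t_theta : forall n (t : nat -> N V),
    @interp_rel (LQ w) N _ (Theta n) (hmk (A:=N) n.+1 t) <-> rindep n.+1 t;
  t_pi : forall n (i : 'I_n.+1) (t : nat -> N V),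
    let p := @interp_func (LQ w) N _ _ (Pi w i) (hmk (A:=N) n.+2 t) in
    (forall a, rindep n.+1 t -> t n.+1 = lin a t n.+1 -> p = a i) /\
    (~ (exists a, rindep n.+1 t /\ t n.+1 = lin a t n.+1) -> p = k0);
  t_bvl : forall a x y z, bv (va (vs a x) y) z = a *k bv x z +k bv y z;
  t_bvr : forall a x y z, bv z (va (vs a x) y) = a *k bv z x +k bv z y;
  t_bvxx : forall x, bv x x = k0;
  t_bvnd : forall x, (forall y, bv x y = k0) -> x = vz;
  t_bqZ : forall q a x, bq q (vs a x) = a *k a *k bq q x;
  t_bqD : forall q x y, bq q (va x y) = bq q x +k bq q y +k bv x y;
  t_qa0 : forall q, qa q vz = q;
  t_qaA : forall q x y, qa q (va x y) = qa (qa q x) y;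
  t_qareg : forall q q', exists x, qa q x = q' /\ forall y, qa q y = q' -> y = x;
  t_bqa : forall q x y, bq (qa q x) y = bq q y +k bv x y *k bv x y;
  t_qs : forall q q' x, x = qs q q' <-> qa q' x = q }.

Lemma K_inh : inhabited (N K). Proof. exact: (inhabits k0). Qed.
Lemma V_inh : inhabited (N V). Proof. exact: (inhabits vz). Qed.

Lemma eval_lincomb (e : assignment N) n (ta : nat -> term (S:=LQ w) K)
    (tv : nat -> term (S:=LQ w) V) a x :
  (forall i, i < n -> eval e (ta i) = Some (a i)) ->
  (forall i, i < n -> eval e (tv i) = Some (x i)) ->
  eval e (lincomb n ta tv) = Some (lin a x n).
Proof.
rewrite /lincomb /lin => ha hx.
have: forall i, i \in iota 0 n -> i < n by move=> i; rewrite mem_iota.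
elim: (iota 0 n) => [|i s IH] //= h.
rewrite ha ?h ?mem_head //= hx ?h ?mem_head //= IH // => j js.
by apply: h; rewrite inE js orbT.
Qed.

Lemma sat_theta (e : assignment N) n x : (forall i, i < n.+1 -> e V i = Some (x i)) ->
  sat e (theta n (Var (S:=LQ w) V)) <-> @interp_rel (LQ w) N _ (Theta n) (hmk (A:=N) n.+1 x).
Proof. by move=> h; apply: sat_Rel; apply: evals_nargs. Qed.

Lemma sat_indep (e : assignment N) n (t : nat -> N V) :
  (forall i, i < n.+1 -> e V i = Some (t i)) ->
  (forall a, lin a t n.+1 = vz -> forall i, i < n.+1 -> a i = k0) <->
  sat e (Alls (S:=LQ w) K (iota 0 n.+1)
      (Imp (Eq (lincomb n.+1 (Var (S:=LQ w) K) (Var (S:=LQ w) V)) (vzero w))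
        (Conj [seq Eq (Var (S:=LQ w) K i) (kzero w) | i <- iota 0 n.+1]))).
Proof.
move=> et; rewrite sat_Alls ?iota_uniq //; last exact: K_inh.
have E a : (lin a t n.+1 = vz -> forall i, i < n.+1 -> a i = k0) <->
    sat (updates e (iota 0 n.+1) a)
      (Imp (Eq (lincomb n.+1 (Var (S:=LQ w) K) (Var (S:=LQ w) V)) (vzero w))
        (Conj [seq Eq (Var (S:=LQ w) K i) (kzero w) | i <- iota 0 n.+1])).
  rewrite satImp sat_Conj_map (@sat_Eq _ _ _ _ _ _ (lin a t n.+1) vz) //; last first.
    apply: eval_lincomb => i lti; rewrite evalV; last by rewrite updates_neq // et.
    by rewrite updatesE mem_iota0 lti.
  have Ei i : i < n.+1 -> sat (updates e (iota 0 n.+1) a)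
      (Eq (Var (S:=LQ w) K i) (kzero w)) <-> a i = k0.
    by move=> lti; apply: sat_Eq; rewrite ?evalV ?updatesE ?mem_iota0 ?lti.
  split=> h /h {}h i; first by rewrite mem_iota0 => lti; apply/(Ei i lti)/h.
  by move=> lti; apply/(Ei i lti); apply: h; rewrite mem_iota0.
by split=> h a; apply/E/h.
Qed.

Lemma theta_axiomP n : holds N (theta_axiom w n) <->
  forall t : nat -> N V,
    @interp_rel (LQ w) N _ (Theta n) (hmk (A:=N) n.+1 t) <-> rindep n.+1 t.
Proof.
rewrite /holds /theta_axiom sat_Alls ?iota_uniq //; last exact: V_inh.
have et t i : i < n.+1 -> updates (no_assignment N) (iota 0 n.+1) t V i = Some (t i).
  by move=> lti; rewrite updatesE mem_iota0 lti.
split=> h t; have := h t; rewrite satI (sat_theta (@et t)).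
  by rewrite -(sat_indep (@et t)).
by rewrite -(sat_indep (@et t)).
Qed.

(** The axiom for [pi] expresses independence through the symbol [theta], whose meaning is supplied
    by the axiom for [theta]. *)
Lemma pi_axiomP n (i : 'I_n.+1) : holds N (theta_axiom w n) -> holds N (pi_axiom w i) <->
  forall t : nat -> N V,
    let p := @interp_func (LQ w) N _ _ (Pi w i) (hmk (A:=N) n.+2 t) in
    (forall a, rindep n.+1 t -> t n.+1 = lin a t n.+1 -> p = a i) /\
    (~ (exists a, rindep n.+1 t /\ t n.+1 = lin a t n.+1) -> p = k0).
Proof.
move=> /theta_axiomP thP.
rewrite /holds /pi_axiom sat_Alls ?iota_uniq //; last exact: V_inh.
set c := And (theta n _) _; set u := Var (S:=LQ w) V n.+1; set P := Defs.pi _ _ _.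
suff E t p : p = @interp_func (LQ w) N _ _ (Pi w i) (hmk (A:=N) n.+2 t) ->
    sat (updates (no_assignment N) (iota 0 n.+2) t)
    (And (Alls (S:=LQ w) K (iota 0 n.+1) (Imp c (Eq P (Var (S:=LQ w) K i))))
      (Imp (Neg (Exs (S:=LQ w) K (iota 0 n.+1) c)) (Eq P (kzero w)))) <->
    (forall a, rindep n.+1 t -> t n.+1 = lin a t n.+1 -> p = a i) /\
    (~ (exists a, rindep n.+1 t /\ t n.+1 = lin a t n.+1) -> p = k0).
  by split=> h t; apply/(E t _ erefl).
move=> def_p; set e := updates _ _ _.
have et j : j < n.+2 -> e V j = Some (t j).
  by move=> ltj; rewrite /e updatesE mem_iota0 ltj.
have eat (a : nat -> N K) j : j < n.+2 -> updates e (iota 0 n.+1) a V j = Some (t j).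
  by move=> ltj; rewrite updates_neq // et.
have eaa (a : nat -> N K) j : j < n.+1 -> updates e (iota 0 n.+1) a K j = Some (a j).
  by move=> ltj; rewrite updatesE mem_iota0 ltj.
have cP a : sat (updates e (iota 0 n.+1) a) c <-> rindep n.+1 t /\ t n.+1 = lin a t n.+1.
  rewrite satA (@sat_theta _ _ t); last by move=> j ltj; apply: eat; apply: ltnW.
  rewrite thP (@sat_Eq _ _ _ _ _ _ (t n.+1) (lin a t n.+1)) //; first exact: eat.
  by apply: eval_lincomb => j ltj; [apply: eaa|apply: eat; apply: ltnW].
have evP (e' : assignment N) : (forall j, j < n.+2 -> e' V j = Some (t j)) -> eval e' P = Some p.
  move=> e't; rewrite /P /Defs.pi def_p.
  apply: eval_App; apply: evals_nargs => j ltj; case: ifP => ltjn; rewrite evalV e't //.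
  by congr (Some (t _)); apply/eqP; rewrite eqn_leq ltnNge ltjn.
rewrite satA satImp satN (@sat_Exs _ N e K _ c K_inh (iota_uniq _ _)).
rewrite (@sat_Alls _ N e K _ _ K_inh (iota_uniq _ _)).
have -> : sat e (Eq P (kzero w)) <-> p = k0 by apply: sat_Eq => //; apply: evP.
have -> : (exists a : nat -> N K, sat (updates e (iota 0 n.+1) a) c) <->
    exists a, rindep n.+1 t /\ t n.+1 = lin a t n.+1.
  by split=> -[a ca]; exists a; apply/cP.
have evi (a : nat -> N K) : sat (updates e (iota 0 n.+1) a) (Eq P (Var (S:=LQ w) K i)) <-> p = a i.
  by apply: sat_Eq; [apply: evP; exact: eat|rewrite evalV eaa].
split=> -[h1 h2]; split=> // a; have := h1 a.
  by rewrite satImp cP evi => h *; apply: h.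
by rewrite satImp cP evi => h [*]; apply: h.
Qed.

Lemma model_setU S (M : structure S) (A B : theory S) :
  model (A `|` B) M <-> model A M /\ model B M.
Proof.
split=> [h|[hA hB] f [/hA|/hB]//].
by split=> f hf; apply: h; [left|right].
Qed.

Lemma model_In S (M : structure S) l :
  model [set f | List.In f l] M <-> List.Forall (holds M) l.
Proof. by rewrite List.Forall_forall. Qed.

Lemma Forall_app_iff T (P : T -> Prop) l1 l2 :
  List.Forall P (l1 ++ l2) <-> List.Forall P l1 /\ List.Forall P l2.
Proof. exact: List.Forall_app. Qed.

Local Ltac unfold_vars := rewrite /= ?(updateE, update_neq) //=.
Local Ltac by_equation := unfold_vars; case=> ? [[<-] []]; let h := fresh in move=> h; exact: (esym h).

Local Ltac by_sem eqn h := eapply eqn; [exact: h|unfold_vars; reflexivity|unfold_vars; reflexivity].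

Lemma T0_Q_sem_of_model : model (T0_Q w) N -> T0_Q_sem.
Proof.
move=> /model_setU[/model_setU[/model_setU[/model_setU[/model_setU[/model_K hF hv] hth] hpi] hc] hq].
move: hv => /model_In /List.Forall_cons_iff[v1 /List.Forall_cons_iff[v2 /List.Forall_cons_iff[v3 /List.Forall_cons_iff[v4 /List.Forall_cons_iff[v5 /List.Forall_cons_iff[v6 /List.Forall_cons_iff[v7 /List.Forall_cons_iff[v8 _]]]]]]]].
move: hq => /model_In /Forall_app_iff[+ /Forall_app_iff[]].
move=> /List.Forall_cons_iff[b1 /List.Forall_cons_iff[b2 /List.Forall_cons_iff[b3 /List.Forall_cons_iff[b4 _]]]].
move=> /List.Forall_cons_iff[q1 /List.Forall_cons_iff[q2 _]].
move=> /List.Forall_cons_iff[a1 /List.Forall_cons_iff[a2 /List.Forall_cons_iff[a3 /List.Forall_cons_iff[a4 /List.Forall_cons_iff[a5 _]]]]].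
have thP n : holds N (theta_axiom w n) by apply: hth; exists n.
split.
- by [].
- by move/model_K: hc; apply.
- by move=> x y z; have := v1 x y z; by_equation.
- by move=> x y; have := v2 x y; by_equation.
- by move=> x; have := v3 x; by_equation.
- by move=> x; have := v4 x; by_equation.
- by move=> a b x; have := v5 a b x; by_equation.
- by move=> x; have := v6 x; by_equation.
- by move=> a x y; have := v7 a x y; by_equation.
- by move=> a b x; have := v8 a b x; by_equation.
- by move=> n; apply/theta_axiomP.
- by move=> n i; apply/(pi_axiomP i (thP n)); apply: hpi; exists n, i.
- by move=> a x y z; have := b1 a x y z; by_equation.
- by move=> a x y z; have := b2 a x y z; by_equation.
- by move=> x; have := b3 x; by_equation.
- move=> x h; have [|? []] := b4 x.
    by move=> y; unfold_vars; exists k0; split=> //; congr Some; exact: h.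
  by unfold_vars => -[<-] [].
- by move=> q a x; have := q1 q a x; by_equation.
- by move=> q x y; have := q2 q x y; by_equation.
- by move=> q; have := a1 q; by_equation.
- by move=> q x y; have := a2 q x y; by_equation.
- move=> q q'; rewrite /holds in a3; move/sat_Alls_cons: a3 => /(_ q) /sat_Alls_cons /(_ q') /sat_Alls_nil /sat_Exs1[x /satA[+ hx]].
  unfold_vars => -[? [[<-] [e]]]; exists x; split=> // y qy.
  have [|? []] := hx y.
    by unfold_vars; exists q'; split=> //; congr Some.
  by unfold_vars => -[<-] [].
- by move=> q x y; have := a4 q x y; by_equation.
- move=> q q' x; rewrite /holds in a5; move/sat_Alls_cons: a5 => /(_ q) /sat_Alls_cons /(_ q') /sat_Alls_nil.
  move=> /sat_Alls_cons /(_ x) /sat_Alls_nil /satI.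
  rewrite (@sat_Eq _ _ _ _ _ _ x (qs q q')); [|by unfold_vars|by unfold_vars].
  by rewrite (@sat_Eq _ _ _ _ _ _ (qa q' x) q); [|by unfold_vars|by unfold_vars].
Qed.

Lemma T0_Q_model_of_sem : T0_Q_sem -> model (T0_Q w) N.
Proof.
case=> hF hc v1 v2 v3 v4 v5 v6 v7 v8 hth hpi b1 b2 b3 b4 q1 q2 a1 a2 a3 a4 a5.
have thP n : holds N (theta_axiom w n) by apply/theta_axiomP.
have eqn s (e : assignment N) (t u : term s) a b : a = b -> eval e t = Some a ->
  eval e u = Some b -> sat e (Eq t u) by move=> ab ht hu; apply/(sat_Eq ht hu).
suff [] : model (T0_VK w) N /\ model [set f | List.In f (betaV_axioms w ++ betaQ_axioms w ++ action_axioms w)] N.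
  by move=> h1 h2; apply/model_setU; split=> //; apply/model_setU; split=> //; apply/model_K => _ ->.
split.
  apply/model_setU; split; first (apply/model_setU; split; first (apply/model_setU; split)).
- exact/model_K.
- apply/model_In.
  apply: List.Forall_cons; first by move=> x y z; by_sem eqn (v1 x y z).
  apply: List.Forall_cons; first by move=> x y; by_sem eqn (v2 x y).
  apply: List.Forall_cons; first by move=> x; by_sem eqn (v3 x).
  apply: List.Forall_cons; first by move=> x; by_sem eqn (v4 x).
  apply: List.Forall_cons; first by move=> a b x; by_sem eqn (v5 a b x).
  apply: List.Forall_cons; first by move=> x; by_sem eqn (v6 x).
  apply: List.Forall_cons; first by move=> a x y; by_sem eqn (v7 a x y).
  apply: List.Forall_cons; first by move=> a b x; by_sem eqn (v8 a b x).
  exact: List.Forall_nil.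
- by move=> _ [n _ <-].
- by move=> _ [n [i ->]]; apply/(pi_axiomP i (thP n)); exact: hpi.
- apply/model_In.
  apply: List.Forall_cons; first by move=> a x y z; by_sem eqn (b1 a x y z).
  apply: List.Forall_cons; first by move=> a x y z; by_sem eqn (b2 a x y z).
  apply: List.Forall_cons; first by move=> x; by_sem eqn (b3 x).
  apply: List.Forall_cons; first by 
    move=> x h; apply: (eqn _ _ _ _ x vz); unfold_vars; apply: b4 => y;
    by have := h y; unfold_vars => -[? [[<-] []]].
  apply: List.Forall_cons; first by move=> q a x; by_sem eqn (q1 q a x).
  apply: List.Forall_cons; first by move=> q x y; by_sem eqn (q2 q x y).
  apply: List.Forall_cons; first by move=> q; by_sem eqn (a1 q).
  apply: List.Forall_cons; first by move=> q x y; by_sem eqn (a2 q x y).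
  apply: List.Forall_cons; first by 
    apply/sat_Alls_cons => q; apply/sat_Alls_cons => q'; apply/sat_Alls_nil/sat_Exs1;
    have [x [qx hx]] := a3 q q'; exists x; apply/satA; split; [by_sem eqn qx|];
    move=> y hy; apply: (eqn _ _ _ _ y x); unfold_vars; apply: hx;
    by move: hy; unfold_vars => -[? [[<-] []]].
  apply: List.Forall_cons; first by move=> q x y; by_sem eqn (a4 q x y).
  apply: List.Forall_cons; first by 
    apply/sat_Alls_cons => q; apply/sat_Alls_cons => q'; apply/sat_Alls_nil/sat_Alls_cons => x;
    apply/sat_Alls_nil/satI;
    have hq := a5 q q' x; split=> h;
    [have e : x = qs q q'|have e : qa q' x = q];
    [by move: h; unfold_vars => -[? [[<-] []]]|by_sem eqn (hq.1 e)
    |by move: h; unfold_vars => -[? [[<-] []]]|by_sem eqn (hq.2 e)].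
  exact: List.Forall_nil.
Qed.

Lemma T0_QP : model (T0_Q w) N <-> T0_Q_sem.
Proof. by split; [exact: T0_Q_sem_of_model|exact: T0_Q_model_of_sem]. Qed.

End Reduct.

(** * Meaning of the sentences on cardinality, dimension, hyperbolic planes and [omega] *)

Section GenericSentences.
Variables (S : signature) (M : structure S) (s : sg_sort S).

Lemma nonemptyP : holds M (nonempty s) <-> inhabited (M s).
Proof. by rewrite /holds satE; split=> [[a _]|[a]]; [exact: inhabits a|exists a]. Qed.

Lemma card_eqP n : inhabited (M s) -> holds M (card_eq s n) <->
  exists a : nat -> M s, (forall i j, i < n -> j < n -> i != j -> a i <> a j) /\
    forall x, exists2 i, i < n & x = a i.
Proof.
move=> inh; rewrite /holds /card_eq sat_Exs ?iota_uniq //.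
have ea a i : i < n ->
    eval (@updates S M (no_assignment M) s (iota 0 n) a) (Var s i) = Some (a i).
  by move=> lti; rewrite evalV updatesE mem_iota0 lti.
have E (a : nat -> M s) : sat (updates (no_assignment M) (iota 0 n) a)
    (Conj [seq Neg (Eq (Var s ij.1) (Var s ij.2)) |
        ij <- [seq (i, j) | i <- iota 0 n, j <- iota 0 n] & ij.1 != ij.2]) <->
    (forall i j, i < n -> j < n -> i != j -> a i <> a j).
  rewrite sat_Conj_map; split=> h.
    move=> i j lti ltj ij; have := h (i, j).
    rewrite mem_filter /= ij => /(_ _) h1.
    have {}h1 : sat (updates (no_assignment M) (iota 0 n) a) (Neg (Eq (Var s i) (Var s j))).
      by apply: h1; apply/allpairsP; exists (i, j); rewrite !mem_iota0.
    by move=> aij; move/satN: h1; apply; apply/(sat_Eq (ea a i lti) (ea a j ltj)).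
  move=> ij; rewrite mem_filter => /andP[ne /allpairsP[[i j] /= [+ + eij]]].
  rewrite eij /= in ne; rewrite !mem_iota0 => lti ltj.
  rewrite eij => h1; apply: (h i j lti ltj ne).
  by apply/(sat_Eq (ea a i lti) (ea a j ltj)); exact: h1.
have E2 (a : nat -> M s) : sat (updates (no_assignment M) (iota 0 n) a)
    (All s n (Disj [seq Eq (Var s n) (Var s i) | i <- iota 0 n])) <->
    (forall x, exists2 i, i < n & x = a i).
  have Ei x i : i < n -> sat (update (updates (no_assignment M) (iota 0 n) a) n x)
      (Eq (Var s n) (Var s i)) <-> x = a i.
    move=> lti; apply: sat_Eq; rewrite evalV updateE ?eqxx // gtn_eqF //.
    by rewrite -[LHS]evalV ea.
  rewrite satAll; split=> h x; have := h x; rewrite sat_Disj_map => -[i].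
    by rewrite mem_iota0 => lti /(Ei x i lti); exists i.
  by move=> lti xi; exists i; [rewrite mem_iota0|apply/(Ei x i lti)].
split=> -[a].
  by rewrite satA E E2; exists a.
by move=> h; exists a; rewrite satA E E2.
Qed.

End GenericSentences.

Section Sentences.
Variables (w : bool) (N : structure (LQ w)) (H : T0_Q_sem N).

Local Notation k0 := (fzero (Kred N)).
Local Notation k1 := (fone (Kred N)).
Local Notation v := (Var (S:=LQ w) V).
Local Notation q := (Var (S:=LQ w) Q).

Lemma sat_indep_vars (e : assignment N) n (t : nat -> N V) :
  (forall i, i < n -> e V i = Some (t i)) -> sat e (indep n v) <-> @rindep w N n t.
Proof.
case: n => [|n] et; first by split=> [_ a _ i|_ []]; rewrite ?ltn0.
by rewrite [indep _ _]/= (sat_theta et) (t_theta H).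
Qed.

Lemma dim_geP n : holds N (dim_ge w n) <-> exists t, @rindep w N n t.
Proof.
rewrite /holds /dim_ge (@sat_Exs _ N _ V _ _ (V_inh N) (iota_uniq _ _)).
have E t : sat (updates (no_assignment N) (iota 0 n) t) (indep n v) <-> @rindep w N n t.
  by apply: sat_indep_vars => i lti; rewrite updatesE mem_iota0 lti.
by split=> -[t /E]; exists t.
Qed.

Lemma dim_eqP n : holds N (dim_eq w n) <->
  (exists t, @rindep w N n t) /\ ~ (exists t, @rindep w N n.+1 t).
Proof. by rewrite /holds /dim_eq satA satN -!/(holds _ _) !dim_geP. Qed.

Definition hyperbolic_sum n (a : N Q) : Prop := exists t : nat -> N V,
  [/\ @rindep w N (2 * n) t,
      forall i, i < n -> [/\ bq a (t i) = k0, bq a (t (n + i)) = k0 & bv (t i) (t (n + i)) = k1]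
    & forall i j, i < n -> j < n -> i != j ->
      [/\ bv (t i) (t j) = k0, bv (t i) (t (n + j)) = k0 & bv (t (n + i)) (t (n + j)) = k0]].

Lemma sum_of_hyperbolic_planesP n (a : N Q) :
  sat (update (no_assignment N) 0 a) (sum_of_hyperbolic_planes w n) <-> hyperbolic_sum n a.
Proof.
rewrite /sum_of_hyperbolic_planes (@sat_Exs _ N _ V _ _ (V_inh N) (iota_uniq _ _)).
set f1 := fun i : nat => And _ _; set f2 := fun ij : nat * nat => And _ _.
suff E t : sat (updates (update (no_assignment N) 0 a) (iota 0 (2 * n)) t)
    (And (indep (2 * n) v) (And (Conj [seq f1 i | i <- iota 0 n])
       (Conj [seq f2 ij | ij <- [seq (i, j) | i <- iota 0 n, j <- iota 0 n] & ij.1 != ij.2]))) <->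
  [/\ @rindep w N (2 * n) t,
      forall i, i < n -> [/\ bq a (t i) = k0, bq a (t (n + i)) = k0 & bv (t i) (t (n + i)) = k1]
    & forall i j, i < n -> j < n -> i != j ->
      [/\ bv (t i) (t j) = k0, bv (t i) (t (n + j)) = k0 & bv (t (n + i)) (t (n + j)) = k0]].
  by split=> -[t /E]; exists t.
set e := updates _ _ _.
have e1 i : i < n -> e V i = Some (t i).
  by move=> lti; rewrite /e updatesE mem_iota0 mul2n -addnn ltn_addr.
have e2 i : i < n -> e V (n + i) = Some (t (n + i)).
  by move=> lti; rewrite /e updatesE mem_iota0 mul2n -addnn ltn_add2l lti.
have eq : e Q 0 = Some a by rewrite /e updates_neq // updateE.
have evb x y t1 t2 : eval e t1 = Some x -> eval e t2 = Some y ->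
    eval e (betaV (w:=w) t1 t2) = Some (bv x y) by move=> /= -> ->.
have evq y t2 : eval e t2 = Some y ->
    eval e (betaQ (w:=w) (q 0) t2) = Some (bq a y) by move=> /= ->; rewrite eq.
have E1 i : i < n -> sat e (f1 i) <->
    [/\ bq a (t i) = k0, bq a (t (n + i)) = k0 & bv (t i) (t (n + i)) = k1].
  move=> lti; rewrite /f1 !satA.
  rewrite (@sat_Eq _ _ e _ _ _ _ k0 (evq _ (v i) (e1 i lti))) //.
  rewrite (@sat_Eq _ _ e _ _ _ _ k0 (evq _ (v (n + i)) (e2 i lti))) //.
  rewrite (@sat_Eq _ _ e _ _ _ _ k1 (evb _ _ (v i) (v (n + i)) (e1 i lti) (e2 i lti))) //.
  by split=> [[? []]|[]].
have E2 i j : i < n -> j < n -> sat e (f2 (i, j)) <->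
    [/\ bv (t i) (t j) = k0, bv (t i) (t (n + j)) = k0 & bv (t (n + i)) (t (n + j)) = k0].
  move=> lti ltj; rewrite /f2 !satA.
  rewrite (@sat_Eq _ _ e _ _ _ _ k0 (evb _ _ (v i) (v j) (e1 i lti) (e1 j ltj))) //.
  rewrite (@sat_Eq _ _ e _ _ _ _ k0 (evb _ _ (v i) (v (n + j)) (e1 i lti) (e2 j ltj))) //.
  rewrite (@sat_Eq _ _ e _ _ _ _ k0 (evb _ _ (v (n + i)) (v (n + j)) (e2 i lti) (e2 j ltj))) //.
  by split=> [[? []]|[]].
rewrite !satA (@sat_indep_vars _ _ t); last first.
  by move=> i lti; rewrite /e updatesE mem_iota0 lti.
rewrite !sat_Conj_map; split=> [[h1 [h2 h3]]|[h1 h2 h3]].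
  split=> // [i lti|i j lti ltj ij]; first by apply/(E1 i lti)/h2; rewrite mem_iota0.
  apply/(E2 i j lti ltj)/h3; rewrite mem_filter ij.
  by apply/allpairsP; exists (i, j); rewrite !mem_iota0.
split=> //; split=> [i|ij]; first by rewrite mem_iota0 => lti; apply/(E1 i lti)/h2.
rewrite mem_filter => /andP[ne /allpairsP[[i j] /= [+ + eij]]].
rewrite eij /= in ne *; rewrite !mem_iota0 => lti ltj.
by apply/(E2 i j lti ltj)/h3.
Qed.

Section OmegaAxioms.
Variable ww : w.

Definition omega_sem : Prop :=
  (forall a : N Q, om ww a = k0 \/ om ww a = k1) /\
  forall a b : N Q, om ww a = om ww b <->
    exists t : N K, bq a (qs a b) = @fadd (Kred N) (@fmul (Kred N) t t) (@fopp (Kred N) t).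

Lemma omega_axiomsP : model [set f | List.In f (omega_axioms ww)] N <-> omega_sem.
Proof.
rewrite model_In /omega_axioms !List.Forall_cons_iff.
have E1 : holds N (Alls (S:=LQ w) Q [:: 0] (Or (Eq (omega ww (q 0)) (kzero w)) (Eq (omega ww (q 0)) (kone w))))
    <-> forall a : N Q, om ww a = k0 \/ om ww a = k1.
  have E a : sat (update (no_assignment N) 0 a)
      (Or (Eq (omega ww (q 0)) (kzero w)) (Eq (omega ww (q 0)) (kone w))) <->
      om ww a = k0 \/ om ww a = k1.
    have ev : eval (update (no_assignment N) 0 a) (omega ww (q 0)) = Some (om ww a).
      by rewrite /= updateE.
    by rewrite satO (@sat_Eq (LQ w) N _ K _ (kzero w) _ k0 ev) // (@sat_Eq (LQ w) N _ K _ (kone w) _ k1 ev).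
  rewrite /holds sat_Alls_cons; split=> h a; have := h a; first by move/sat_Alls_nil/E.
  by move=> ha; apply/sat_Alls_nil/E.
rewrite E1.
set f2 := Iff _ _.
have E2 : holds N (Alls (S:=LQ w) Q [:: 0; 1] f2) <->
  forall a b : N Q, om ww a = om ww b <->
    exists t : N K, bq a (qs a b) = @fadd (Kred N) (@fmul (Kred N) t t) (@fopp (Kred N) t).
  have E a b : sat (update (update (no_assignment N) 0 a) 1 b) f2 <->
     (om ww a = om ww b <->
       exists t : N K, bq a (qs a b) = @fadd (Kred N) (@fmul (Kred N) t t) (@fopp (Kred N) t)).
    rewrite satI (@sat_Eq _ _ _ _ _ _ (om ww a) (om ww b)); [|by rewrite /= !updateE|by rewrite /= !updateE].
    rewrite sat_Exs1.
    have Et (t : N K) : sat (update (update (update (no_assignment N) 0 a) 1 b) 0 t)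
      (Eq (betaQ (w:=w) (q 0) (qsub (q 0) (q 1)))
       (kadd (kmul (Var (S:=LQ w) K 0) (Var (S:=LQ w) K 0)) (kopp (Var (S:=LQ w) K 0)))) <->
       bq a (qs a b) = @fadd (Kred N) (@fmul (Kred N) t t) (@fopp (Kred N) t).
      by apply: sat_Eq; rewrite /= ?(updateE, update_neq) //=.
    suff -> : (exists t : N K, sat (update (update (update (no_assignment N) 0 a) 1 b) 0 t)
      (Eq (betaQ (w:=w) (q 0) (qsub (q 0) (q 1)))
       (kadd (kmul (Var (S:=LQ w) K 0) (Var (S:=LQ w) K 0)) (kopp (Var (S:=LQ w) K 0))))) <->
       (exists t : N K, bq a (qs a b) = @fadd (Kred N) (@fmul (Kred N) t t) (@fopp (Kred N) t)).
      by [].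
    by split=> -[t /Et]; exists t.
  rewrite /holds; split=> h.
    by move=> a b; apply/E; move/sat_Alls_cons: h => /(_ a)/sat_Alls_cons/(_ b)/sat_Alls_nil.
  by apply/sat_Alls_cons => a; apply/sat_Alls_cons => b; apply/sat_Alls_nil/E/h.
by rewrite E2; split=> [[? []]|[]].
Qed.

Definition witt_sem n : Prop := holds N (dim_eq w (2 * n)) ->
  forall a : N Q, (hyperbolic_sum n a -> om ww a = k0) /\ (~ hyperbolic_sum n a -> om ww a = k1).

Lemma witt_axiomP n : holds N (witt_axiom ww n) <-> witt_sem n.
Proof.
rewrite /holds /witt_axiom satImp.
set f := And _ _.
have E a : sat (update (no_assignment N) 0 a) f <->
   (hyperbolic_sum n a -> om ww a = k0) /\ (~ hyperbolic_sum n a -> om ww a = k1).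
  have ev : eval (update (no_assignment N) 0 a) (omega ww (q 0)) = Some (om ww a).
    by rewrite /= updateE.
  rewrite satA !satImp (@sat_Eq (LQ w) N _ K _ (kzero w) _ k0 ev) // (@sat_Eq (LQ w) N _ K _ (kone w) _ k1 ev) //.
  by rewrite sum_of_hyperbolic_planesP; apply: iff_refl.
split=> h /h {}h; first by move=> a; apply/E; move/sat_Alls_cons: h => /(_ a)/sat_Alls_nil.
by apply/sat_Alls_cons => a; apply/sat_Alls_nil/E/h.
Qed.

End OmegaAxioms.

End Sentences.

(** * The axioms are sentences *)

Section Scoping.
Variable S : signature.
Implicit Types (G : seq (sg_sort S * nat)) (f : formula S).

Lemma scoped_sub G G' f : {subset G <= G'} -> scoped G f -> scoped G' f.
Proof.
have [ht ha] : (forall s (t : term (S:=S) s) G G', {subset G <= G'} -> term_scoped G t -> term_scoped G' t) /\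
    (forall d (ts : args (S:=S) d) G G', {subset G <= G'} -> args_scoped G ts -> args_scoped G' ts).
  apply: (@term_args_mutind S
    (fun s t => forall G G', {subset G <= G'} -> term_scoped G t -> term_scoped G' t)
    (fun d ts => forall G G', {subset G <= G'} -> args_scoped G ts -> args_scoped G' ts)) => //=.
  - by move=> s n G1 G2; apply.
  - by move=> d s t IHt ts IHts G1 G2 sG /andP[/(IHt _ _ sG)-> /(IHts _ _ sG)->].
elim: f G G' => [|s t u|d r ts|f IHf g IHg|s x f IH] G G' sG //=.
- by move=> /andP[/(ht _ _ _ _ sG)-> /(ht _ _ _ _ sG)->].
- exact: ha.
- by move=> /andP[/(IHf _ _ sG)-> /(IHg _ _ sG)->].
- by apply: IH => y; rewrite !inE => /orP[->//|/sG->]; rewrite orbT.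
Qed.

Lemma scoped_Alls G s xs f : scoped ([seq (s, x) | x <- xs] ++ G) f -> scoped G (Alls s xs f).
Proof.
elim: xs G => //= x xs IH G h; apply: IH; apply: scoped_sub h => y.
by rewrite inE !mem_cat inE orbCA.
Qed.

Lemma scoped_Exs G s xs f : scoped ([seq (s, x) | x <- xs] ++ G) f -> scoped G (Exs s xs f).
Proof.
elim: xs G => //= x xs IH G h; rewrite andbT; apply/andP; split=> //.
apply: IH; apply: scoped_sub h => y.
by rewrite inE !mem_cat inE orbCA.
Qed.

Lemma scopedA G f g : scoped G (And f g) = scoped G f && scoped G g.
Proof. by rewrite /= !andbT. Qed.

Lemma scopedN G f : scoped G (Neg f) = scoped G f.
Proof. by rewrite /= andbT. Qed.

Lemma scopedImp G f g : scoped G (Imp f g) = scoped G f && scoped G g.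
Proof. by []. Qed.

Lemma scopedIff G f g : scoped G (Iff f g) = scoped G f && scoped G g.
Proof. by rewrite scopedA /=; case: scoped; case: scoped. Qed.

Lemma scoped_Conj G fs : List.Forall (scoped G) fs -> scoped G (Conj fs).
Proof. by elim=> //= f fs' hf _ ->; rewrite hf. Qed.

Lemma scoped_Disj G fs : List.Forall (scoped G) fs -> scoped G (Disj fs).
Proof. by elim=> //= f fs' hf _ ->; rewrite hf. Qed.

Lemma scoped_nargs G s n (t : nat -> term s) :
  (forall i, i < n -> term_scoped G (t i)) -> args_scoped G (nargs n t).
Proof.
elim: n t => //= n IH t h; rewrite h //= IH // => i lti; exact: h.
Qed.

Lemma var_scoped G s xs x : x \in xs -> (s, x) \in [seq (s, y) | y <- xs] ++ G.
Proof. by move=> h; rewrite mem_cat map_f. Qed.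

Lemma scoped_catr (l : seq (sg_sort S * nat)) G y : y \in G -> y \in l ++ G.
Proof. by move=> h; rewrite mem_cat h orbT. Qed.

Lemma card_eq_sentence (s : sg_sort S) n : sentence (card_eq s n).
Proof.
apply: scoped_Exs; rewrite cats0 scopedA; apply/andP; split.
  apply/scoped_Conj/Forall_map_mem => -[i j]; rewrite mem_filter.
  move=> /andP[_ /allpairsP[[i' j'] /= [+ + [-> ->]]]] => hi hj.
  by rewrite /= !map_f.
rewrite /=; apply/scoped_Disj/Forall_map_mem => i hi.
by rewrite /= !inE eqxx /= map_f // orbT.
Qed.

End Scoping.

Section LQSentences.
Variable w : bool.

Lemma K_formula_scoped G G' f : (forall x, (tt, x) \in (G : seq (sg_sort Lring * nat)) ->
    (K, x) \in (G' : seq (sg_sort (LQ w) * nat))) ->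
  scoped (S:=Lring) G f -> scoped G' (K_formula w f).
Proof.
have [ht ha] : (forall s (t : term (S:=Lring) s) G G', (forall x, (tt, x) \in (G : seq (sg_sort Lring * nat)) ->
    (K, x) \in (G' : seq (sg_sort (LQ w) * nat))) -> term_scoped G t -> term_scoped G' (K_term w t)) /\
    (forall d (ts : args (S:=Lring) d) G G', (forall x, (tt, x) \in (G : seq (sg_sort Lring * nat)) ->
    (K, x) \in (G' : seq (sg_sort (LQ w) * nat))) -> args_scoped G ts -> args_scoped G' (K_args w ts)).
  apply: (@term_args_mutind Lring
    (fun s t => forall G G', (forall x, (tt, x) \in (G : seq (sg_sort Lring * nat)) ->
      (K, x) \in (G' : seq (sg_sort (LQ w) * nat))) -> term_scoped G t -> term_scoped G' (K_term w t))
    (fun d ts => forall G G', (forall x, (tt, x) \in (G : seq (sg_sort Lring * nat)) ->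
      (K, x) \in (G' : seq (sg_sort (LQ w) * nat))) -> args_scoped G ts -> args_scoped G' (K_args w ts))) => //=.
  - by case=> n G1 G2 h; apply: h.
  - by move=> d s t IHt ts IHts G1 G2 sG /andP[/(IHt _ _ sG)-> /(IHts _ _ sG)->].
elim: f G G' => [|s t u|d []|f IHf g IHg|s x f IH] G G' sG //=.
- by move=> /andP[/(ht _ _ _ _ sG)-> /(ht _ _ _ _ sG)->].
- by move=> /andP[/(IHf _ _ sG)-> /(IHg _ _ sG)->].
- apply: IH => y; rewrite !inE => /orP[/eqP[_ ->]|/sG->]; first by rewrite eqxx.
  by rewrite orbT.
Qed.

Lemma K_sentence f : sentence f -> sentence (K_formula w f).
Proof. by apply: K_formula_scoped. Qed.

Local Notation v := (Var (S:=LQ w) V).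
Local Notation k := (Var (S:=LQ w) K).

Lemma theta_scoped G n : (forall i, i < n.+1 -> (V, i) \in (G : seq (sg_sort (LQ w) * nat))) ->
  scoped G (theta n v).
Proof. by move=> h; apply: scoped_nargs. Qed.

Lemma lincomb_scoped G n : (forall i, i < n -> (V, i) \in (G : seq (sg_sort (LQ w) * nat))) ->
  (forall i, i < n -> (K, i) \in (G : seq (sg_sort (LQ w) * nat))) ->
  term_scoped G (lincomb n k v).
Proof.
move=> hv hk; rewrite /lincomb.
have : forall i, i \in iota 0 n -> i < n by move=> i; rewrite mem_iota0.
elim: (iota 0 n) => //= i s IH h; rewrite hv ?hk ?h ?mem_head //= IH // => j js.
by apply: h; rewrite inE js orbT.
Qed.

Lemma theta_axiom_sentence n : sentence (theta_axiom w n).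
Proof.
apply: scoped_Alls; rewrite cats0.
set G := [seq _ | _ <- _].
have GV j : j < n.+1 -> (V, j) \in G by move=> lt; rewrite /G map_f // mem_iota0.
rewrite scopedIff theta_scoped //; apply: scoped_Alls.
have GV' j : j < n.+1 -> (V, j) \in [seq (K : sg_sort (LQ w), x) | x <- iota 0 n.+1] ++ G.
  by move=> lt; exact: (@scoped_catr (LQ w) _ _ _ (GV j lt)).
have GK' j : j < n.+1 -> (K, j) \in [seq (K : sg_sort (LQ w), x) | x <- iota 0 n.+1] ++ G.
  by move=> lt; apply: (@var_scoped (LQ w)); rewrite mem_iota0.
rewrite scopedImp; apply/andP; split.
  by rewrite [scoped _ _]/=; apply/andP; split=> //; exact: (lincomb_scoped (n:=n.+1)).
apply/scoped_Conj/Forall_map_mem => i; rewrite mem_iota0 => lti.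
by rewrite [scoped _ _]/= andbT; exact: GK'.
Qed.

Lemma pi_axiom_sentence n (i : 'I_n.+1) : sentence (pi_axiom w i).
Proof.
apply: scoped_Alls; rewrite cats0.
set G := [seq _ | _ <- _].
have GV j : j < n.+2 -> (V, j) \in G by move=> lt; rewrite /G map_f // mem_iota0.
pose G' := [seq (K : sg_sort (LQ w), x) | x <- iota 0 n.+1] ++ G.
have GV' j : j < n.+2 -> (V, j) \in G' by move=> lt; exact: (@scoped_catr (LQ w) _ _ _ (GV j lt)).
have GK' j : j < n.+1 -> (K, j) \in G' by move=> lt; apply: (@var_scoped (LQ w)); rewrite mem_iota0.
have hc : scoped G' (And (theta n v) (Eq (v n.+1) (lincomb n.+1 k v))).
  rewrite scopedA theta_scoped /=; last by move=> j lt; apply: GV'; apply: ltnW.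
  rewrite GV' //=; apply: (lincomb_scoped (n:=n.+1)) => j lt; [apply: GV'; exact: ltnW|exact: GK'].
have hp (G2 : seq (sg_sort (LQ w) * nat)) : (forall j, j < n.+2 -> (V, j) \in G2) ->
    term_scoped G2 (Defs.pi i v (v n.+1)).
  move=> h; change (args_scoped G2 (nargs (S:=LQ w) (s:=V) n.+2 (fun j => if j <= n then v j else v n.+1))).
  apply: scoped_nargs => j lt.
  by case: ifP => _; apply: h.
rewrite scopedA; apply/andP; split.
  apply: scoped_Alls; rewrite scopedImp hc /= -/(term_scoped _ (Defs.pi i v (v n.+1))).
  apply/andP; split; last exact: GK'.
  exact: hp GV'.
rewrite scopedImp scopedN; apply/andP; split; first by apply: scoped_Exs; exact: hc.
by rewrite [scoped _ _]/=; apply/andP; split=> //; exact: hp GV.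
Qed.

Lemma indep_scoped G n : (forall i, i < n -> (V, i) \in (G : seq (sg_sort (LQ w) * nat))) ->
  scoped G (indep n v).
Proof. by case: n => // n h; apply: theta_scoped. Qed.

Lemma dim_ge_sentence n : sentence (dim_ge w n).
Proof.
by apply: scoped_Exs; rewrite cats0; apply: indep_scoped => i lt; rewrite map_f // mem_iota0.
Qed.

Lemma dim_eq_sentence n : sentence (dim_eq w n).
Proof. by rewrite /sentence scopedA scopedN !(dim_ge_sentence _ : scoped [::] _). Qed.

Lemma sum_scoped n : scoped (S:=LQ w) [:: (Q, 0)] (sum_of_hyperbolic_planes w n).
Proof.
apply: scoped_Exs; set G := _ ++ _.
have GV j : j < 2 * n -> (V, j) \in G by move=> lt; apply: (@var_scoped (LQ w)); rewrite mem_iota0.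
have GV1 j : j < n -> (V, j) \in G by move=> lt; apply: GV; rewrite mul2n -addnn ltn_addr.
have GV2 j : j < n -> (V, n + j) \in G by move=> lt; apply: GV; rewrite mul2n -addnn ltn_add2l.
have GQ : (Q, 0) \in G by exact: (@scoped_catr (LQ w) _ [:: (Q, 0)] (Q, 0) isT).
rewrite !scopedA indep_scoped //=; apply/andP; split; apply/scoped_Conj/Forall_map_mem.
  by move=> i; rewrite mem_iota0 => lti; rewrite /= !GQ !(GV1 i lti) !(GV2 i lti).
move=> [i j]; rewrite mem_filter => /andP[_ /allpairsP[[i' j'] /= [+ + [-> ->]]]].
by rewrite !mem_iota0 => lti ltj; rewrite /= !(GV1 i' lti) !(GV1 j' ltj) !(GV2 i' lti) !(GV2 j' ltj).
Qed.

Lemma witt_sentence ww n : sentence (witt_axiom (w:=w) ww n).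
Proof.
rewrite /sentence /witt_axiom scopedImp; apply/andP; split; first exact: dim_eq_sentence.
by apply: scoped_Alls; rewrite [_ ++ _]/= scopedA !scopedImp sum_scoped.
Qed.

Lemma T0_Q_sentence f : T0_Q w f -> sentence f.
Proof.
case=> [[[[[[g hg <-]|hf]|[n _ <-]]|[n [i ->]]]|[g -> <-]]|hf].
- by apply: K_sentence; move: hg; do 10?[case=> [<-//|]].
- by move: hf; do 8?[case=> [<-//|]].
- exact: theta_axiom_sentence.
- exact: pi_axiom_sentence.
- exact: K_sentence.
- by move: hf; do 11?[case=> [<-//|]].
Qed.

End LQSentences.

(** [Th M] consists of closed formulas only, so a model of [Th M] is known to satisfy an axiom of
    [T0] once that axiom is closed. *)
Lemma T0_sentence w f : T0 w f -> sentence f.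
Proof.
case: w f => f; last exact: T0_Q_sentence.
case=> [[|hf]|[n _ <-]]; [exact: T0_Q_sentence|by move: hf; do 2?[case=> [<-//|]]|exact: witt_sentence].
Qed.

Local Open Scope ring_scope.

(** * From structures to fields and quadratic spaces *)

Section FieldOf.
Variables (F : structure Lring) (H : model field_theory F).

(** The proof of the field axioms is a parameter of the alias, so that the algebraic instances
    declared on it can depend on that proof. *)
Definition fcar of model field_theory F : Type := F tt.
HB.instance Definition _ := gen_eqMixin (fcar H).
HB.instance Definition _ := gen_choiceMixin (fcar H).

Local Ltac unfold_vars := rewrite /= ?(updateE, update_neq) //=.
Local Ltac by_equation := unfold_vars; case=> ? [[<-] []]; let h := fresh in move=> h; exact: (esym h).

Let ax_nth n : (n < 10)%N -> holds F (nth Bot field_axioms n).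
Proof. by move=> ltn; apply: H; do 10?[case: n ltn => [|n] ltn; [by left|right]]. Qed.

Let addA : associative (@fadd F : fcar H -> fcar H -> fcar H).
Proof. by move=> x y z; have := @ax_nth 0%N isT x y z; by_equation. Qed.
Let addC : commutative (@fadd F : fcar H -> fcar H -> fcar H).
Proof. by move=> x y; have := @ax_nth 1%N isT x y x; by_equation. Qed.
Let add0 : left_id (fzero F) (@fadd F : fcar H -> fcar H -> fcar H).
Proof. by move=> x; have := @ax_nth 2%N isT x x x; by_equation. Qed.
Let addN : left_inverse (fzero F) (@fopp F) (@fadd F : fcar H -> fcar H -> fcar H).
Proof. by move=> x; have := @ax_nth 3%N isT x x x; by_equation. Qed.
Let mulA : associative (@fmul F : fcar H -> fcar H -> fcar H).
Proof. by move=> x y z; have := @ax_nth 4%N isT x y z; by_equation. Qed.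
Let mulC : commutative (@fmul F : fcar H -> fcar H -> fcar H).
Proof. by move=> x y; have := @ax_nth 5%N isT x y x; by_equation. Qed.
Let mul1 : left_id (fone F) (@fmul F : fcar H -> fcar H -> fcar H).
Proof. by move=> x; have := @ax_nth 6%N isT x x x; by_equation. Qed.
Let mulD : left_distributive (@fmul F : fcar H -> fcar H -> fcar H) (@fadd F).
Proof. by move=> x y z; have := @ax_nth 7%N isT x y z; by_equation. Qed.
Let one_neq0 : (fone F : fcar H) != fzero F.
Proof.
apply/eqP => e; apply: (@ax_nth 8%N isT); exists (fone F); split=> //=.
by rewrite -[RHS]/(Some _) e.
Qed.

HB.instance Definition _ := GRing.isZmodule.Build (fcar H) addA addC add0 addN.
HB.instance Definition _ := GRing.Zmodule_isComNzRing.Build (fcar H)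
  mulA mulC mul1 mulD one_neq0.

Lemma fcar_inv_ex (x : fcar H) : exists y : fcar H, (x != 0 -> y * x = 1) /\ (x = 0 -> y = 0).
Proof.
have [->|x0] := eqVneq x 0; first by exists 0; split.
have := @ax_nth 9%N isT; rewrite /holds [nth _ _ _]/= => /satAll/(_ x)/satImp h.
have [|y] := (satE _ _ _ _).1 (h _).
  by unfold_vars; case=> ? [[<-] [e]]; move/eqP: x0; apply; exact: (esym e).
unfold_vars => -[? [[<-] [e]]]; exists y; split=> [_|x00]; first exact: (esym e).
by rewrite x00 eqxx in x0.
Qed.

Definition fcar_inv (x : fcar H) : fcar H := projT1 (cid (fcar_inv_ex x)).

Lemma fcar_mulVf (x : fcar H) : x != 0 -> fcar_inv x * x = 1.
Proof. by rewrite /fcar_inv; case: cid => y []. Qed.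

Lemma fcar_inv0 : fcar_inv 0 = 0.
Proof. by rewrite /fcar_inv; case: cid => y h; exact: h.2. Qed.

HB.instance Definition _ := GRing.ComNzRing_isField.Build (fcar H) fcar_mulVf fcar_inv0.

Lemma fcar_char2 : holds F char2 -> 2%N \in [pchar (fcar H)].
Proof.
by move=> /= [? [[<-] [e]]]; rewrite inE /= mulr2n; do 2!apply/eqP; exact: (esym e).
Qed.

End FieldOf.

Record qspace := QSpace {
  qK : fieldType;
  qV : lmodType qK;
  qb : qV -> qV -> qK;
  qf : qV -> qK;
  qchar2 : 2%N \in [pchar qK];
  qbDl : forall a x y z, qb (a *: x + y) z = a * qb x z + qb y z;
  qbDr : forall a x y z, qb z (a *: x + y) = a * qb z x + qb z y;
  qbxx : forall x, qb x x = 0;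
  qbnd : forall x, (forall y, qb x y = 0) -> x = 0;
  qfZ : forall a x, qf (a *: x) = a * a * qf x;
  qfD : forall x y, qf (x + y) = qf x + qf y + qb x y }.

Section VOf.
Variables (w : bool) (N : structure (LQ w)) (H : T0_Q_sem N).
Local Notation k := (fcar (t_field H)).

Definition vcar of T0_Q_sem N : Type := N V.
HB.instance Definition _ := gen_eqMixin (vcar H).
HB.instance Definition _ := gen_choiceMixin (vcar H).
HB.instance Definition _ := GRing.isZmodule.Build (vcar H)
  (t_vaA H) (t_vaC H) (t_va0 H) (t_vaN H).
HB.instance Definition _ := GRing.Zmodule_isLmodule.Build k (vcar H)
  (t_vsA H) (t_vs1 H) (t_vsDr H) (fun v a b => t_vsDl H a b v).

Definition qspace_of (q0 : N Q) : qspace :=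
  @QSpace k (vcar H) (@bv w N) (bq q0) (fcar_char2 (t_field H) (t_char2 H))
    (t_bvl H) (t_bvr H) (t_bvxx H) (@t_bvnd w N H) (t_bqZ H q0) (t_bqD H q0).

End VOf.

Lemma field_theory_sem (k : fieldType) (F : structure Lring) (f : k -> F tt) :
  bijective f ->
  f 0 = fzero F -> f 1 = fone F -> (forall x y, f (x + y) = fadd (f x) (f y)) ->
  (forall x, f (- x) = fopp (f x)) -> (forall x y, f (x * y) = fmul (f x) (f y)) ->
  model field_theory F.
Proof.
move=> [g fK gK] f0 f1 fD fN fM.
have eqn (e : assignment F) (t u : term (S:=Lring) tt) x y : x = y -> eval e t = Some (f x) ->
  eval e u = Some (f y) -> sat e (Eq t u) by move=> xy ht hu; apply/(sat_Eq ht hu); rewrite xy.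
have ev0 e : eval e rzero = Some (f 0) by rewrite f0.
have ev1 e : eval e rone = Some (f 1) by rewrite f1.
have evD (e : assignment F) t u x y : eval e t = Some (f x) -> eval e u = Some (f y) ->
    eval e (radd t u) = Some (f (x + y)) by move=> /= -> -> /=; rewrite fD.
have evM (e : assignment F) t u x y : eval e t = Some (f x) -> eval e u = Some (f y) ->
    eval e (rmul t u) = Some (f (x * y)) by move=> /= -> -> /=; rewrite fM.
have evN (e : assignment F) t x : eval e t = Some (f x) ->
    eval e (ropp t) = Some (f (- x)) by move=> /= -> /=; rewrite fN.
have ev3 x y z : let e := update (update (update (no_assignment F) 0%N (f x)) 1%N (f y)) 2%N (f z) in
  [/\ eval e (Var (S:=Lring) tt 0) = Some (f x), eval e (Var (S:=Lring) tt 1) = Some (f y)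
    & eval e (Var (S:=Lring) tt 2) = Some (f z)].
  by split; rewrite /= !updateE.
have all3 h : (forall x y z, sat (update (update (update (no_assignment F) 0%N (f x)) 1%N (f y)) 2%N (f z)) h) ->
    holds F (Alls (S:=Lring) tt [:: 0; 1; 2] h).
  by move=> hh x y z; have := hh (g x) (g y) (g z); rewrite !gK.
apply/model_In.
apply: List.Forall_cons.
  by apply: all3 => x y z; have [hx hy hz] := ev3 x y z; apply: eqn (addrA x y z) _ _; auto.
apply: List.Forall_cons.
  by apply: all3 => x y z; have [hx hy hz] := ev3 x y z; apply: eqn (addrC x y) _ _; auto.
apply: List.Forall_cons.
  by apply: all3 => x y z; have [hx hy hz] := ev3 x y z; apply: eqn (add0r x) _ _; auto.
apply: List.Forall_cons.
  by apply: all3 => x y z; have [hx hy hz] := ev3 x y z; apply: eqn (addNr x) _ _; auto.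
apply: List.Forall_cons.
  by apply: all3 => x y z; have [hx hy hz] := ev3 x y z; apply: eqn (mulrA x y z) _ _; auto.
apply: List.Forall_cons.
  by apply: all3 => x y z; have [hx hy hz] := ev3 x y z; apply: eqn (mulrC x y) _ _; auto.
apply: List.Forall_cons.
  by apply: all3 => x y z; have [hx hy hz] := ev3 x y z; apply: eqn (mul1r x) _ _; auto.
apply: List.Forall_cons.
  by apply: all3 => x y z; have [hx hy hz] := ev3 x y z; apply: eqn (mulrDl x y z) _ _; auto.
apply: List.Forall_cons.
  move=> [? [+ +]]; rewrite ev0 ev1 => -[<-] [] /(can_inj fK)/esym/eqP.
  by rewrite oner_eq0.
apply: List.Forall_cons; last exact: List.Forall_nil.
apply/satAll => x; apply/satImp => hx; apply/satE; exists (f (g x)^-1).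
have x0 : g x != 0.
  apply/eqP => gx0; apply: hx; apply: (eqn _ _ _ 0 0); rewrite ?ev0 //=.
  by rewrite updateE -gx0 gK.
apply: eqn (mulVf x0) _ _; last by auto.
by apply: evM; rewrite /= !updateE // gK.
Qed.

(** The image of the Artin-Schreier map. *)
Definition wp (k : fieldType) (a : k) : Prop := exists t : k, a = t * t - t.

(** * The structure attached to a quadratic space and a value of [omega] *)

Section Str.
Variables (w : bool) (D : qspace) (o : bool).
Local Notation k := (qK D).
Local Notation E := (qV D).

Definition qindep n (t : nat -> E) : Prop :=
  forall a : nat -> k, \sum_(i < n) a i *: t i = 0 -> forall i, (i < n)%N -> a i = 0.

Definition qpi n (i : nat) (t : nat -> E) : k :=
  match pselect (exists a : nat -> k, qindep n t /\ t n = \sum_(j < n) a j *: t j) with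
  | left h => projT1 (cid h) i
  | right _ => 0
  end.

(** The bit [o] is the value at the base point. The form at the base point and its translate by [x]
    agree on [x], because the bilinear form is alternating; so the axiom on [omega] says that the
    value changes exactly when [qf x] lies outside the Artin-Schreier image. *)
Definition qomega (x : E) : k := (o (+) ~~ `[< wp (qf x) >])%:R.

(** The sort [Q] is a second copy of the vectors: [x] stands for the translate of the base point by
    [x]. *)
Definition str_carrier (s : QSort) : Type := if s is K then k else E.

Definition str_ring d s (g : ring_func d s) :
    @htuple (sg_sort (LQ w)) str_carrier [seq K | _ <- d] -> k :=
  match g in ring_func d s return htuple _ [seq K | _ <- d] -> k with
  | RZero => fun _ => 0
  | ROne => fun _ => 1
  | RAdd => fun a => a.1 + a.2.1
  | ROpp => fun a => - a.1
  | RMul => fun a => a.1 * a.2.1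
  end.

Definition str_func d s (g : Q_func w d s) : htuple str_carrier d -> str_carrier s :=
  match g in Q_func _ d s return htuple str_carrier d -> str_carrier s with
  | KRing _ _ g => str_ring g
  | VZero => fun _ => (0 : E)
  | VAdd => fun a => (a.1 : E) + a.2.1
  | VOpp => fun a => - (a.1 : E)
  | Scale => fun a => (a.1 : k) *: (a.2.1 : E)
  | Pi n i => fun a => qpi n.+1 i (@hnth _ str_carrier V (0 : E) n.+2 a)
  | BetaV => fun a => qb (a.1 : E) a.2.1
  | QAdd => fun a => (a.1 : E) + a.2.1
  | QSub => fun a => (a.1 : E) - a.2.1
  | BetaQ => fun a => qf (a.2.1 : E) + qb (a.1 : E) a.2.1 ^+ 2
  | Omega _ => fun a => qomega a.1
  end.

Definition str_rel d (r : Q_rel d) : htuple str_carrier d -> Prop :=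
  match r in Q_rel d return htuple str_carrier d -> Prop with
  | Theta n => fun a => qindep n.+1 (@hnth _ str_carrier V (0 : E) n.+1 a)
  end.

Definition str : structure (LQ w) := @Structure (LQ w) str_carrier str_func str_rel.

Lemma qb0l x : qb 0 x = 0 :> k.
Proof.
have := qbDl 1 0 0 x; rewrite scaler0 addr0 mul1r => /eqP.
by rewrite eq_sym -subr_eq0 addrK => /eqP.
Qed.

Lemma qb0r x : qb x 0 = 0 :> k.
Proof.
have := qbDr 1 0 0 x; rewrite scaler0 addr0 mul1r => /eqP.
by rewrite eq_sym -subr_eq0 addrK => /eqP.
Qed.

Lemma qbZl a (x y : E) : qb (a *: x) y = a * qb x y.
Proof. by rewrite -[a *: x]addr0 qbDl qb0l addr0. Qed.

Lemma qbZr a (x y : E) : qb x (a *: y) = a * qb x y.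
Proof. by rewrite -[a *: y]addr0 qbDr qb0r addr0. Qed.

Lemma qbDl1 (x y z : E) : qb (x + y) z = qb x z + qb y z.
Proof. by have := qbDl 1 x y z; rewrite scale1r mul1r. Qed.

Lemma qbDr1 (x y z : E) : qb z (x + y) = qb z x + qb z y.
Proof. by have := qbDr 1 x y z; rewrite scale1r mul1r. Qed.

Lemma qaddkk (a : k) : a + a = 0.
Proof. exact: addrr_pchar2 (qchar2 D) a. Qed.

Lemma qoppk (a : k) : - a = a.
Proof. exact: oppr_pchar2 (qchar2 D) a. Qed.

Lemma qaddVV (x : E) : x + x = 0.
Proof. by rewrite -[x]scale1r -scalerDl qaddkk scale0r. Qed.

Lemma qoppV (x : E) : - x = x.
Proof. by apply/eqP; rewrite eq_sym -subr_eq0 opprK qaddVV. Qed.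

Lemma qsqrD (a b : k) : (a + b) ^+ 2 = a ^+ 2 + b ^+ 2.
Proof. by rewrite sqrrD mulr2n qaddkk addr0. Qed.

Lemma qbC (x y : E) : qb x y = qb y x.
Proof.
have := qbxx (x + y); rewrite qbDl1 !qbDr1 !qbxx add0r addr0.
by move/eqP; rewrite addr_eq0 qoppk => /eqP.
Qed.

Lemma qf0 : qf 0 = 0 :> k.
Proof. by have := qfZ 0 (0 : E); rewrite scaler0 !mul0r. Qed.

Lemma str_lin a t n : @lin w str a t n = \sum_(i < n) a i *: t i.
Proof.
rewrite -(big_mkord xpredT (fun i => a i *: t i)) /index_iota subn0 unlock /lin.
by elim: (iota 0 n) => //= i s <-.
Qed.

Lemma eq_qindep n (t u : nat -> E) : (forall i, (i < n)%N -> t i = u i) ->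
  qindep n t <-> qindep n u.
Proof.
move=> tu; have eqs a : \sum_(i < n) a i *: t i = \sum_(i < n) a i *: u i.
  by apply: eq_bigr => i _; rewrite tu.
by split=> h a; [rewrite -eqs|rewrite eqs]; apply: h.
Qed.

Lemma str_rindep n t : @rindep w str n t <-> qindep n t.
Proof.
by split=> h a ha; [apply: h; rewrite str_lin|apply: (h a); rewrite -str_lin].
Qed.

Lemma eq_qpi n i (t u : nat -> E) : (forall i, (i <= n)%N -> t i = u i) ->
  qpi n i t = qpi n i u.
Proof.
move=> tu; have tu' j : (j < n)%N -> t j = u j by move=> /ltnW/tu.
rewrite /qpi; have -> : (fun a : nat -> k => qindep n t /\ t n = \sum_(j < n) a j *: t j) =
   (fun a : nat -> k => qindep n u /\ u n = \sum_(j < n) a j *: u j) => //.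
apply: funext => a; apply: propext; rewrite (eq_qindep tu') tu //.
by rewrite (eq_bigr (fun j : 'I_n => a j *: u j)) // => j _; rewrite tu'.
Qed.

Lemma qindep_inj n t (a b : nat -> k) : qindep n t ->
  \sum_(j < n) a j *: t j = \sum_(j < n) b j *: t j -> forall i, (i < n)%N -> a i = b i.
Proof.
move=> h ab i lti; apply/eqP; rewrite -subr_eq0; apply/eqP.
apply: (h (fun i => a i - b i)) lti.
under eq_bigr do rewrite scalerBl; rewrite sumrB ab subrr //.
Qed.

Lemma qpiE n t (a : nat -> k) i : qindep n t -> t n = \sum_(j < n) a j *: t j -> (i < n)%N -> qpi n i t = a i.
Proof.
move=> h tn lti; rewrite /qpi; case: pselect => [ex|[]]; last by exists a.
by case: cid => b /= [_]; rewrite tn => /esym/(qindep_inj h)->.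
Qed.

Lemma qpi0 n t i : ~ (exists a : nat -> k, qindep n t /\ t n = \sum_(j < n) a j *: t j) ->
  qpi n i t = 0.
Proof. by rewrite /qpi; case: pselect. Qed.

Lemma str_field : model field_theory (Kred str).
Proof. by apply: (@field_theory_sem k (Kred str) id) => //; exists id. Qed.

Lemma str_T0_Q_sem : T0_Q_sem str.
Proof.
split.
- exact: str_field.
- exists 0; split=> //; congr Some; exact: qaddkk.
- exact: addrA. - exact: addrC. - exact: add0r. - exact: addNr.
- exact: scalerA. - exact: scale1r. - exact: scalerDr. - by move=> a b x; apply: scalerDl.
- move=> n t; rewrite str_rindep; apply: eq_qindep => i lti.
  exact: (@hnth_mk QSort str_carrier V).
- move=> n i t p; have -> : p = qpi n.+1 i t.
    by apply: eq_qpi => j ltj; exact: (@hnth_mk QSort str_carrier V).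
  split=> [a /str_rindep h|h].
    by rewrite str_lin => /qpiE ->.
  by apply: qpi0 => -[a [h1 h2]]; apply: h; exists a; rewrite str_rindep str_lin.
- exact: qbDl. - exact: qbDr. - exact: qbxx. - exact: qbnd.
- by move=> q a x; rewrite /bq /= qfZ qbZr exprMn mulrDr.
- move=> q x y; rewrite /bq /= qfD qbDr1 qsqrD.
  by rewrite -[RHS]/((qf x + qb q x ^+ 2) + (qf y + qb q y ^+ 2) + qb (x : E) y); ring.
- exact: addr0. - exact: addrA.
- move=> q q'; exists (q' - q); split; first exact: subrKC.
  by move=> y <-; rewrite addrC addKr.
- move=> q x y; rewrite /bq /= qbDl1 qsqrD addrA.
  by [].
- move=> q q' x; split=> [->|<-]; first exact: subrKC.
  by rewrite /qs /= addrC addKr.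
Qed.

End Str.

Lemma hrel_hnth (I : Type) (A B : I -> Type) (R : forall s, A s -> B s -> Prop) s n
    (a : htuple A (nseq n s)) (b : htuple B (nseq n s)) a0 b0 :
  hrel R a b -> forall i, (i < n)%N -> R s (hnth a0 a i) (hnth b0 b i).
Proof.
elim: n a b => // n IH [x a] [y b] [xy ab] [|i] //=; exact: IH.
Qed.

Section Representation.
Variables (w : bool) (N : structure (LQ w)) (H : T0_Q_sem N) (q0 : N Q) (o : bool).
Local Notation D := (qspace_of H q0).
Hypothesis om_q0 : forall (ww : w) x, om ww (qa q0 x) = qomega (D:=D) o x.

Definition base_rel (s : QSort) : N s -> str w D o s -> Prop :=
  match s return N s -> str w D o s -> Prop with
  | K => fun a b => a = b
  | V => fun a b => a = b
  | Q => fun a b => a = qa q0 b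
  end.

Lemma lin_sum (a : nat -> qK D) (t : nat -> qV D) n :
  @lin w N a t n = \sum_(i < n) a i *: t i.
Proof.
rewrite -(big_mkord xpredT (fun i => a i *: t i)) /index_iota subn0 unlock /lin.
by elim: (iota 0 n) => //= i s <-.
Qed.

Lemma rindep_qindep n (t : nat -> qV D) : @rindep w N n t <-> qindep n t.
Proof.
by split=> h a ha; [apply: h; rewrite lin_sum|apply: (h a); rewrite -lin_sum].
Qed.

(** One index is enough, [base_rel] being the graph of an isomorphism. *)
Lemma base_back_and_forth :
  @back_and_forth (LQ w) N (str w D o) unit (fun _ _ => True) (fun=> base_rel).
Proof.
have qaK q x : qs (qa q x) q = x :> N V by apply: esym; apply/(t_qs H).
have qaI x y : qa q0 x = qa q0 y -> x = y :> N V by move=> e; rewrite -(qaK q0 x) e qaK.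
have hn n (a : htuple N (nseq n V)) (b : htuple (str w D o) (nseq n V)) i :
    @hrel QSort N (str_carrier D) base_rel _ a b -> (i < n)%N ->
    @hnth _ N V (vz N) n a i = @hnth _ (str_carrier D) V 0 n b i.
  by move=> ab lti; exact: (@hrel_hnth QSort N (str_carrier D) base_rel V n a b (vz N) (0 : qV D) ab i lti).
split=> //.
- move=> _ [] a b c d /=; do ?[by move=> -> ->].
  by move=> -> ->; split=> [/qaI|->].
- move=> i d s g a b ab; exists tt; split=> //; case: g a b ab.
  + move=> d' s' []; do ?[by case=> [] []].
    * by move=> [x [y []]] [x' [y' []]] /= [-> [-> _]].
    * by move=> [x []] [x' []] /= [-> _].
    * by move=> [x [y []]] [x' [y' []]] /= [-> [-> _]].
  + by case=> [] [].
  + by move=> [x [y []]] [x' [y' []]] /= [-> [-> _]].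
  + by move=> [x []] [x' []] /= [-> _].
  + by move=> [x [y []]] [x' [y' []]] /= [-> [-> _]].
  + move=> n j a b ab; rewrite -(hmk_nth (vz N) a).
    have [h1 h2] := t_pi H j (hnth (vz N) a).
    have /= -> : @interp_func (LQ w) (str w D o) _ _ (Pi w j) b = qpi n.+1 j (hnth (vz N) a : nat -> qV D).
      by apply: eq_qpi => l ltl; rewrite (hn _ _ _ _ ab).
    have [[c [hc1 hc2]]|nex] := pselect (exists c : nat -> qK D, qindep n.+1 (hnth (vz N) a : nat -> qV D) /\
       hnth (vz N) a n.+1 = \sum_(l < n.+1) c l *: (hnth (vz N) a l : qV D)).
      rewrite (qpiE hc1 hc2) //; apply: h1; first exact/rindep_qindep.
      by rewrite lin_sum.
    rewrite (qpi0 _ nex); apply: h2 => -[c [hc1 hc2]]; apply: nex.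
    by exists c; split; [exact/rindep_qindep|rewrite -lin_sum].
  + by move=> [x [y []]] [x' [y' []]] /= [-> [-> _]].
  + by move=> [x [y []]] [x' [y' []]] /= [-> [-> _]]; exact: (esym (t_qaA H q0 x' y')).
  + move=> [x [y []]] [x' [y' []]] /= [-> [-> _]]; apply: esym.
    apply: (t_qs H (qa q0 x') (qa q0 y') (x' - y' : qV D)).2.
    by rewrite -(t_qaA H); congr qa; exact: (@subrKC (qV D) y' x').
  + move=> [x [y []]] [x' [y' []]] /= [-> [-> _]]; exact: (t_bqa H).
  + by move=> ww [x []] [x' []] /= [-> _]; exact: om_q0.
- move=> _ d r a b ab; case: r a b ab => n a b ab.
  rewrite -(hmk_nth (vz N) a) (t_theta H) rindep_qindep.
  by apply: eq_qindep => i lti; exact: (hn _ _ _ _ ab lti).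
- move=> _ [] a; [by exists tt, a|by exists tt, a|].
  by have [x [qx _]] := t_qareg H q0 a; exists tt, x.
- move=> _ [] b; [by exists tt, b|by exists tt, b|].
  by exists tt, (qa q0 b).
Qed.

Lemma holds_str f : holds N f <-> holds (str w D o) f.
Proof. exact: (back_and_forth_holds base_back_and_forth tt). Qed.

End Representation.

(** * Symplectic and hyperbolic frames *)

(** Total functions keep frames of all sizes in one type; only the entries below [fsize] carry
    meaning. *)
Record frame (D : qspace) := Frame { fe : nat -> qV D; ff : nat -> qV D; fsize : nat }.

Section Frames.
Variable D : qspace.
Local Notation k := (qK D).
Local Notation E := (qV D).
Implicit Types (F : frame D) (x y z u : E) (a b : nat -> k).

Lemma qb_suml n (t : nat -> E) x : qb (\sum_(i < n) t i) x = \sum_(i < n) qb (t i) x.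
Proof.
by elim: n => [|n IH]; rewrite ?big_ord0 ?qb0l // !big_ord_recr /= qbDl1 IH.
Qed.

Definition comb F a b : E := \sum_(i < fsize F) (a i *: fe F i + b i *: ff F i).
(** For a symplectic frame this is the orthogonal projection onto its span: the coefficient of one
    vector of a pair is the pairing with the other, without signs in characteristic two. Hence
    [full] says that the frame spans. *)
Definition proj F u : E := comb F (fun i => qb u (ff F i)) (fun i => qb u (fe F i)).

Definition symp F : Prop := forall i j, (i < fsize F)%N -> (j < fsize F)%N ->
  [/\ qb (fe F i) (fe F j) = 0, qb (ff F i) (ff F j) = 0 & qb (fe F i) (ff F j) = (i == j)%:R].
Definition sing F : Prop := forall i, (i < fsize F)%N -> qf (fe F i) = 0 /\ qf (ff F i) = 0.
Definition full F : Prop := forall u, u = proj F u.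
Definition perp F z : Prop := forall i, (i < fsize F)%N -> qb z (fe F i) = 0 /\ qb z (ff F i) = 0.

Definition ext F x y : frame D :=
  Frame (fun i => if (i < fsize F)%N then fe F i else x)
        (fun i => if (i < fsize F)%N then ff F i else y) (fsize F).+1.

Lemma sum_delta n (a : nat -> k) i : (i < n)%N -> \sum_(j < n) a j * (j == i :> nat)%:R = a i.
Proof.
move=> lti; rewrite (bigD1 (Ordinal lti)) //= eqxx mulr1 big1 ?addr0 // => j ji.
by rewrite (_ : (j == i :> nat) = false) ?mulr0 //; apply: contraNF ji => /eqP ji; apply/eqP/val_inj.
Qed.

Lemma comb_coord F a b i : symp F -> (i < fsize F)%N ->
  qb (comb F a b) (fe F i) = b i /\ qb (comb F a b) (ff F i) = a i.
Proof.
move=> sF lti; rewrite /comb !(qb_suml _ (fun i => a i *: fe F i + b i *: ff F i)).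
split; rewrite -[RHS](sum_delta _ lti); apply: eq_bigr => j _;
  have [h1 h2 h3] := sF j i (ltn_ord j) lti; have [_ _ h4] := sF i j lti (ltn_ord j).
  by rewrite qbDl1 !qbZl h1 mulr0 add0r qbC h4 eq_sym.
by rewrite qbDl1 !qbZl h2 mulr0 addr0 h3.
Qed.

Lemma proj_coord F u i : symp F -> (i < fsize F)%N ->
  qb (proj F u) (fe F i) = qb u (fe F i) /\ qb (proj F u) (ff F i) = qb u (ff F i).
Proof. exact: comb_coord. Qed.

Lemma comb_lin F c a b a' b' : comb F (fun i => c * a i + a' i) (fun i => c * b i + b' i) =
  c *: comb F a b + comb F a' b'.
Proof.
rewrite /comb scaler_sumr -big_split /=; apply: eq_bigr => i _.
by rewrite !scalerDl scalerDr !scalerA -!addrA; congr (_ + _); rewrite addrCA.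
Qed.

Lemma eq_comb F a b a' b' : (forall i, (i < fsize F)%N -> a i = a' i /\ b i = b' i) ->
  comb F a b = comb F a' b'.
Proof. by move=> h; apply: eq_bigr => i _; have [-> ->] := h i (ltn_ord i). Qed.

Lemma proj_lin F c u x : proj F (c *: u + x) = c *: proj F u + proj F x.
Proof. by rewrite /proj -comb_lin; apply: eq_comb => i _; rewrite !qbDl. Qed.

Lemma comb0 F : comb F (fun=> 0) (fun=> 0) = 0.
Proof. by rewrite /comb big1 // => i _; rewrite !scale0r addr0. Qed.

Lemma proj0 F : proj F 0 = 0.
Proof. by rewrite -[RHS](comb0 F); apply: eq_comb => i _; rewrite !qb0l. Qed.

Lemma projD F u x : proj F (u + x) = proj F u + proj F x.
Proof. by have := proj_lin F 1 u x; rewrite !scale1r. Qed.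

Lemma projZ F c u : proj F (c *: u) = c *: proj F u.
Proof. by have := proj_lin F c u 0; rewrite proj0 !addr0. Qed.

Lemma proj_comb F a b : symp F -> proj F (comb F a b) = comb F a b.
Proof. by move=> sF; apply: eq_comb => i lti; have [-> ->] := comb_coord a b sF lti. Qed.

Lemma projK F u : symp F -> proj F (proj F u) = proj F u.
Proof. exact: proj_comb. Qed.

Lemma proj_perp F z : perp F z -> proj F z = 0.
Proof. by move=> h; rewrite -[RHS](comb0 F); apply: eq_comb => i /h[-> ->]. Qed.

Lemma qb_comb F a b z : qb (comb F a b) z =
  \sum_(i < fsize F) (a i * qb (fe F i) z + b i * qb (ff F i) z).
Proof.
rewrite /comb (qb_suml _ (fun i => a i *: fe F i + b i *: ff F i)).
by apply: eq_bigr => i _; rewrite qbDl1 !qbZl.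
Qed.

Lemma qb_comb_perp F a b z : perp F z -> qb (comb F a b) z = 0.
Proof.
move=> h; rewrite qb_comb big1 // => i _.
by have [h1 h2] := h i (ltn_ord i); rewrite -!(qbC z) h1 h2 !mulr0 addr0.
Qed.

Lemma perp_sub F u : symp F -> perp F (u - proj F u).
Proof.
move=> sF i lti; have [h1 h2] := proj_coord u sF lti.
by rewrite qoppV !qbDl1 h1 h2 !qaddkk.
Qed.

(** Distinct planes are orthogonal, and inside a plane with a singular basis only the polar term
    survives. *)
Lemma qf_comb F a b : symp F -> sing F -> qf (comb F a b) = \sum_(i < fsize F) a i * b i.
Proof.
case: F => e f n; rewrite /comb /symp /sing /=.
elim: n => [|n IH] sF siF; first by rewrite !big_ord0 qf0.
rewrite !big_ord_recr /= qfD IH; last 2 first.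
- by move=> i j lti ltj; apply: sF; apply: ltnW.
- by move=> i lti; apply: siF; apply: ltnW.
have h0 : qb (\sum_(i < n) (a i *: e i + b i *: f i)) (a n *: e n + b n *: f n) = 0.
  rewrite (qb_suml _ (fun i => a i *: e i + b i *: f i)) big1 // => i _.
  have ltn : (i < n.+1)%N by rewrite ltnW // ltnS.
  have [h1 h2 h3] := sF i n ltn (leqnn _); have [_ _ h4] := sF n i (leqnn _) ltn.
  rewrite !qbDl1 !qbDr1 !qbZl !qbZr h1 h2 h3 (qbC (f i)) h4.
  by rewrite (gtn_eqF (ltn_ord i)) (ltn_eqF (ltn_ord i)) !mulr0 !addr0.
rewrite h0 addr0; congr (_ + _).
have [h1 h2] := siF n (leqnn _); have [_ _ h3] := sF n n (leqnn _) (leqnn _).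
by rewrite qfD !qfZ h1 h2 !mulr0 !add0r qbZl qbZr h3 eqxx mulr1.
Qed.

Lemma symp_ext F x y : symp F -> perp F x -> perp F y -> qb x y = 1 -> symp (ext F x y).
Proof.
move=> sF px py xy i j; rewrite /= !ltnS (leq_eqVlt i) (leq_eqVlt j).
case/predU1P => [->|lti]; case/predU1P => [->|ltj]; rewrite ?ltnn ?lti ?ltj ?eqxx.
- by rewrite !qbxx.
- have [h1 h2] := px j ltj; have [h3 h4] := py j ltj.
  by rewrite h1 h2 h4 (gtn_eqF ltj).
- have [h1 h2] := px i lti; have [h3 h4] := py i lti.
  by rewrite (qbC (fe F i)) h1 (qbC (ff F i)) h4 (qbC (fe F i)) h3 (ltn_eqF lti).
- exact: sF.
Qed.

Lemma comb_ext F x y a b : comb (ext F x y) a b =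
  comb F a b + (a (fsize F) *: x + b (fsize F) *: y).
Proof.
rewrite /comb big_ord_recr /= ltnn; congr (_ + _).
by apply: eq_bigr => i _; rewrite ltn_ord.
Qed.

Lemma proj_ext F x y u : proj (ext F x y) u = proj F u + (qb u y *: x + qb u x *: y).
Proof.
rewrite /proj comb_ext /= ltnn; congr (_ + _).
by apply: eq_comb => i lti; rewrite lti.
Qed.

Lemma sing_ext F x y : sing F -> qf x = 0 -> qf y = 0 -> sing (ext F x y).
Proof. by move=> sF qx qy i _ /=; case: ifP => [/sF|]. Qed.

Lemma qb_nz x : x <> 0 -> exists y, qb x y = 1.
Proof.
move=> x0; have [y xy] : exists y, qb x y <> 0.
  by apply: contrapT => h; apply: x0; apply: qbnd => y; apply: contrapT => xy; apply: h; exists y.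
by exists ((qb x y)^-1 *: y); rewrite qbZr mulVf //; apply/eqP.
Qed.

(** Subtracting from a partner of [z] its projection leaves the pairing unchanged, as [z] is
    orthogonal to the span of the frame. *)
Lemma perp_partner F z : symp F -> perp F z -> z <> 0 -> exists2 y, perp F y & qb z y = 1.
Proof.
move=> sF pz /qb_nz[y zy]; exists (y - proj F y); first exact: perp_sub.
by rewrite qoppV qbDr1 zy (qbC z) qb_comb_perp // addr0.
Qed.

Lemma not_full F : ~ full F -> exists u, u - proj F u <> 0.
Proof.
by move/existsNP => [u h]; exists u => /eqP; rewrite subr_eq0 => /eqP.
Qed.

Lemma extend_frame F : symp F -> ~ full F ->
  exists x y, [/\ perp F x, perp F y, qb x y = 1 & symp (ext F x y)].
Proof.
move=> sF /not_full[u u0]; have px := perp_sub u sF.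
have [y py xy] := perp_partner sF px u0.
by exists (u - proj F u), y; split=> //; apply: symp_ext.
Qed.

(** The enumeration used by [sum_of_hyperbolic_planes], where the partner of the vector [i] is the
    vector [n + i]. *)
Definition frame_vec F i : E := if (i < fsize F)%N then fe F i else ff F (i - fsize F).

Lemma sum_frame_vec F a : \sum_(i < 2 * fsize F) a i *: frame_vec F i =
  comb F a (fun i => a (fsize F + i)%N).
Proof.
rewrite /comb big_split /= mul2n -addnn big_split_ord.
congr (_ + _); apply: eq_bigr => i _; rewrite /frame_vec /= ?ltn_ord //.
by rewrite ltnNge leq_addr /= addKn.
Qed.

Lemma frame_indep F : symp F -> qindep (2 * fsize F) (frame_vec F).
Proof.
move=> sF a; rewrite sum_frame_vec => h i lti.
have hc j : (j < fsize F)%N -> a j = 0 /\ a (fsize F + j)%N = 0.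
  move=> ltj; have [h1 h2] := comb_coord a (fun i => a (fsize F + i)%N) sF ltj.
  by split; [rewrite -h2 h qb0l|rewrite -h1 h qb0l].
have [lt|ge] := ltnP i (fsize F); first by have [] := hc i lt.
by rewrite -(subnKC ge); have [] := hc (i - fsize F)%N ltac:(lia).
Qed.

Definition qdim_ge n : Prop := exists t : nat -> E, qindep n t.

Lemma qdim_ge_le m n : (m <= n)%N -> qdim_ge n -> qdim_ge m.
Proof.
move=> mn [t ht]; exists t => a h i lti.
have := ht (fun i => if (i < m)%N then a i else 0) _ i (leq_trans lti mn).
rewrite lti; apply; rewrite (bigID (fun i : 'I_n => (i < m)%N)) /=.
rewrite [X in _ + X]big1 => [|j /negPf->]; last by rewrite scale0r.
rewrite addr0 -[RHS]h (big_ord_widen n (fun i => a i *: t i) mn).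
by apply: eq_bigr => j ->.
Qed.

(** With more vectors than coordinates the coordinate matrix has a nonzero left kernel, and a row of
    that kernel is a linear dependency. *)
Lemma full_dim F n (t : nat -> E) : full F -> qindep n t -> (n <= 2 * fsize F)%N.
Proof.
move=> fF ht; rewrite leqNgt; apply/negP => ltn.
set m := fsize F in ltn *.
pose c (i : 'I_n) (j : 'I_(2 * m)) : k :=
  if (j < m)%N then qb (t i) (ff F j) else qb (t i) (fe F (j - m)).
pose A : 'M[k]_(n, 2 * m) := \matrix_(i, j) c i j.
have : kermx A != 0.
  rewrite -mxrank_eq0 mxrank_ker subn_eq0 -ltnNge.
  exact: leq_ltn_trans (rank_leq_col A) ltn.
move=> /rowV0Pn[r /sub_kermxP rA r0].
pose a i : k := if insub i is Some j then r 0 (j : 'I_n) else 0.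
have aE (i : 'I_n) : a i = r 0 i by rewrite /a valK.
have h : \sum_(i < n) a i *: t i = 0.
  rewrite [LHS]fF /proj -[RHS](comb0 F); apply: eq_comb => j ltj.
  rewrite !(qb_suml _ (fun i => a i *: t i)).
  have lt1 : (j < 2 * m)%N by rewrite mul2n -addnn ltn_addr.
  have lt2 : (m + j < 2 * m)%N by rewrite mul2n -addnn ltn_add2l.
  move/matrixP: (rA) => /(_ 0 (Ordinal lt1)); move/matrixP: rA => /(_ 0 (Ordinal lt2)).
  rewrite !mxE => h2 h1; split; [rewrite -[RHS]h1|rewrite -[RHS]h2];
  by apply: eq_bigr => i _; rewrite qbZl aE mxE /c /= ?ltj // ltnNge leq_addr /= addKn.
move/eqP: r0; apply; apply/rowP => i; rewrite mxE -aE; exact: ht h _ _.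
Qed.

(** A frame that does not span can be lengthened, so without a spanning frame there are frames of
    every size. In particular a finite dimension is even. *)
Lemma frame_dichotomy : (forall n, qdim_ge n) \/ exists F, symp F /\ full F.
Proof.
have [ex|nex] := pselect (exists F, symp F /\ full F); [by right|left=> n].
have [F [sF szF]] : exists F, symp F /\ fsize F = n.
  elim: n => [|n [F [sF szF]]]; first by exists (Frame (fun=> 0) (fun=> 0) 0).
  have [fF|/(extend_frame sF)[x [y [_ _ _ s]]]] := pselect (full F).
    by case: nex; exists F.
  by exists (ext F x y); rewrite /= szF.
apply: (@qdim_ge_le n (2 * fsize F)); first by rewrite szF; lia.
exact: ex_intro (frame_indep sF).
Qed.

Lemma full_frame_dim F : symp F -> full F ->
  qdim_ge (2 * fsize F) /\ ~ qdim_ge (2 * fsize F).+1.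
Proof.
move=> sF fF; split; first exact: ex_intro (frame_indep sF).
by move=> [t /(full_dim fF)]; rewrite ltnn.
Qed.

Lemma full_frame_of_dim n : qdim_ge (2 * n) -> ~ qdim_ge (2 * n).+1 ->
  exists F, [/\ symp F, full F & fsize F = n].
Proof.
move=> h1 h2; case: frame_dichotomy => [h|[F [sF fF]]]; first by case: h2.
exists F; split=> //; have [h3 h4] := full_frame_dim sF fF.
have : ~ (2 * n < 2 * fsize F)%N by move=> lt; apply: h2; apply: qdim_ge_le lt h3.
have : ~ (2 * fsize F < 2 * n)%N by move=> lt; apply: h4; apply: qdim_ge_le lt h1.
lia.
Qed.

(** * Singular vectors over a perfect field *)

Section Perfect.
Hypothesis perfect : forall a : k, exists b : k, b * b = a.

(* Shifting [z] by a multiple of a singular vector [y] makes it singular, so it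
   suffices to find [y]; in large dimension a vector orthogonal to everything
   at hand corrects the value of the form at a partner of [z]. *)
Lemma hyperbolic_plane F z : (forall n, qdim_ge n) -> symp F -> sing F -> perp F z -> z <> 0 ->
  exists x y, [/\ perp F x, perp F y, qb x y = 1, sing (ext F x y) & z = proj (ext F x y) z].
Proof.
move=> inf sF siF pz z0.
have inf_not_full F' : ~ full F' by move=> /full_dim h; have [t /h] := inf (2 * fsize F').+1; rewrite ltnn.
have [f0 pf0 zf0] := perp_partner sF pz z0.
have sF1 := symp_ext sF pz pf0 zf0.
have [x1 [y1 [px1 py1 xy1 _]]] := extend_frame sF1 (inf_not_full _).
(* If [x1] and [y1] are both singular, the form takes at their sum the value [qb x1 y1 = 1]. *)
have [y2 py2 qy2] : exists2 y2, perp (ext F z f0) y2 & qf y2 <> 0.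
  have [h1|] := pselect (qf x1 = 0); last by exists x1.
  have [h2|] := pselect (qf y1 = 0); last by exists y1.
  exists (x1 + y1); last by rewrite qfD h1 h2 xy1 !add0r; apply/eqP; rewrite oner_eq0.
  by move=> i lti; have [a1 a2] := px1 i lti; have [b1 b2] := py1 i lti; rewrite !qbDl1 a1 a2 b1 b2 !addr0.
(* As [f0] and [y2] are orthogonal, the form takes at [f0 + c *: y2] the value
   [qf f0 + c * c * qf y2], which is twice [qf f0]. *)
have [c hc] := perfect (qf f0 / qf y2).
have py2F i : (i < fsize F)%N -> qb y2 (fe F i) = 0 /\ qb y2 (ff F i) = 0.
  by move=> lti; have := py2 i (ltnW lti); rewrite /= lti.
have [y2z y2f0] : qb y2 z = 0 /\ qb y2 f0 = 0.
  by have := py2 (fsize F) (leqnn _); rewrite /= ltnn.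
pose y := f0 + c *: y2.
have qy : qf y = 0.
  rewrite /y qfD qfZ qbZr (qbC f0) y2f0 mulr0 addr0 hc divfK; last exact/eqP.
  exact: qaddkk.
have zy : qb z y = 1 by rewrite /y qbDr1 zf0 qbZr (qbC z) y2z mulr0 addr0.
have py : perp F y.
  move=> i lti; have [h1 h2] := pf0 i lti; have [h3 h4] := py2F i lti.
  by rewrite /y !qbDl1 !qbZl h1 h2 h3 h4 !mulr0 !addr0.
(* Since [y] is singular and [qb z y = 1], the value at [x] is twice [qf z], hence zero, and [z]
   equals [x + qf z *: y]. *)
pose x := z + qf z *: y.
have xy : qb x y = 1 by rewrite /x qbDl1 zy qbZl qbxx mulr0 addr0.
exists x, y; split=> //.
- move=> i lti; have [h1 h2] := pz i lti; have [h3 h4] := py i lti.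
  by rewrite /x !qbDl1 !qbZl h1 h2 h3 h4 !mulr0 !addr0.
- by apply: sing_ext => //; rewrite /x qfD qfZ qy mulr0 addr0 qbZr zy mulr1 qaddkk.
- rewrite proj_ext (proj_perp pz) add0r zy scale1r /x qbDr1 qbxx add0r qbZr zy mulr1.
  by rewrite -addrA qaddVV addr0.
Qed.

Lemma singular_translate F : symp F -> exists v, forall i, (i < fsize F)%N ->
  qf (fe F i) + qb v (fe F i) ^+ 2 = 0 /\ qf (ff F i) + qb v (ff F i) ^+ 2 = 0.
Proof.
move=> sF; have /choice[s hs] := perfect.
(* The coefficients are square roots of the values to be cancelled, in crossed order because pairing
   with [fe F i] reads the coefficient of [ff F i]. *)
exists (comb F (fun i => s (qf (ff F i))) (fun i => s (qf (fe F i)))) => i lti.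
have [-> ->] := comb_coord (fun i => s (qf (ff F i))) (fun i => s (qf (fe F i))) sF lti.
by rewrite !expr2 !hs !qaddkk.
Qed.

End Perfect.

End Frames.

(** * Back and forth between quadratic spaces *)

Definition perfect_field (k : fieldType) : Prop := forall a : k, exists b : k, b * b = a.

Section Config.
Variables (D1 D2 : qspace).
Local Notation k1 := (qK D1).
Local Notation k2 := (qK D2).
Local Notation F1 := (Kred (str false D1 false)).
Local Notation F2 := (Kred (str false D2 false)).

(** By [c_mode] a new vector never leads to a mismatch: either both frames already span, or both can
    be lengthened indefinitely. *)
Record config (G : (F1 tt -> F2 tt -> Prop) -> Prop) (g : k1 -> k2 -> Prop)
    (B1 : frame D1) (B2 : frame D2) : Prop := Config {
  c_field : G g;
  c_size : fsize B1 = fsize B2;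
  c_symp1 : symp B1; c_sing1 : sing B1;
  c_symp2 : symp B2; c_sing2 : sing B2;
  c_mode : (full B1 /\ full B2) \/
    ((forall n, qdim_ge D1 n) /\ (forall n, qdim_ge D2 n)) }.

Definition vrel (g : k1 -> k2 -> Prop) (B1 : frame D1) (B2 : frame D2) (u : qV D1) (u' : qV D2) : Prop :=
  [/\ u = proj B1 u, u' = proj B2 u' & forall i, (i < fsize B1)%N ->
    g (qb u (fe B1 i)) (qb u' (fe B2 i)) /\ g (qb u (ff B1 i)) (qb u' (ff B2 i))].

Definition krel g B1 B2 (s : QSort) : str_carrier D1 s -> str_carrier D2 s -> Prop :=
  match s return str_carrier D1 s -> str_carrier D2 s -> Prop with
  | K => g
  | V | Q => vrel g B1 B2
  end.

End Config.

Lemma config_sym (D1 D2 : qspace) G g B1 B2 : @config D1 D2 G g B1 B2 ->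
  @config D2 D1 (fun g => G (fun a b => g b a)) (fun a b => g b a) B2 B1.
Proof. by case=> *; split=> //; tauto. Qed.

Lemma krel_sym (D1 D2 : qspace) g B1 B2 s a b : fsize B1 = fsize B2 ->
  @krel D1 D2 g B1 B2 s a b -> @krel D2 D1 (fun a b => g b a) B2 B1 s b a.
Proof. by move=> sz; case: s a b => //= a b [? ? h]; split=> //; rewrite -sz. Qed.

Section Forth.
Variables (D1 D2 : qspace).
Local Notation k1 := (qK D1).
Local Notation k2 := (qK D2).
Local Notation F1 := (Kred (str false D1 false)).
Local Notation F2 := (Kred (str false D2 false)).
Variable G : (F1 tt -> F2 tt -> Prop) -> Prop.
Hypotheses (GS : field_system G) (perf1 : perfect_field k1) (perf2 : perfect_field k2).

Section Closure.
Variable g : k1 -> k2 -> Prop.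
Hypothesis Gg : G g.

Lemma g0 : g 0 0. Proof. exact: (fs_zero GS Gg). Qed.
Lemma g1 : g 1 1. Proof. exact: (fs_one GS Gg). Qed.
Lemma gD a a' b b' : g a a' -> g b b' -> g (a + b) (a' + b').
Proof. exact: (fs_add GS Gg). Qed.
Lemma gN a a' : g a a' -> g (- a) (- a'). Proof. exact: (fs_opp GS Gg). Qed.
Lemma gM a a' b b' : g a a' -> g b b' -> g (a * b) (a' * b').
Proof. exact: (fs_mul GS Gg). Qed.
Lemma gI a a' b b' : g a a' -> g b b' -> (a = b <-> a' = b').
Proof. exact: (fs_eq GS Gg). Qed.

Lemma g_sum n (a : nat -> k1) (a' : nat -> k2) : (forall i, (i < n)%N -> g (a i) (a' i)) ->
  g (\sum_(i < n) a i) (\sum_(i < n) a' i).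
Proof.
elim: n => [|n IH] h; rewrite ?big_ord0 ?big_ord_recr /=; first exact: g0.
by apply: gD; [apply: IH => i /ltnW; exact: h|exact: h].
Qed.

Lemma g_forth_list n (a : nat -> k1) : exists g' (a' : nat -> k2),
  [/\ G g', forall x y, g x y -> g' x y & forall i, (i < n)%N -> g' (a i) (a' i)].
Proof.
elim: n => [|n [g' [a' [Gg' gg' h]]]]; first by exists g, (fun=> 0).
have [g2 [b [Gg2 g'g2 hb]]] := fs_forth GS Gg' (a n).
exists g2, (fun i => if i == n then b else a' i); split=> // [x y /gg'/g'g2//|i].
by rewrite ltnS leq_eqVlt; case: eqP => [->|_] //= /h/g'g2.
Qed.

End Closure.

Section Relation.
Variables (g : k1 -> k2 -> Prop) (B1 : frame D1) (B2 : frame D2).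
Hypothesis (C : config G g B1 B2).
Let Gg : G g := c_field C.
Local Notation rel := (vrel g B1 B2).

Lemma vrel0 : rel 0 0.
Proof. by split=> [||i _]; rewrite ?proj0 // !qb0l; split; apply: g0. Qed.

Lemma vrelD u u' x x' : rel u u' -> rel x x' -> rel (u + x) (u' + x').
Proof.
move=> [hu hu' h1] [hx hx' h2]; split=> [||i lti]; rewrite ?projD -?hu -?hx -?hu' -?hx' //.
have [? ?] := h1 i lti; have [? ?] := h2 i lti.
by rewrite !qbDl1; split; apply: gD.
Qed.

Lemma vrelZ a a' u u' : g a a' -> rel u u' -> rel (a *: u) (a' *: u').
Proof.
move=> ga [hu hu' h1]; split=> [||i lti]; rewrite ?projZ -?hu -?hu' //.
by have [? ?] := h1 i lti; rewrite !qbZl; split; apply: gM.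
Qed.

Lemma vrel_qb u u' x x' : rel u u' -> rel x x' -> g (qb u x) (qb u' x').
Proof.
move=> [hu hu' h1] [_ _ h2]; rewrite hu hu' /proj !qb_comb -(c_size C).
apply: (@g_sum _ Gg (fsize B1)
  (fun i => qb u (ff B1 i) * qb (fe B1 i) x + qb u (fe B1 i) * qb (ff B1 i) x)
  (fun i => qb u' (ff B2 i) * qb (fe B2 i) x' + qb u' (fe B2 i) * qb (ff B2 i) x')) => i lti.
have [? ?] := h1 i lti; have [? ?] := h2 i lti.
by rewrite -!(qbC x) -!(qbC x'); apply: gD => //; apply: gM.
Qed.

Lemma vrel_qf u u' : rel u u' -> g (qf u) (qf u').
Proof.
move=> [hu hu' h1]; rewrite hu hu' /proj (qf_comb _ _ (c_symp1 C) (c_sing1 C)).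
rewrite (qf_comb _ _ (c_symp2 C) (c_sing2 C)) -(c_size C).
apply: (@g_sum _ Gg (fsize B1)
  (fun i => qb u (ff B1 i) * qb u (fe B1 i)) (fun i => qb u' (ff B2 i) * qb u' (fe B2 i))) => i lti.
by have [? ?] := h1 i lti; apply: gM.
Qed.

Lemma vrel_zero u u' : rel u u' -> u = 0 -> u' = 0.
Proof.
move=> [hu hu' h] u0; rewrite hu' -[RHS](comb0 B2); apply: eq_comb => i; rewrite -(c_size C) => /h[].
rewrite u0 !qb0l => h1 h2.
by split; [apply/(gI Gg h2 (g0 Gg))|apply/(gI Gg h1 (g0 Gg))].
Qed.

Lemma vrel_comb (a b : nat -> k1) (a' b' : nat -> k2) :
  (forall i, (i < fsize B1)%N -> g (a i) (a' i) /\ g (b i) (b' i)) ->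
  rel (comb B1 a b) (comb B2 a' b').
Proof.
move=> h; split=> [||i lti].
- by rewrite proj_comb //; exact: c_symp1 C.
- by rewrite proj_comb //; exact: c_symp2 C.
have [h1 h2] := h i lti.
have [-> ->] := comb_coord a b (c_symp1 C) lti.
rewrite (c_size C) in lti.
by have [-> ->] := comb_coord a' b' (c_symp2 C) lti.
Qed.

Lemma vrel_sum n (a : nat -> k1) (a' : nat -> k2) t t' :
  (forall i, (i < n)%N -> g (a i) (a' i)) -> (forall i, (i < n)%N -> rel (t i) (t' i)) ->
  rel (\sum_(i < n) a i *: t i) (\sum_(i < n) a' i *: t' i).
Proof.
elim: n => [|n IH] h1 h2; rewrite ?big_ord0 ?big_ord_recr /=; first exact: vrel0.
apply: vrelD; first by apply: IH => i /ltnW; [exact: h1|exact: h2].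
by apply: vrelZ; [exact: h1|exact: h2].
Qed.

Lemma config_field g' : G g' -> config G g' B1 B2.
Proof. by case: C => *; split. Qed.

End Relation.

Lemma vrel_mono (g g' : k1 -> k2 -> Prop) B1 B2 u u' : (forall x y, g x y -> g' x y) ->
  vrel g B1 B2 u u' -> vrel g' B1 B2 u u'.
Proof. by move=> gg' [h1 h2 h]; split=> // i /h[? ?]; split; apply: gg'. Qed.

Lemma krel_mono (g g' : k1 -> k2 -> Prop) B1 B2 : (forall x y, g x y -> g' x y) ->
  forall s a b, @krel D1 D2 g B1 B2 s a b -> krel g' B1 B2 a b.
Proof. by move=> gg' [] a b //=; [exact: gg'|exact: vrel_mono|exact: vrel_mono]. Qed.

(** The coefficients of a dependency in the first space receive partners in a larger relation, and
    these form a dependency in the second space. *)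
Lemma vrel_indep g B1 B2 n (t : nat -> qV D1) (t' : nat -> qV D2) : config G g B1 B2 ->
  (forall i, (i < n)%N -> vrel g B1 B2 (t i) (t' i)) -> qindep n t' -> qindep n t.
Proof.
move=> C ht it' a ta i lti.
have [g' [a' [Gg' gg' ga']]] := g_forth_list (c_field C) n a.
have C' := config_field C Gg'.
have rs := vrel_sum C' ga' (fun i lti => vrel_mono gg' (ht i lti)).
have := it' _ (vrel_zero C' rs ta) i lti.
by move/(gI Gg' (ga' i lti) (g0 Gg')).
Qed.

Lemma vrel_wp g B1 B2 a a' : config G g B1 B2 -> g a a' -> wp a -> wp a'.
Proof.
move=> C ga [t at_]; have [g' [t' [Gg' gg' gt]]] := fs_forth GS (c_field C) t.
exists t'; apply/(gI Gg' (gg' _ _ ga) _); last exact: at_.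
by apply: (gD Gg'); [apply: gM|apply: gN].
Qed.

Lemma vrel_ext g B1 B2 x y x' y' u u' : config G g B1 B2 ->
  perp B1 x -> perp B1 y -> perp B2 x' -> perp B2 y' ->
  vrel g B1 B2 u u' -> vrel g (ext B1 x y) (ext B2 x' y') u u'.
Proof.
move=> C px py px' py' [hu hu' h].
have q1 : qb u x = 0 by rewrite hu qb_comb_perp.
have q2 : qb u y = 0 by rewrite hu qb_comb_perp.
have q3 : qb u' x' = 0 by rewrite hu' qb_comb_perp.
have q4 : qb u' y' = 0 by rewrite hu' qb_comb_perp.
split=> [||i]; rewrite ?proj_ext ?q1 ?q2 ?q3 ?q4 ?scale0r ?addr0 //=.
rewrite ltnS leq_eqVlt -(c_size C) => /predU1P[->|lti]; last by rewrite lti; exact: h.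
by rewrite ltnn q1 q2 q3 q4; split; apply: g0 (c_field C).
Qed.

(** The component of [u] orthogonal to [B1] is caught in a hyperbolic plane. On the other side any
    hyperbolic plane orthogonal to [B2] will do, because singular symplectic bases of planes all
    look alike. *)
Lemma config_cover g B1 B2 u : config G g B1 B2 -> exists B1' B2',
  [/\ config G g B1' B2', u = proj B1' u &
     forall x x', vrel g B1 B2 x x' -> vrel g B1' B2' x x'].
Proof.
move=> C; have [->|u0] := eqVneq u (proj B1 u).
  by exists B1, B2; split=> //; rewrite projK //; exact: c_symp1 C.
case: (C) => Gg sz sy1 si1 sy2 si2 [[f1 _]|[inf1 inf2]].
  by rewrite -f1 eqxx in u0.
have pz := perp_sub u sy1.
have [|x [y [px py xy si z_xy]]] := hyperbolic_plane perf1 inf1 sy1 si1 pz.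
  by apply/eqP; rewrite subr_eq0.
have nf2 : ~ full B2.
  by move=> /full_dim h; have [t /h] := inf2 (2 * fsize B2).+1; rewrite ltnn.
have [z' z'0] := not_full nf2.
have [x' [y' [px' py' xy' si' _]]] := hyperbolic_plane perf2 inf2 sy2 si2 (perp_sub z' sy2) z'0.
exists (ext B1 x y), (ext B2 x' y'); split.
- split=> //=; rewrite ?sz //; [exact: symp_ext|exact: symp_ext|by right].
- have -> : u = proj B1 u + (u - proj B1 u) by rewrite addrC subrK.
  rewrite [RHS]projD -z_xy proj_ext !qb_comb_perp // !scale0r !addr0 projK //.
- by move=> ? ?; apply: vrel_ext.
Qed.

Lemma forth g B1 B2 s (a : str_carrier D1 s) : config G g B1 B2 ->
  exists g' B1' B2' (b : str_carrier D2 s),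
  [/\ config G g' B1' B2', forall s x y, @krel D1 D2 g B1 B2 s x y -> krel g' B1' B2' x y
    & krel g' B1' B2' a b].
Proof.
move=> C; case: s a => a.
- have [g' [b [Gg' gg' gb]]] := fs_forth GS (c_field C) a.
  by exists g', B1, B2, b; split=> //; [exact: (config_field C Gg')|exact: krel_mono].
all: have [B1' [B2' [C' aE h]]] := config_cover a C;
  have [g' [b [Gg' gg' gb]]] := g_forth_list (c_field C') (fsize B1') (fun i => qb (a : qV D1) (ff B1' i));
  have [g2 [c [Gg2 g'g2 gc]]] := g_forth_list Gg' (fsize B1') (fun i => qb (a : qV D1) (fe B1' i));
  have C2 := config_field C' Gg2;
  exists g2, B1', B2', (comb B2' b c); split=> //;
  [move=> s x y; case: s x y => x y /=; [by move/gg'/g'g2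
     |by move/h/(vrel_mono gg')/(vrel_mono g'g2)|by move/h/(vrel_mono gg')/(vrel_mono g'g2)]
  |rewrite /= aE; apply: (vrel_comb C2) => i lti; split; [exact/g'g2/gb|exact: gc]].
Qed.

End Forth.

Section TwoSided.
Variables (D1 D2 : qspace).
Local Notation k1 := (qK D1).
Local Notation k2 := (qK D2).
Variable G : (k1 -> k2 -> Prop) -> Prop.
Hypotheses (GS : @field_system (Kred (str false D1 false)) (Kred (str false D2 false)) G).
Let GS' := field_system_sym GS.

Lemma vrel_zero_iff g B1 B2 u u' : config G g B1 B2 -> vrel g B1 B2 u u' -> (u = 0 <-> u' = 0).
Proof.
move=> C r; split; first exact: (vrel_zero GS C r).
have r' : vrel (fun a b => g b a) B2 B1 u' u by apply: (@krel_sym D1 D2 g B1 B2 V) (c_size C) r.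
exact: (vrel_zero GS' (config_sym C) r').
Qed.

Lemma vrel_indep_iff g B1 B2 n (t : nat -> qV D1) (t' : nat -> qV D2) : config G g B1 B2 ->
  (forall i, (i < n)%N -> vrel g B1 B2 (t i) (t' i)) -> (qindep n t <-> qindep n t').
Proof.
move=> C r; split; last exact: (vrel_indep GS C r).
apply: (vrel_indep GS' (config_sym C)) => i lti.
exact: (@krel_sym D1 D2 g B1 B2 V) (c_size C) (r i lti).
Qed.

Lemma vrel_wp_iff g B1 B2 a a' : config G g B1 B2 -> g a a' -> (wp a <-> wp a').
Proof.
move=> C ga; split; first exact: (vrel_wp GS C ga).
exact: (vrel_wp GS' (config_sym C)).
Qed.

(** The coordinates may be field elements without a partner, whence the larger [g']. In
    characteristic two the equation says that a sum of related vectors vanishes, which the relation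
    preserves. *)
Lemma vrel_coords g B1 B2 n (t : nat -> qV D1) (t' : nat -> qV D2) (a : nat -> k1) :
  config G g B1 B2 -> (forall i, (i <= n)%N -> vrel g B1 B2 (t i) (t' i)) ->
  t n = \sum_(j < n) a j *: t j ->
  exists g' (a' : nat -> k2), [/\ G g', forall x y, g x y -> g' x y,
    forall i, (i < n)%N -> g' (a i) (a' i) & t' n = \sum_(j < n) a' j *: t' j].
Proof.
move=> C r tn; have [g' [a' [Gg' gg' ga']]] := g_forth_list GS (c_field C) n a.
exists g', a'; split=> //; have C' := config_field C Gg'.
have r1 := vrel_sum GS C' ga' (fun i lti => vrel_mono gg' (r i (ltnW lti))).
have r2 := vrelD GS C' (vrel_mono gg' (r n (leqnn n))) r1.
have := (vrel_zero_iff C' r2).1; rewrite tn qaddVV => /(_ erefl)/eqP.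
by rewrite addr_eq0 qoppV => /eqP.
Qed.

End TwoSided.

Section Equivalence.
Variables (w : bool) (D1 D2 : qspace) (o1 o2 : bool).
Hypothesis o12 : w -> o1 = o2.
Local Notation k1 := (qK D1).
Local Notation k2 := (qK D2).
Variable G : (k1 -> k2 -> Prop) -> Prop.
Hypotheses (GS : @field_system (Kred (str false D1 false)) (Kred (str false D2 false)) G).
Hypotheses (perf1 : perfect_field k1) (perf2 : perfect_field k2).
Let GS' : @field_system (Kred (str false D2 false)) (Kred (str false D1 false))
  (fun g => G (fun a b => g b a)) := field_system_sym GS.

Definition cindex : Type :=
  {c : (k1 -> k2 -> Prop) * frame D1 * frame D2 | config G c.1.1 c.1.2 c.2}.

Definition crel (c : cindex) : forall s : QSort, str w D1 o1 s -> str w D2 o2 s -> Prop :=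
  krel (sval c).1.1 (sval c).1.2 (sval c).2.

Definition cle (c c' : cindex) : Prop := forall s a b, crel c (s:=s) a b -> crel c' a b.

Lemma cindex_mono (c : cindex) g' : G g' -> (forall x y, (sval c).1.1 x y -> g' x y) ->
  exists c' : cindex, [/\ cle c c', (sval c').1.1 = g', (sval c').1.2 = (sval c).1.2 & (sval c').2 = (sval c).2].
Proof.
case: c => -[[g B1] B2] /= C Gg' gg'.
by exists (exist _ (g', B1, B2) (config_field C Gg')); split=> //= s a b; apply: krel_mono.
Qed.

(** Among the function symbols only [Pi] moves to a larger index; all other values are already
    related at the given one. *)
Lemma completeness_back_and_forth :
  @back_and_forth (LQ w) (str w D1 o1) (str w D2 o2) cindex cle crel.
Proof.
have cnth (c : cindex) n (a : htuple (str_carrier D1) (nseq n V)) (b : htuple (str_carrier D2) (nseq n V)) i :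
    @hrel QSort (str_carrier D1) (str_carrier D2) (crel c) _ a b -> (i < n)%N ->
    vrel (sval c).1.1 (sval c).1.2 (sval c).2 (@hnth _ (str_carrier D1) V (0 : qV D1) n a i)
     (@hnth _ (str_carrier D2) V (0 : qV D2) n b i).
  move=> ab lti.
  exact: (@hrel_hnth QSort (str_carrier D1) (str_carrier D2) (crel c) V n a b (0 : qV D1) (0 : qV D2) ab i lti).
split.
- by move=> c s a b.
- by move=> c c' c'' h1 h2 s a b /h1/h2.
- by move=> c c' s a b h /h.
- move=> [[[g B1] B2] C] s a b a' b'; rewrite /crel /=.
  case: s a b a' b' => a b a' b' /=; first exact: (gI GS (c_field C)).
  1,2: move=> r r'; have r0 := vrel_zero_iff GS C (vrelD GS C r r').
  1,2: by split=> e; apply/eqP; rewrite -subr_eq0 qoppV; apply/eqP/r0; rewrite e qaddVV.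
- move=> c d s g a b ab.
  have Gc := c_field (svalP c); have Cc := svalP c.
  case: g a b ab.
  + move=> d' s' g a b ab; exists c; split=> //; case: g a b ab.
    * by move=> a b ab; exact: (g0 GS Gc).
    * by move=> a b ab; exact: (g1 GS Gc).
    * by move=> [x [y []]] [x' [y' []]] /= [r1 [r2 _]]; exact: (gD GS Gc r1 r2).
    * by move=> [x []] [x' []] /= [r1 _]; exact: (gN GS Gc r1).
    * by move=> [x [y []]] [x' [y' []]] /= [r1 [r2 _]]; exact: (gM GS Gc r1 r2).
  + by move=> a b ab; exists c; split=> //; exact: (vrel0 GS Cc).
  + by move=> [x [y []]] [x' [y' []]] /= [r1 [r2 _]]; exists c; split=> //; exact: (vrelD GS Cc r1 r2).
  + by move=> [x []] [x' []] /= [r1 _]; exists c; split=> //; rewrite /= !qoppV.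
  + by move=> [x [y []]] [x' [y' []]] /= [r1 [r2 _]]; exists c; split=> //; exact: (vrelZ GS Cc r1 r2).
  + move=> n j a b ab.
    set t : nat -> qV D1 := @hnth _ (str_carrier D1) V (0 : qV D1) n.+2 a.
    set t' : nat -> qV D2 := @hnth _ (str_carrier D2) V (0 : qV D2) n.+2 b.
    have r i (lti : (i < n.+2)%N) : vrel (sval c).1.1 (sval c).1.2 (sval c).2 (t i) (t' i) := cnth c _ a b i ab lti.
    have ri := vrel_indep_iff GS Cc (fun i lti => r i (ltnW lti)).
    have [[x [ht hx]]|nex] := pselect (exists x : nat -> k1, qindep n.+1 t /\ t n.+1 = \sum_(l < n.+1) x l *: t l).
      have [g' [x' [Gg' gg' gx' tx']]] := vrel_coords GS Cc r hx.
      have [c' [cc' eg' _ _]] := cindex_mono Gg' gg'.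
      exists c'; split=> //; rewrite /crel /= eg' (qpiE ht hx) // (qpiE (ri.1 ht) tx') //.
      exact: gx'.
    (* Both values are the default 0: coordinates in the second space would give coordinates in the
       first through the reversed system. *)
    exists c; split=> //; rewrite /crel /= (qpi0 _ nex) qpi0; first exact: (g0 GS Gc).
    move=> [x' [ht' hx']]; apply: nex.
    have r' i (lti : (i <= n.+1)%N) := @krel_sym D1 D2 _ _ _ V _ _ (c_size Cc) (r i lti).
    have [g' [x [Gg' gg' gx tx]]] := vrel_coords GS' (config_sym Cc) r' hx'.
    by exists x; split=> //; apply/ri.
  + move=> [x [y []]] [x' [y' []]] /= [r1 [r2 _]]; exists c; split=> //; exact: (vrel_qb GS Cc r1 r2).
  + by move=> [x [y []]] [x' [y' []]] /= [r1 [r2 _]]; exists c; split=> //; exact: (vrelD GS Cc r1 r2).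
  + move=> [x [y []]] [x' [y' []]] /= [r1 [r2 _]]; exists c; split=> //.
    by rewrite /crel /= !qoppV; exact: (vrelD GS Cc r1 r2).
  + move=> [x [y []]] [x' [y' []]] /= [r1 [r2 _]]; exists c; split=> //.
    apply: (gD GS Gc); first exact: (vrel_qf GS Cc r2).
    by rewrite !expr2; apply: (gM GS Gc); exact: (vrel_qb GS Cc r1 r2).
  + move=> ww [x []] [x' []] /= [r1 _]; exists c; split=> //.
    (* The symbol [Omega] exists only if [w] holds, and then the bits at the two base points agree;
       what remains is membership in the Artin-Schreier image. *)
    rewrite /crel /= /qomega -(o12 ww).
    have -> : `[< wp (qf (x' : qV D2)) >] = `[< wp (qf (x : qV D1)) >].
      by apply: asbool_equiv_eq; apply: iff_sym; apply: (vrel_wp_iff GS Cc); exact: (vrel_qf GS Cc r1).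
    by case: (_ (+) _); [exact: (g1 GS Gc)|exact: (g0 GS Gc)].
- move=> c d r a b ab; case: r a b ab => n a b ab.
  by apply: (vrel_indep_iff GS (svalP c)) => i lti; exact: (cnth c _ a b i ab lti).
- move=> c s a.
  have [g' [B1 [B2 [b [C h r]]]]] := forth GS perf1 perf2 (s:=s) a (svalP c).
  by exists (exist _ (g', B1, B2) C), b.
- move=> c s b.
  have [g' [B1 [B2 [a [C h r]]]]] := forth GS' perf2 perf1 (s:=s) b (config_sym (svalP c)).
  have C' := config_sym C.
  exists (exist _ (fun a b => g' b a, B2, B1) C'), a; split; last first.
    exact: (@krel_sym D2 D1 _ _ _ s) (c_size C) r.
  move=> s' x y /(@krel_sym D1 D2 _ _ _ s' x y (c_size (svalP c)))/h.
  exact: (@krel_sym D2 D1 _ _ _ s') (c_size C).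
Qed.

Lemma str_equiv g B1 B2 f : config G g B1 B2 -> holds (str w D1 o1) f <-> holds (str w D2 o2) f.
Proof.
move=> C; exact: (back_and_forth_holds completeness_back_and_forth (exist _ (g, B1, B2) C)).
Qed.

End Equivalence.

(** * Finite fields *)

Section FinFieldOf.
Variables (F : structure Lring) (H : model field_theory F) (e : seq (fcar H)).
Hypothesis (he : forall x, x \in e).

Definition ffcar of (forall x, x \in e) : Type := fcar H.
HB.instance Definition _ := GRing.Field.on (ffcar he).

Lemma ffcar_pickleK : pcancel (fun x : ffcar he => index (x : fcar H) e) (fun n => onth e n).
Proof.
move=> x; have := he x; elim: (e) => //= y s IH; rewrite inE.
by case: (eqVneq y x) => [->|ne] //; rewrite eq_sym (negPf ne).
Qed.

HB.instance Definition _ := PCanIsCountable ffcar_pickleK.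

Lemma ffcar_enum : Finite.axiom (undup e : seq (ffcar he)).
Proof. by apply: Finite.uniq_enumP; [exact: undup_uniq|move=> x; rewrite mem_undup; exact: he]. Qed.

HB.instance Definition _ := isFinite.Build (ffcar he) ffcar_enum.

Definition fin_field_of : finFieldType := ffcar he.

End FinFieldOf.

Lemma card_eq_fin_field (F : structure Lring) (H : model field_theory F) n :
  holds F (card_eq (S:=Lring) tt n) ->
  exists (e : seq (fcar H)) (he : forall x, x \in e), #|fin_field_of he| = n.
Proof.
move=> /card_eqP -/(_ (inhabits (fzero F)))[a [aI aS]].
have he (x : fcar H) : x \in [seq (a i : fcar H) | i <- iota 0 n].
  by have [i lti ->] := aS x; apply: map_f; rewrite mem_iota0.
exists [seq (a i : fcar H) | i <- iota 0 n], he.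
rewrite fintype.cardE enumT unlock /= undup_id ?size_map ?size_iota //.
rewrite map_inj_in_uniq ?iota_uniq // => i j; rewrite !mem_iota0 => lti ltj ij.
by apply/eqP; apply: contrapT => /negP ne; exact: (aI i j lti ltj ne).
Qed.

Lemma finType_card_eq S (M : structure S) s (T : finType) (x0 : T) (h : T -> M s) :
  bijective h -> holds M (card_eq s #|T|).
Proof.
move=> hB; have hI := bij_inj hB; case: hB => h' _ h'K.
apply/card_eqP; first exact: (inhabits (h x0)).
have szE : size (enum T) = #|T| by rewrite fintype.cardE.
exists (fun i => h (nth x0 (enum T) i)); split=> [i j lti ltj ne /hI|x].
  by apply/eqP; rewrite nth_uniq ?szE ?enum_uniq.
exists (index (h' x) (enum T)); first by rewrite -szE index_mem mem_enum.
by rewrite nth_index ?h'K // mem_enum.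
Qed.

Lemma fin_field_card_eq (F : structure Lring) (H : model field_theory F) (e : seq (fcar H))
    (he : forall x, x \in e) : holds F (card_eq (S:=Lring) tt #|fin_field_of he|).
Proof. by apply: (@finType_card_eq Lring F tt (fin_field_of he) 0 id); exists id. Qed.

(** * Squares and the Artin-Schreier map over finite fields *)

Section Char2FinField.
Variable k : finFieldType.
Hypothesis k2 : 2%N \in [pchar k].
Local Open Scope set_scope.

(** The map sends 0 and 1 to 0. If it were onto, a section of it would be injective, hence onto by
    finiteness, and would reach both 0 and 1 from the argument 0. *)
Lemma fin_AS_not_onto : exists a : k, ~ wp a.
Proof.
apply: contrapT => h.
have /choice[g hg] : forall a : k, exists t, a = t * t - t.
  by move=> a; apply: contrapT => na; apply: h; exists a.
have gI : injective g by move=> a b ab; rewrite (hg a) ab -hg.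
have /codomP[a ga] := injF_onto gI 0; have /codomP[b gb] := injF_onto gI 1.
have a0 : a = 0 by rewrite (hg a) -ga mul0r subrr.
have b0 : b = 0 by rewrite (hg b) -gb mul1r subrr.
have : g a = g b by rewrite a0 b0.
by rewrite -ga -gb => /esym/eqP; rewrite oner_eq0.
Qed.

(** Squaring is injective in characteristic two, hence onto by finiteness. *)
Lemma fin_perfect : perfect_field k.
Proof.
move=> a; have fI : injective (fun x : k => x * x).
  move=> x y /eqP; rewrite -subr_eq0 -!expr2 subr_sqr mulf_eq0 => /orP[|].
    by rewrite subr_eq0 => /eqP.
  by rewrite addr_eq0 (oppr_pchar2 k2) => /eqP.
by have /codomP[b ->] := injF_onto fI a; exists b.
Qed.

Lemma wpD (a b : k) : wp a -> wp b -> wp (a + b).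
Proof.
move=> [s ->] [t ->]; exists (s + t).
have := addrr_pchar2 k2 (s * t) => h.
rewrite mulrDl !mulrDr (mulrC t s).
have -> : s * s + s * t + (s * t + t * t) = s * s + t * t + (s * t + s * t) by ring.
by rewrite h; ring.
Qed.

(* The fibres of [x |-> x^2 - x] have two elements, so three cosets of its image
   do not fit. *)
Lemma wp_index2 (a b : k) : ~ wp a -> ~ wp b -> wp (a + b).
Proof.
move=> na nb; apply: contrapT => nab.
pose P := [set x : k | [exists t, x == t * t - t]].
have PP x : reflect (wp x) (x \in P).
  by rewrite inE; apply: (iffP existsP) => -[t]; [move/eqP|move->]; exists t.
have hcard : (#|k| <= 2 * #|P|)%N.
  (* The bit tells whether [x] is the chosen representative of its fibre; this determines [x], as
     the fibre consists of [x] and [x + 1]. *)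
  pose h (x : k) : k * bool := (x * x - x, [pick t | t * t - t == x * x - x] == Some x).
  have hI : injective h.
    move=> x y [e1]; rewrite e1; case: pickP => [t /eqP ht|/(_ y)]; last by rewrite eqxx.
    have two u v : u * u - u = v * v - v :> k -> u = v \/ u = v + 1.
      move=> /eqP; rewrite -subr_eq0 => /eqP uv.
      have : (u - v) * (u - v - 1) = 0.
        have h2 := addrr_pchar2 k2 (u * v).
        have -> : (u - v) * (u - v - 1) = u * u - u - (v * v - v) + (v * v + v * v) - (u * v + u * v) by ring.
        by rewrite uv h2 (addrr_pchar2 k2) subr0 addr0.
      move=> /eqP; rewrite mulf_eq0 => /orP[|]; first by rewrite subr_eq0 => /eqP; left.
      by rewrite -addrA -opprD subr_eq0 => /eqP; right.
    have [->|tx] := eqVneq t x; first by rewrite eqxx => /esym/eqP[].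
    have [->|ty] := eqVneq t y; first by rewrite eqxx => /eqP[].
    move=> _; have tx' : t * t - t = x * x - x by rewrite ht.
    case: (two _ _ tx') => [e|ex]; first by rewrite e eqxx in tx.
    case: (two _ _ ht) => [e|ey]; first by rewrite e eqxx in ty.
    by apply: (addIr 1); rewrite -ex -ey.
  have : {subset codom h <= finset.setX P [set: bool]}.
    by move=> _ /codomP[x ->]; rewrite !inE andbT; apply/existsP; exists x.
  move/fintype.subsetP/subset_leq_card; rewrite card_codom // cardsX cardsT card_bool mulnC.
  by apply.
have sh c : #|[set c + x | x in P]| = #|P| by apply: card_imset; exact: addrI.
have addK c x : c + (c + x) = x :> k by rewrite addrA (addrr_pchar2 k2) add0r.
have d1 c : ~ wp c -> P :&: [set c + x | x in P] = finset.set0.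
  move=> nc; apply/finset.setP => x; rewrite !inE; apply/negP => /andP[/existsP px /imsetP[y yP xy]].
  apply: nc; have -> : c = x + y by rewrite xy -addrA (addrr_pchar2 k2) addr0.
  by apply: wpD; [case: px => t /eqP ->; exists t|apply/PP].
have d2 : [set a + x | x in P] :&: [set b + x | x in P] = finset.set0.
  apply/finset.setP => x; rewrite !inE; apply/negP => /andP[/imsetP[y /PP yP xy] /imsetP[z /PP zP xz]].
  apply: nab; have -> : a + b = y + z.
    have -> : b = x + z by rewrite xz -addrA (addrr_pchar2 k2) addr0.
    by rewrite xy addrA addK.
  exact: wpD.
pose T := P :|: [set a + x | x in P] :|: [set b + x | x in P].
have : (#|T| <= #|k|)%N by exact: max_card.
rewrite /T.
rewrite !cardsU finset.setIUl d1 // d2 finset.setU0 cards0 !subn0 !sh d1 // cards0 subn0.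
have : (0 < #|P|)%N.
  by apply/card_gt0P; exists 0; apply/PP; exists 0; rewrite mul0r subr0.
lia.
Qed.

End Char2FinField.

Lemma card_pchar2 (k : finFieldType) : 2%N \in [pchar k] -> exists2 n, (0 < n)%N & #|k| = (2 ^ n)%N.
Proof.
move=> k2; have := card_pprimeChar k2; set d := logn _ _ => ck.
exists d; last exact: ck.
by rewrite lt0n; apply/eqP => d0; have := finNzRing_gt1 k; rewrite ck d0.
Qed.

(** * Uniqueness of the finite field of given cardinality *)

Section FinFieldUnique.
Variables (k1 k2 : finFieldType).
Hypotheses (h1 : 2%N \in [pchar k1]) (h2 : 2%N \in [pchar k2]) (card12 : #|k1| = #|k2|).
Local Notation A1 := (pPrimeCharType h1).
Local Notation A2 := (pPrimeCharType h2).

Lemma fin_field_generator : exists g : k1, forall x, x != 0 -> exists n, x = g ^+ n.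
Proof.
have /cyclicP[u hu] := field_unit_group_cyclic [set: {unit k1}]%G.
exists (val u) => x x0; have ux : x \is a GRing.unit by rewrite unitfE.
have : FinRing.unit k1 ux \in <[u]>%g by rewrite -hu inE.
by move=> /cycleP[n /(congr1 val)]; rewrite /= FinRing.val_unitX => ->; exists n.
Qed.

(** Over the second field, which has the same cardinality, this polynomial is the product of all
    [X - x], so a nonconstant divisor has a root there. *)
Lemma fin_field_root (f : {poly 'F_2}) : (1 < size f)%N -> f %| 'X^#|k1| - 'X ->
  exists g' : A2, horner_alg g' f = 0.
Proof.
move=> szf; rewrite -(dvdp_map (in_alg A2)) rmorphB /= map_polyXn map_polyX card12.
have -> : 'X^#|k2| - 'X = \prod_(x <- enum A2) ('X - x%:P) :> {poly A2}.
  by rewrite big_enum; exact: (finField_genPoly A2).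
move=> /dvdp_prod_XsubC[m fm].
have : (1 < (size (mask m (enum A2))).+1)%N.
  by rewrite -(size_prod_XsubC _ id) -(eqp_size fm) size_map_poly.
case em: (mask m (enum A2)) fm => [//|g' s] fm _; exists g'.
apply/eqP; have -> : (horner_alg g' f == 0) = root (map_poly (in_alg A2) f) g' by [].
by rewrite (eqp_root fm) root_prod_XsubC mem_head.
Qed.

(** A generator of the multiplicative group of [k1] is matched with a root in [k2] of its minimal
    polynomial over the prime field. The relation is the set of pairs of values of one polynomial at
    the two elements, so it respects the operations by construction; equality of cardinalities makes
    it onto. *)
Lemma fin_field_iso : exists r : k1 -> k2 -> Prop,
  [/\ r 1 1, forall a a' b b', r a a' -> r b b' -> r (a + b) (a' + b'),
      forall a a', r a a' -> r (- a) (- a'),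
      forall a a' b b', r a a' -> r b b' -> r (a * b) (a' * b')
    & forall a a', r a a' -> (a = 0 <-> a' = 0)] /\
  ((forall a, exists a', r a a') /\ (forall a', exists a, r a a')).
Proof.
have [g hg] := fin_field_generator.
pose e1 : {rmorphism {poly 'F_2} -> A1} := horner_alg (g : A1).
(* A polynomial of least size that kills the generator divides every other such polynomial. *)
pose P n := `[< exists f : {poly 'F_2}, [/\ f != 0, size f = n & e1 f = 0] >].
have : exists n, P n.
  exists (#|k1|.+1); apply/asboolP; exists ('X^#|k1| - 'X).
  have sz : size ('X^#|k1| - 'X : {poly 'F_2}) = #|k1|.+1.
    by rewrite size_polyDl size_polyXn // size_polyN size_polyX ltnS finNzRing_gt1.
  split=> //; first by rewrite -size_poly_gt0 sz.
  rewrite rmorphB rmorphXn /= /e1 !horner_algX.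
  by apply/eqP; rewrite subr_eq0; apply/eqP; exact: (expf_card (g : k1)).
move=> /ex_minnP[n /asboolP[f [f0 szf ef]] nmin].
have ker1 h : e1 h = 0 -> f %| h.
  move=> eh; rewrite /dvdp; apply: contrapT => /negP r0.
  have : (n <= size (h %% f)%R)%N.
    apply: nmin; apply/asboolP; exists (h %% f); split=> //.
    have := congr1 e1 (divp_eq h f); rewrite rmorphD rmorphM /= ef eh mulr0 add0r.
    by move=> <-.
  by rewrite -szf leqNgt ltn_modp f0.
have szf1 : (1 < size f)%N.
  rewrite ltnNge; apply/negP => /size1_polyC; move: f`_0 => c fc.
  have c0 : c != 0 by move: f0; rewrite fc polyC_eq0.
  move: ef; rewrite fc /e1 /= horner_algC => /eqP.
  by rewrite scaler_eq0 (negPf c0) /= oner_eq0.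
have [g' hg'] : exists g' : A2, horner_alg g' f = 0.
  apply: fin_field_root => //; apply: ker1.
  rewrite rmorphB rmorphXn /= /e1 !horner_algX.
  by apply/eqP; rewrite subr_eq0; apply/eqP; exact: (expf_card (g : k1)).
pose e2 : {rmorphism {poly 'F_2} -> A2} := horner_alg g'.
have ker12 h : e1 h = 0 -> e2 h = 0.
  by move=> /ker1/divpK <-; rewrite rmorphM /= hg' mulr0.
have surj1 a : exists h, e1 h = a.
  have [->|/hg[m ->]] := eqVneq a 0; first by exists 0; rewrite rmorph0.
  by exists 'X^m; rewrite rmorphXn /= /e1 horner_algX.
(* If [e1 h] is nonzero, its inverse is some [e1 h']; then [e2] kills both [h] and [h * h' - 1],
   hence also 1. *)
have ker21 h : e2 h = 0 -> e1 h = 0.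
  move=> eh; apply: contrapT => /eqP ne.
  have [h' eh'] := surj1 (e1 h)^-1.
  have /ker12 : e1 (h * h' - 1) = 0.
    by rewrite rmorphB rmorphM rmorph1 /= eh' mulfV // subrr.
  rewrite rmorphB rmorphM rmorph1 /= eh mul0r sub0r => /eqP.
  by rewrite oppr_eq0 oner_eq0.
have /choice[s hs] := surj1.
pose phi (a : k1) : k2 := e2 (s a).
have phiI : injective phi.
  move=> a b ab; rewrite -(hs a) -(hs b); apply/eqP; rewrite -subr_eq0 -rmorphB.
  by apply/eqP/ker21; rewrite rmorphB /=; apply/eqP; rewrite subr_eq0; apply/eqP.
exists (fun a a' => exists h, e1 h = a /\ e2 h = a'); split; last split; first split.
- by exists 1; rewrite !rmorph1.
- by move=> a a' b b' [h [<- <-]] [h' [<- <-]]; exists (h + h'); rewrite !rmorphD.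
- by move=> a a' [h [<- <-]]; exists (- h); rewrite !rmorphN.
- by move=> a a' b b' [h [<- <-]] [h' [<- <-]]; exists (h * h'); rewrite !rmorphM.
- by move=> a a' [h [<- <-]]; split; [exact: ker12|exact: ker21].
- by move=> a; exists (phi a), (s a); rewrite hs.
- move=> a'; have /codomP[a ->] : a' \in codom phi.
    by apply: inj_card_onto => //; rewrite card12.
  by exists a, (s a); rewrite hs.
Qed.

End FinFieldUnique.

(** * The hyperbolic space of dimension [2n] over a finite field *)

Lemma str_hyperbolic_sumP w D o n (a : qV D) :
  @hyperbolic_sum w (str w D o) n a <-> exists F : frame D, [/\ symp F, fsize F = n &
    forall i, (i < n)%N -> qf (fe F i) + qb a (fe F i) ^+ 2 = 0 /\ qf (ff F i) + qb a (ff F i) ^+ 2 = 0].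
Proof.
split=> [[t [_ h1 h2]]|[F [sF szF h]]].
  exists (Frame (D:=D) t (fun i => t (n + i)%N) n); split=> //= [i j lti ltj|i lti].
    have [->|ne] := eqVneq i j.
      by have [_ _ h] := h1 j ltj; split; [exact: qbxx|exact: qbxx|exact: h].
    by have [g1 g2 g3] := h2 i j lti ltj ne; split; [exact: g1|exact: g3|exact: g2].
  by have [g1 g2 _] := h1 i lti; split; [exact: g1|exact: g2].
exists (frame_vec F); split.
- by apply/str_rindep; rewrite -szF; exact: frame_indep.
- move=> i lti; have [g1 g2] := h i lti; rewrite /frame_vec szF lti ltnNge leq_addr /= addKn.
  by have [_ _ g3] := sF i i ltac:(lia) ltac:(lia); rewrite eqxx in g3; split; [exact: g1|exact: g2|exact: g3].
- move=> i j lti ltj ne; rewrite /frame_vec szF lti ltj !ltnNge !leq_addr /= !addKn.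
  have [g1 g2 g3] := sF i j ltac:(lia) ltac:(lia); rewrite (negPf ne) in g3.
  by split; [exact: g1|exact: g3|exact: g2].
Qed.

Section Translate.
Variables (D : qspace) (a : qV D).

Definition tqf (x : qV D) : qK D := qf x + qb a x ^+ 2.

Lemma tqfZ c x : tqf (c *: x) = c * c * tqf x.
Proof. by rewrite /tqf qfZ qbZr; ring. Qed.

Lemma tqfD x y : tqf (x + y) = tqf x + tqf y + qb x y.
Proof. by rewrite /tqf qfD qbDr1 qsqrD; ring. Qed.

Definition translate : qspace :=
  @QSpace (qK D) (qV D) (@qb D) tqf (qchar2 D) (@qbDl D) (@qbDr D) (@qbxx D) (@qbnd D) tqfZ tqfD.

(* The transvection along [a] carries [q] to its translate by [a] as soon as
   [q a] lies in the image of [x |-> x^2 - x]. *)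
Lemma translate_frame (F : frame D) : wp (qf a) -> symp F -> sing F ->
  exists F' : frame D, [/\ symp F', fsize F' = fsize F &
    forall i, (i < fsize F)%N -> tqf (fe F' i) = 0 /\ tqf (ff F' i) = 0].
Proof.
move=> wpa sF siF.
(* This is the condition for [x + (c * qb x a) *: a] to carry [qf] to [tqf]. If [qf a = t * t - t]
   with [t] nonzero, the inverse of [t] satisfies it; if [t = 0], then 1 does. *)
have [c hc] : exists c : qK D, c * c * qf a + c = 1.
  case: wpa => t ->; have [->|t0] := eqVneq t 0; first by exists 1; ring.
  by exists t^-1; field.
pose g x := x + (c * qb x a) *: a.
have gq x : tqf (g x) = qf x.
  rewrite /tqf /g qfD qfZ qbDr1 !qbZr qbxx mulr0 addr0 (qbC a x).
  set b := qb x a.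
  have -> : qf x + c * b * (c * b) * qf a + c * b * b + b ^+ 2 =
      qf x + ((c * c * qf a + c) * (b * b) + b * b) by ring.
  by rewrite hc mul1r qaddkk addr0.
have gb x y : qb (g x) (g y) = qb x y.
  rewrite /g qbDl1 !qbDr1 !qbZl !qbZr qbxx !mulr0 addr0 (qbC a y).
  have -> : c * qb x a * qb y a = c * qb y a * qb x a by ring.
  by rewrite -addrA qaddkk addr0.
exists (Frame (fun i => g (fe F i)) (fun i => g (ff F i)) (fsize F)); split=> //.
  by move=> i j lti ltj; rewrite /= !gb; exact: sF.
by move=> i /siF[h1 h2]; rewrite /= !gq.
Qed.

End Translate.

Section Std.
Variables (k : finFieldType) (k2 : 2%N \in [pchar k]) (n : nat).
Local Notation E := ('rV[k]_n * 'rV[k]_n)%type.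

Definition dot (u v : 'rV[k]_n) : k := \sum_i u 0 i * v 0 i.

Lemma dotC u v : dot u v = dot v u.
Proof. by apply: eq_bigr => i _; rewrite mulrC. Qed.

Lemma dotDl c u v x : dot (c *: u + v) x = c * dot u x + dot v x.
Proof. by rewrite /dot mulr_sumr -big_split; apply: eq_bigr => i _; rewrite !mxE mulrDl mulrA. Qed.

Lemma dotDr c u v x : dot x (c *: u + v) = c * dot x u + dot x v.
Proof. by rewrite !(dotC x) dotDl. Qed.

Definition sqb (u v : E) : k := dot u.1 v.2 + dot u.2 v.1.
Definition sqf (u : E) : k := dot u.1 u.2.

Lemma sqbDl c u v x : sqb (c *: u + v) x = c * sqb u x + sqb v x.
Proof. by rewrite /sqb !dotDl; ring. Qed.

Lemma sqbC u v : sqb u v = sqb v u.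
Proof. by rewrite /sqb addrC (dotC u.2) (dotC u.1). Qed.

Lemma sqbDr c u v x : sqb x (c *: u + v) = c * sqb x u + sqb x v.
Proof. by rewrite !(sqbC x) sqbDl. Qed.

Lemma sqbxx u : sqb u u = 0.
Proof. by rewrite /sqb (dotC u.2) (addrr_pchar2 k2). Qed.

Definition delta (i : nat) : 'rV[k]_n := \row_j (j == i :> nat)%:R.

Lemma dot_delta u (i : 'I_n) : dot u (delta i) = u 0 i.
Proof.
rewrite /dot (bigD1 i) //= mxE eqxx mulr1 big1 ?addr0 // => j ji.
by rewrite mxE (_ : (j == i :> nat) = false) ?mulr0 //; apply: negPf.
Qed.

Lemma dot0l u : dot 0 u = 0.
Proof. by rewrite /dot big1 // => i _; rewrite mxE mul0r. Qed.

Lemma sqbnd u : (forall v, sqb u v = 0) -> u = 0.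
Proof.
case: u => u1 u2 h; congr pair; apply/rowP => i; rewrite mxE -dot_delta.
  by have := h (0, delta i); rewrite /sqb /= (dotC u2) dot0l addr0.
by have := h (delta i, 0); rewrite /sqb /= (dotC u1) dot0l add0r.
Qed.

Lemma sqfZ c u : sqf (c *: u) = c * c * sqf u.
Proof.
have dotZ a (x y : 'rV[k]_n) : dot (a *: x) y = a * dot x y.
  by have := dotDl a x 0 y; rewrite addr0 dot0l addr0.
by rewrite /sqf /= dotZ dotC dotZ dotC mulrA.
Qed.

Lemma sqfD u v : sqf (u + v) = sqf u + sqf v + sqb u v.
Proof.
have := dotDl 1 u.1 v.1; rewrite scale1r => h; have := dotDr 1 u.2 v.2; rewrite scale1r => h'.
by rewrite /sqf /sqb /= h !h' (dotC u.2); ring.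
Qed.

Definition std : qspace := @QSpace k E sqb sqf k2 sqbDl sqbDr sqbxx sqbnd sqfZ sqfD.

Definition std_frame : frame std :=
  Frame (D:=std) (fun i => (delta i, 0)) (fun i => (0, delta i)) n.

Lemma delta_delta i j : (i < n)%N -> dot (delta i) (delta j) = (i == j)%:R.
Proof. by move=> lti; rewrite dotC (dot_delta _ (Ordinal lti)) mxE. Qed.

Lemma std_symp : symp std_frame.
Proof.
move=> i j lti ltj; rewrite /= /sqb /= !dot0l !(dotC _ 0) !dot0l !addr0.
by split=> //; exact: delta_delta.
Qed.

Lemma std_sing : sing std_frame.
Proof. by move=> i lti; rewrite /= /sqf /= dot0l dotC dot0l. Qed.

(** The remainder after projection pairs to zero with all unit vectors, and these pairings are its
    coordinates. *)
Lemma std_full : full std_frame.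
Proof.
move=> u; apply/eqP; rewrite -subr_eq0; apply/eqP; apply: sqbnd => v.
have pz := perp_sub u std_symp.
have ortho i (lti : (i < n)%N) := pz i lti.
case: (u - _) ortho => z1 z2 ortho; rewrite /sqb.
have -> : (z1, z2).1 = 0.
  apply/rowP => i; rewrite mxE -dot_delta.
  by have [_] := ortho i (ltn_ord i); rewrite /= /sqb /= (dotC z2) dot0l addr0.
have -> : (z1, z2).2 = 0.
  apply/rowP => i; rewrite mxE -dot_delta.
  by have [+ _] := ortho i (ltn_ord i); rewrite /= /sqb /= (dotC z1) dot0l add0r.
by rewrite !dot0l addr0.
Qed.

(** The additive character of order two whose kernel is the Artin-Schreier image, that is, -1 to the
    power of the absolute trace; it is multiplicative because that image has index two. *)
Definition sgn (a : k) : int := if `[< wp a >] then 1 else -1.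

Lemma wp0 : wp (0 : k).
Proof. by exists 0; rewrite mul0r subr0. Qed.

Lemma wpDl (a b : k) : wp a -> (wp (a + b) <-> wp b).
Proof.
move=> wa; split=> [wab|]; last exact: wpD.
by have := wpD k2 wa wab; rewrite addrA (addrr_pchar2 k2) add0r.
Qed.

Lemma sgnD (a b : k) : sgn (a + b) = sgn a * sgn b.
Proof.
rewrite /sgn; case: (asboolP (wp a)) => [wa|na].
  by rewrite (asbool_equiv_eq (wpDl b wa)) mul1r.
case: (asboolP (wp b)) => [wb|nb].
  by rewrite addrC (asbool_equiv_eq (wpDl a wb)) asboolF ?mulr1.
by rewrite (asboolT (wp_index2 k2 na nb)).
Qed.

(** Translating [v] by a vector [c] for which [dot u c] lies outside the Artin-Schreier image
    reverses the sign of every term. *)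
Lemma sgn_sum0 (u : 'rV[k]_n) : u != 0 -> \sum_v sgn (dot u v) = 0.
Proof.
move=> u0; have [b nb] := fin_AS_not_onto k.
have [i ui] : exists i, u 0 i != 0.
  apply/existsP; apply: contraR u0; rewrite negb_exists => /forallP h.
  by apply/eqP/rowP => i; rewrite mxE; apply/eqP; have := h i; rewrite negbK.
pose c := (b / u 0 i) *: delta i.
have uc : dot u c = b.
  have := dotDr (b / u 0 i) (delta i) 0 u; rewrite addr0 -/c => ->.
  by rewrite dot_delta (dotC u) dot0l addr0 divfK.
have : \sum_v sgn (dot u v) = - \sum_v sgn (dot u v).
  rewrite {1}(reindex_inj (addIr c)) -sumrN; apply: eq_bigr => v _.
  have := dotDr 1 v c u; rewrite scale1r mul1r => ->.
  by rewrite sgnD uc {2}/sgn asboolF // mulrN1.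
by lia.
Qed.

(** Only the pairs with first component zero contribute, each of them by 1. *)
Lemma sgn_sum_neq0 : \sum_(x : E) sgn (sqf x) != 0.
Proof.
have -> : \sum_(x : E) sgn (sqf x) = \sum_u \sum_v sgn (dot u v).
  by rewrite pair_big; apply: eq_bigr => -[].
rewrite (bigD1 (0 : 'rV[k]_n)) //= [X in _ + X]big1; last by move=> u; exact: sgn_sum0.
rewrite addr0 (eq_bigr (fun=> 1)); last by move=> v _; rewrite dot0l /sgn asboolT //; exact: wp0.
rewrite sumr_const Num.Theory.pnatr_eq0 -lt0n.
by apply/card_gt0P; exists 0.
Qed.

(** Modulo the Artin-Schreier image the square of [sqb a x] may be replaced by [sqb a x], and
    [sqf x + sqb a x] equals [sqf (x + a) + sqf a]. *)
Lemma tqf_sgn (a x : E) : sgn (tqf (D:=std) a x) = sgn (sqf (x + a)) * sgn (sqf a).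
Proof.
have h2 := addrr_pchar2 k2.
have -> : tqf (D:=std) a x = (sqb a x * sqb a x - sqb a x) + (sqf (x + a) + sqf a).
  rewrite /tqf /= sqfD (sqbC x) expr2 (oppr_pchar2 k2).
  have -> : sqb a x * sqb a x + sqb a x + (sqf x + sqf a + sqb a x + sqf a) =
    sqf x + sqb a x * sqb a x + ((sqb a x + sqb a x) + (sqf a + sqf a)) by ring.
  by rewrite !h2 !addr0.
have s1 : sgn (sqb a x * sqb a x - sqb a x) = 1 by rewrite /sgn asboolT //; exists (sqb a x).
by rewrite sgnD s1 mul1r sgnD.
Qed.

(* The Gauss sum of a hyperbolic form does not vanish and is an isometry
   invariant; translating by [a] multiplies it by [sgn (sqf a)]. *)
Lemma std_hyperbolic_translate (a : E) (F : frame std) : symp F -> fsize F = n ->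
  (forall i, (i < n)%N -> tqf (D:=std) a (fe F i) = 0 /\ tqf (D:=std) a (ff F i) = 0) ->
  wp (sqf a).
Proof.
move=> sF szF hF.
(* The linear map taking the standard frame to [F] carries [sqf] to the translated form. It is
   injective, hence a permutation of the finite space that reindexes the Gauss sum. *)
pose h (x : E) : E := comb F (fun i => sqb x (ff std_frame i)) (fun i => sqb x (fe std_frame i)).
pose D' := translate (D:=std) a.
pose F' : frame D' := Frame (D:=D') (fe F) (ff F) (fsize F).
have hq x : tqf (D:=std) a (h x) = sqf x.
  have siF' : sing F' by move=> i; rewrite /= szF; exact: hF.
  have -> : tqf (D:=std) a (h x) = _ :=
    @qf_comb D' F' (fun i => sqb x (ff std_frame i)) (fun i => sqb x (fe std_frame i)) sF siF'.
  rewrite [in RHS](std_full x) /=.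
  have -> : sqf (proj std_frame x) = _ := @qf_comb std std_frame _ _ std_symp std_sing.
  by rewrite /= szF.
have hc (x : E) i (lti : (i < fsize F)%N) :
    sqb (h x) (fe F i) = sqb x (fe std_frame i) /\ sqb (h x) (ff F i) = sqb x (ff std_frame i).
  exact: (@comb_coord std F _ _ i sF lti).
have hI : injective h.
  move=> x y hxy; rewrite [LHS]std_full [RHS]std_full; apply: (@eq_comb std std_frame) => i lti.
  have lti' : (i < fsize F)%N by rewrite szF.
  have [cx1 cx2] := hc x i lti'; have [cy1 cy2] := hc y i lti'; rewrite hxy in cx1 cx2.
  by split; [exact: etrans (esym cx2) cy2|exact: etrans (esym cx1) cy1].
have e1 : \sum_(x : E) sgn (sqf x) = \sum_(x : E) sgn (tqf (D:=std) a x).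
  by rewrite [RHS](reindex_inj hI); apply: eq_bigr => x _; rewrite hq.
have e2 : \sum_(x : E) sgn (tqf (D:=std) a x) = (\sum_(x : E) sgn (sqf x)) * sgn (sqf a).
  under eq_bigr do rewrite tqf_sgn.
  by rewrite -mulr_suml [X in _ = X * _](reindex_inj (addIr a)).
have := sgn_sum_neq0; move: e2; rewrite -e1; move: (\sum_x _) => S SE /negPf S0.
apply: contrapT => na; move: SE; rewrite /sgn asboolF // mulrN1; move/negbT: S0; lia.
Qed.

Variable w : bool.
Local Notation M := (str w std false).

Lemma std_qdim : qdim_ge std (2 * n) /\ ~ qdim_ge std (2 * n).+1.
Proof. exact: (full_frame_dim std_symp std_full). Qed.

(** The value of the form of [a] at the difference of [a] and [b] is [sqf a + sqf b] modulo the
    Artin-Schreier image, and the index two of this image turns the condition into an equality of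
    bits. *)
Lemma std_omega_sem (ww : w) : omega_sem M ww.
Proof.
split=> [a|a b].
  by rewrite /om /= /qomega; case: asboolP => _; [left|right].
have -> : bq (N:=M) a (qs (N:=M) a b) = (sqb a b * sqb a b - sqb a b) + (sqf a + sqf b).
  rewrite /bq /qs /= (qoppV (D:=std) b) /=.
  have -> : sqb a (a + b) = sqb a b by have := sqbDr 1 a b a; rewrite scale1r mul1r sqbxx add0r.
  by rewrite sqfD expr2 (oppr_pchar2 k2); ring.
have e : (exists t : k, sqb a b * sqb a b - sqb a b + (sqf a + sqf b) = t * t - t) <-> wp (sqf a + sqf b).
  by apply: wpDl; exists (sqb a b).
apply: (iff_trans _ (iff_sym e)).
rewrite /om /= /qomega /=.
case: (asboolP (wp (sqf a))) => [wa|na]; case: (asboolP (wp (sqf b))) => [wb|nb] /=.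
- by split=> // _; apply: wpD.
- split=> [/eqP|/(wpDl _ wa)//]; by rewrite eq_sym oner_eq0.
- split=> [/eqP|]; first by rewrite oner_eq0.
  by rewrite addrC => /(wpDl _ wb).
- by split=> // _; apply: wp_index2.
Qed.

Lemma std_dim_eq m : holds M (dim_eq w m) -> m = (2 * n)%N.
Proof.
move=> /(dim_eqP (str_T0_Q_sem w std false)) [[t ht] nt].
have [d1 d2] := std_qdim.
have h1 : qdim_ge std m by exists t; apply/str_rindep.
have h2 : ~ qdim_ge std m.+1 by move=> [t' ht']; apply: nt; exists t'; apply/str_rindep.
have : ~ (m < 2 * n)%N by move=> lt; apply: h2; apply: qdim_ge_le lt d1.
have : ~ (2 * n < m)%N by move=> lt; apply: d2; apply: qdim_ge_le lt h1.
lia.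
Qed.

(** The dimension leaves only [m = n]. Then the transvection gives a hyperbolic frame when [sqf a]
    is in the Artin-Schreier image, and the Gauss sum excludes one otherwise. *)
Lemma std_witt_sem (ww : w) m : witt_sem M ww m.
Proof.
move=> /std_dim_eq mn a; have {}mn : m = n by lia.
rewrite {m}mn.
have hw : @hyperbolic_sum w M n a <-> wp (sqf a).
  split=> [/str_hyperbolic_sumP[F [sF szF hF]]|wa]; first exact: std_hyperbolic_translate sF szF hF.
  apply/str_hyperbolic_sumP.
  have [F [sF szF hF]] := @translate_frame std a std_frame wa std_symp std_sing.
  by exists F; split.
rewrite hw /om /= /qomega /=.
by case: asboolP.
Qed.

Lemma std_model : model (T0 w) M.
Proof.
have h : model (T0_Q w) M by apply/T0_QP; exact: str_T0_Q_sem.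
move: h std_omega_sem std_witt_sem; case: w => // h ho hw.
apply/model_setU; split; first (apply/model_setU; split=> //).
  exact/omega_axiomsP.
by move=> _ [m _ <-]; apply/(witt_axiomP (str_T0_Q_sem _ _ _)).
Qed.

End Std.

(** * Base points *)

Lemma T0_T0_Q w (N : structure (LQ w)) : model (T0 w) N -> model (T0_Q w) N.
Proof. by case: w N => // N h f hf; apply: h; left; left. Qed.

Lemma T0_omega w (N : structure (LQ w)) (ww : w) : model (T0 w) N -> omega_sem N ww.
Proof.
case: w N ww => // N ww h; apply/omega_axiomsP => f hf; apply: h; left; right.
by rewrite (bool_irrelevance isT ww).
Qed.

Lemma T0_witt w (N : structure (LQ w)) (ww : w) n : model (T0 w) N -> witt_sem N ww n.
Proof.
case: w N ww => // N ww h.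
apply/(witt_axiomP (T0_Q_sem_of_model (T0_T0_Q h))); apply: h; right.
by exists n => //; rewrite (bool_irrelevance isT ww).
Qed.

Section Base.
Variables (w : bool) (N : structure (LQ w)) (HN : model (T0 w) N).
Let H : T0_Q_sem N := T0_Q_sem_of_model (T0_T0_Q HN).

(** The points [q0] and its translate by [x] are compared by the axiom on [omega]; in the language
    without [omega] any bit will do. *)
Lemma base_omega (q0 : N Q) : exists o : bool,
  (forall (ww : w) x, om ww (qa q0 x) = qomega (D:=qspace_of H q0) o x) /\
  forall ww : w, om ww q0 = (o%:R : fcar (t_field H)).
Proof.
have [ww|nw] := pselect w; last by exists false; split=> ww; case: nw.
have [h01 heq] := T0_omega ww HN.
have [o ho] : exists o : bool, om ww q0 = (o%:R : fcar (t_field H)).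
  by case: (h01 q0) => ->; [exists false|exists true].
exists o; split=> ww'; rewrite (bool_irrelevance ww' ww) // => x.
have qsx : qs (qa q0 x) q0 = x by apply: esym; apply/(t_qs H).
have e : om ww (qa q0 x) = om ww q0 <-> wp (qf (x : qV (qspace_of H q0))).
  rewrite (heq (qa q0 x) q0) qsx (t_bqa H) (t_bvxx H).
  have -> : @fadd (Kred N) (bq q0 x) (@fmul (Kred N) (fzero (Kred N)) (fzero (Kred N))) =
      (qf (x : qV (qspace_of H q0)) + 0 * 0 : fcar (t_field H)) by [].
  by rewrite mul0r addr0.
rewrite /qomega; case: asboolP => wx /=; first by rewrite addbF -ho; apply/e.
rewrite addbT; have ne : om ww (qa q0 x) <> om ww q0 by move/e.
rewrite ho in ne; case: (h01 (qa q0 x)) => hx; rewrite hx in ne *; case: o {ho} ne => //=.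
Qed.

Lemma qdim_geP (q0 : N Q) n : qdim_ge (qspace_of H q0) n <-> holds N (dim_ge w n).
Proof.
by rewrite (dim_geP H); split=> -[t ht]; exists t; apply/(@rindep_qindep w N H q0).
Qed.

Hypothesis perf : forall a : N K, exists b : N K, @fmul (Kred N) b b = a.

Lemma base_perfect (q0 : N Q) : perfect_field (qK (qspace_of H q0)).
Proof. exact: perf. Qed.

(** A translate of the base point makes a spanning frame singular; that frame shows the Witt defect
    to be 0, so [omega] is 0 there. *)
Lemma base_finite n : inhabited (N Q) -> holds N (dim_eq w (2 * n)) ->
  exists (q0 : N Q) (B : frame (qspace_of H q0)), [/\ symp B, sing B, full B, fsize B = n &
    forall (ww : w) x, om ww (qa q0 x) = qomega (D:=qspace_of H q0) false x].
Proof.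
move=> [q] hd; have /(dim_eqP H)[d1 d2] := hd.
have [B [sB fB szB]] : exists B : frame (qspace_of H q), [/\ symp B, full B & fsize B = n].
  apply: full_frame_of_dim; first by apply/qdim_geP/(dim_geP H).
  by move=> /qdim_geP/(dim_geP H).
have [v hv] := singular_translate (base_perfect (q0:=q)) sB.
pose q0 := qa q (v : N V).
pose B0 : frame (qspace_of H q0) := Frame (D:=qspace_of H q0) (fe B) (ff B) (fsize B).
have bq0 x : bq q0 x = (qf (x : qV (qspace_of H q)) + qb v x ^+ 2 : fcar (t_field H)).
  by rewrite /q0 (t_bqa H) expr2.
have si0 : sing B0.
  move=> i lti; have [h1 h2] := hv i lti.
  by split; [exact: etrans (bq0 _) h1|exact: etrans (bq0 _) h2].
exists q0, B0; split=> // ww x.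
have [o [-> ho]] := base_omega q0.
suff -> : o = false by [].
have [h0 _] := T0_witt ww HN hd q0.
have om0 : om ww q0 = fzero (Kred N).
  apply: h0; exists (fun i => if (i < n)%N then fe B i else ff B (i - n)%N); split.
  - apply/(@rindep_qindep w N H q); have := frame_indep sB; rewrite szB.
    by rewrite /frame_vec szB.
  - move=> i lti; rewrite lti ltnNge leq_addr /= addKn.
    have lti' : (i < fsize B)%N by rewrite szB.
    have [s1 s2] := si0 i lti'; have [_ _ s3] := sB i i lti' lti'; rewrite eqxx in s3.
    by split; [exact: s1|exact: s2|exact: s3].
  - move=> i j lti ltj ne; rewrite lti ltj !ltnNge !leq_addr /= !addKn.
    have [s1 s2 s3] := sB i j ltac:(lia) ltac:(lia); rewrite (negPf ne) in s3.
    by split; [exact: s1|exact: s3|exact: s2].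
have := ho ww; rewrite om0; case: o {ho} => // e.
by have /eqP := (esym e : 1 = 0 :> fcar (t_field H)); rewrite oner_eq0.
Qed.

Hypothesis AS : exists a : N K, ~ exists t : N K, a = @fadd (Kred N) (@fmul (Kred N) t t) (@fopp (Kred N) t).

(** If [omega] has the wrong value, the base point is moved by a vector at which the form is outside
    the Artin-Schreier image. Such a vector is a multiple of any nonsingular one, as the field is
    perfect. *)
Lemma base_infinite (c : bool) : inhabited (N Q) -> (forall n, holds N (dim_ge w n)) ->
  exists (q0 : N Q) (o : bool),
    (forall (ww : w) x, om ww (qa q0 x) = qomega (D:=qspace_of H q0) o x) /\ (w -> o = c).
Proof.
move=> [q] inf; have [o [ho1 ho2]] := base_omega q.
have [<-|oc] := eqVneq o c; first by exists q, o.
have infD n : qdim_ge (qspace_of H q) n by apply/qdim_geP.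
pose B0 : frame (qspace_of H q) := Frame (fun=> 0) (fun=> 0) 0.
have sB0 : symp B0 by [].
have nf : ~ full B0 by move=> /full_dim h; have [t /h] := infD 1%N.
have [x [y [_ _ xy _]]] := extend_frame sB0 nf.
have [z qz] : exists z : qV (qspace_of H q), qf z != 0.
  have [h1|] := eqVneq (qf x) 0; last by exists x.
  have [h2|] := eqVneq (qf y) 0; last by exists y.
  by exists (x + y); rewrite qfD h1 h2 xy !add0r oner_eq0.
have [a ha] := AS.
have [b hb] := base_perfect (q0:=q) ((a : fcar (t_field H)) / qf z).
pose v : qV (qspace_of H q) := b *: z.
have qv : qf v = a by rewrite /v qfZ hb divfK.
have [o' [ho1' ho2']] := base_omega (qa q (v : N V)).
exists (qa q (v : N V)), o'; split=> // ww.
have := ho2' ww; rewrite ho1 /qomega asboolF; last by rewrite qv.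
rewrite addbT; case: o o' c oc {ho1 ho2 ho1' ho2'} => -[] [] //= _ e.
  by have /eqP := (e : 0 = 1 :> fcar (t_field H)); rewrite eq_sym oner_eq0.
by have /eqP := (e : 1 = 0 :> fcar (t_field H)); rewrite oner_eq0.
Qed.

End Base.

Lemma complete_of_field_system w (N1 N2 : structure (LQ w)) (H1 : model (T0 w) N1) (H2 : model (T0 w) N2)
    (G : (Kred N1 tt -> Kred N2 tt -> Prop) -> Prop) :
  field_system G ->
  (forall a : N1 K, exists b : N1 K, @fmul (Kred N1) b b = a) ->
  (forall a : N2 K, exists b : N2 K, @fmul (Kred N2) b b = a) ->
  (exists a : N2 K, ~ exists t : N2 K, a = @fadd (Kred N2) (@fmul (Kred N2) t t) (@fopp (Kred N2) t)) ->
  inhabited (N1 Q) -> inhabited (N2 Q) ->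
  (exists n, holds N1 (dim_eq w (2 * n)) /\ holds N2 (dim_eq w (2 * n))) \/
    ((forall n, holds N1 (dim_ge w n)) /\ forall n, holds N2 (dim_ge w n)) ->
  forall f, holds N1 f <-> holds N2 f.
Proof.
move=> GS perf1 perf2 AS Q1 Q2 dims f.
have [g Gg] := fs_ex GS.
pose D1 q1 := qspace_of (T0_Q_sem_of_model (T0_T0_Q H1)) q1.
pose D2 q2 := qspace_of (T0_Q_sem_of_model (T0_T0_Q H2)) q2.
have eqv q1 q2 o1 o2 B1 B2 (o12 : w -> o1 = o2) : @config (D1 q1) (D2 q2) G g B1 B2 ->
    holds (str w (D1 q1) o1) f <-> holds (str w (D2 q2) o2) f.
  (* The field of [str] and that of the model agree by conversion, so the system is only
     repackaged. *)
  have GS' : @field_system (Kred (str false (D1 q1) false)) (Kred (str false (D2 q2) false)) G.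
    by case: GS => *; constructor.
  exact: (@str_equiv w (D1 q1) (D2 q2) o1 o2 o12 G GS' perf1 perf2 g B1 B2 f).
case: dims => [[n [d1 d2]]|[d1 d2]].
  have [q1 [B1 [s1 si1 f1 sz1 om1]]] := base_finite H1 perf1 Q1 d1.
  have [q2 [B2 [s2 si2 f2 sz2 om2]]] := base_finite H2 perf2 Q2 d2.
  apply: iff_trans (holds_str om1 f) (iff_trans _ (iff_sym (holds_str om2 f))).
  by apply: (eqv q1 q2 false false B1 B2) => //; split=> //; [exact: etrans sz1 (esym sz2)|left].
have [q1] := Q1.
have [o1 [om1 _]] := base_omega H1 q1.
(* Only the second base point is moved, to match the first; this is why [AS] speaks of [N2]
   alone. *)
have [q2 [o2 [om2 o12]]] := base_infinite H2 perf2 AS o1 Q2 d2.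
apply: iff_trans (holds_str om1 f) (iff_trans _ (iff_sym (holds_str om2 f))).
(* In infinite dimension the system starts from empty frames. *)
apply: (eqv q1 q2 o1 o2 (Frame (fun=> 0) (fun=> 0) 0) (Frame (fun=> 0) (fun=> 0) 0)).
  by move=> ww; rewrite o12.
by split=> //; right; split=> n; apply/qdim_geP.
Qed.

(** * Finite structures *)

Lemma finite_sort S (M : structure S) s : finite_structure M -> finite_set [set: M s].
Proof.
move=> fM; have -> : [set: M s] = existT M s @^-1` [set: {s : sg_sort S & M s}] by [].
apply: finite_preimage fM => x y _ _; exact: inj_pair2_eq_dec (@eq_comparable _) _ _ _ _.
Qed.

Lemma finite_Lring (F : structure Lring) : finite_set [set: F tt] -> finite_structure F.
Proof.
move=> fF; apply: (sub_finite_set _ (finite_image (existT F tt) fF)).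
by move=> [[] x] _; exists x.
Qed.

Lemma finite_LQ w (N : structure (LQ w)) : finite_set [set: N K] -> finite_set [set: N V] ->
  finite_set [set: N Q] -> finite_structure N.
Proof.
move=> fK fV fQ; apply: (@sub_finite_set _ _ (existT N K @` setT `|` existT N V @` setT `|` existT N Q @` setT)).
  by move=> [[] x] _; [left; left|left; right|right]; exists x.
by rewrite !finite_setU; do !split; exact: finite_image.
Qed.

Lemma finite_field_enum (F : structure Lring) (H : model field_theory F) :
  finite_set [set: F tt] -> exists e : seq (fcar H), forall x, x \in e.
Proof.
move=> fF; have /finite_seqP[e he] : finite_set [set: fcar H] by [].
by exists e => x; have : [set: fcar H] x by []; rewrite he.
Qed.

Lemma Kred_finite w (N : structure (LQ w)) : finite_structure N -> finite_structure (Kred N).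
Proof. by move=> fN; apply: finite_Lring; exact: (@finite_sort _ N K fN). Qed.

Lemma finite_of_frame w (N : structure (LQ w)) (H : T0_Q_sem N) q0 (B : frame (qspace_of H q0)) :
  finite_set [set: N K] -> full B -> finite_structure N.
Proof.
move=> fK fB; have [e he] := finite_field_enum (t_field H) fK.
have fV : finite_set [set: N V].
  pose k := fin_field_of he; pose m := fsize B.
  pose h (p : {ffun 'I_m -> k} * {ffun 'I_m -> k}) : qV (qspace_of H q0) :=
    \sum_(i < m) ((p.1 i : qK (qspace_of H q0)) *: fe B i + (p.2 i : qK (qspace_of H q0)) *: ff B i).
  apply: (sub_finite_set _ (finite_image h (@finite_finset _ setT))) => x _.
  exists ([ffun i : 'I_m => (qb x (ff B i) : k)], [ffun i : 'I_m => (qb x (fe B i) : k)]) => //.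
  rewrite [RHS](fB x) /h /proj /comb; apply: eq_bigr => i _.
  by rewrite !ffunE.
apply: finite_LQ => //; apply: (sub_finite_set _ (finite_image (qa q0) fV)) => q _.
by have [x [<- _]] := t_qareg H q0 q; exists x.
Qed.

Lemma str_finite w (k : finFieldType) (k2 : 2%N \in [pchar k]) n o :
  finite_structure (str w (std k2 n) o).
Proof.
apply: finite_LQ.
- exact: (@finite_finset k setT).
- exact: (@finite_finset ('rV[k]_n * 'rV[k]_n)%type setT).
- exact: (@finite_finset ('rV[k]_n * 'rV[k]_n)%type setT).
Qed.

Lemma ring_iso_holds (F1 F2 : structure Lring) (h : F1 tt -> F2 tt) f : bijective h ->
  h (fzero F1) = fzero F2 -> h (fone F1) = fone F2 ->
  {morph h : x y / fadd x y} -> {morph h : x / fopp x} -> {morph h : x y / fmul x y} ->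
  holds F1 f <-> holds F2 f.
Proof.
move=> hB h0 h1 hD hN hM; have hI := bij_inj hB; case: (hB) => h' _ h'K.
pose R (_ : unit) (s : unit) : F1 s -> F2 s -> Prop :=
  match s with tt => fun a b => h a = b end.
apply: (@back_and_forth_holds Lring F1 F2 unit (fun _ _ => True) R _ tt); split=> //.
- by move=> _ [] a b c d <- <-; split=> [->|/hI].
- move=> i d s g; case: g => /=; first by move=> [] []; exists tt.
  + by move=> [] []; exists tt.
  + by move=> [a [b []]] [a' [b' []]] /= [<- [<- _]]; exists tt; split=> //; exact: hD.
  + by move=> [a []] [a' []] /= [<- _]; exists tt; split=> //; exact: hN.
  + by move=> [a [b []]] [a' [b' []]] /= [<- [<- _]]; exists tt; split=> //; exact: hM.
- by move=> _ [] a; exists tt, (h a).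
- by move=> _ [] b; exists tt, (h' b); split=> //; exact: h'K.
Qed.

Lemma finite_model w (F : structure Lring) n :
  model field_theory F -> holds F char2 -> finite_structure F ->
  exists N : structure (LQ w), [/\ model (T0 w) N, finite_structure N, inhabited (N Q),
    holds N (dim_eq w (2 * n)) & forall g, holds (Kred N) g <-> holds F g].
Proof.
move=> H c2 fF; have [e he] := finite_field_enum H (@finite_sort _ F tt fF).
have k2 : 2%N \in [pchar (fin_field_of he)] := fcar_char2 H c2.
have HN : model (T0 w) (str w (std k2 n) false) by exact: std_model.
exists (str w (std k2 n) false); split=> //.
- exact: str_finite.
- exact: (inhabits (0 : qV (std k2 n))).
- apply/(dim_eqP (T0_Q_sem_of_model (T0_T0_Q HN))).
  have [[t ht] nt] := std_qdim k2 n.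
  split; first by exists t; apply/str_rindep.
  by move=> [t' /str_rindep ht']; apply: nt; exists t'.
- move=> g; apply: (@ring_iso_holds (Kred (str w (std k2 n) false)) F id) => //.
  by exists id.
Qed.

(** * Pseudo-finite fields of characteristic two *)

(** The premise [char2] makes the sentence true in all finite fields, so that it belongs to
    [psf_field_theory], which covers every characteristic. *)
Definition perfect_sentence : formula Lring :=
  Imp char2 (All (S:=Lring) tt 0%N (Ex (S:=Lring) tt 1%N
    (Eq (rmul (Var (S:=Lring) tt 1%N) (Var (S:=Lring) tt 1%N)) (Var (S:=Lring) tt 0%N)))).

Definition artin_schreier_sentence : formula Lring :=
  Ex (S:=Lring) tt 0%N (All (S:=Lring) tt 1%N
    (Neg (Eq (Var (S:=Lring) tt 0%N)
      (radd (rmul (Var (S:=Lring) tt 1%N) (Var (S:=Lring) tt 1%N)) (ropp (Var (S:=Lring) tt 1%N)))))).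

Lemma perfect_sentenceP F : holds F perfect_sentence <->
  (holds F char2 -> forall a : F tt, exists b, fmul b b = a).
Proof.
rewrite /holds /perfect_sentence satImp satAll; split=> h c a.
  have /satE[b] := h c a; rewrite /= ?(updateE, update_neq) //= => -[_ [[<-] [e]]].
  by exists b; exact: (esym e).
apply/satE; have [b e] := h c a; exists b; rewrite /= ?(updateE, update_neq) //=.
by exists a; split=> //; congr Some.
Qed.

Lemma artin_schreier_sentenceP F : holds F artin_schreier_sentence <->
  exists a : F tt, ~ exists t : F tt, a = fadd (fmul t t) (fopp t).
Proof.
rewrite /holds /artin_schreier_sentence satE; split=> -[a h]; exists a.
  move=> [t e]; move: h; rewrite satAll => /(_ t)/satN; apply.
  rewrite /= ?(updateE, update_neq) //=; exists a; split=> //; congr Some; exact: (esym e).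
apply/satAll => t; apply/satN; rewrite /= ?(updateE, update_neq) //= => -[_ [[<-] [e]]].
by apply: h; exists t; exact: (esym e).
Qed.

Lemma finite_perfect (F : structure Lring) : model field_theory F -> holds F char2 ->
  finite_set [set: F tt] -> forall a : F tt, exists b, fmul b b = a.
Proof.
move=> H c2 /(finite_field_enum H)[e he].
exact: (@fin_perfect (fin_field_of he) (fcar_char2 H c2)).
Qed.

Lemma finite_artin_schreier (F : structure Lring) : model field_theory F ->
  finite_set [set: F tt] -> exists a : F tt, ~ exists t : F tt, a = fadd (fmul t t) (fopp t).
Proof.
move=> H /(finite_field_enum H)[e he].
exact: (@fin_AS_not_onto (fin_field_of he)).
Qed.

Lemma card_eq_finite (F : structure Lring) n : model field_theory F ->
  holds F (card_eq (S:=Lring) tt n) -> finite_set [set: F tt].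
Proof.
move=> H /(card_eq_fin_field H)[e [he _]].
exact: (@finite_finset (fin_field_of he) setT).
Qed.

(** If [f] failed in a pseudo-finite field, its negation would hold in some finite field. *)
Lemma psf_of_finite f : sentence f ->
  (forall F, model field_theory F -> finite_structure F -> holds F f) -> psf_field_theory f.
Proof.
move=> sf h; split=> // F [_ _ pF]; apply: contrapT => nf.
have [||N [HN fN /satN]] := pF (Neg f); first by rewrite /sentence scopedN.
  exact/satN.
by apply; exact: h.
Qed.

Lemma psf_perfect : psf_field_theory perfect_sentence.
Proof.
apply: psf_of_finite => // F H fF; apply/perfect_sentenceP => c2.
exact: finite_perfect H c2 (@finite_sort _ F tt fF).
Qed.

Lemma psf_artin_schreier : psf_field_theory artin_schreier_sentence.
Proof.
by apply: psf_of_finite => // F H fF; apply/artin_schreier_sentenceP; exact: finite_artin_schreier H (@finite_sort _ F tt fF).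
Qed.

Lemma psf_infinite n : psf_field_theory (Neg (card_eq (S:=Lring) tt n)).
Proof.
split; first by rewrite /sentence scopedN; exact: card_eq_sentence.
move=> F [H infF _]; apply/satN => /(card_eq_finite H)/finite_Lring.
exact: infF.
Qed.

Lemma psf_field f : field_theory f -> psf_field_theory f.
Proof.
move=> hf; split; last by move=> F [H _ _]; exact: H.
by move: hf; rewrite /field_theory /field_axioms /=; do 10?[case=> [<-//|]].
Qed.

Section Completions.
Variables (C : theory Lring) (HC : completion psf_field_theory C).

Lemma completion_psf (F : structure Lring) : model C F -> model psf_field_theory F.
Proof. by case: HC => _ h _ _ MF f /h; exact: MF. Qed.

Lemma completion_field (F : structure Lring) : model C F -> model field_theory F.
Proof. by move=> /completion_psf h f /psf_field; exact: h. Qed.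

Lemma completion_infinite (F : structure Lring) : model C F -> ~ finite_structure F.
Proof.
move=> MF fF; have H := completion_field MF.
have [e he] := finite_field_enum H (@finite_sort _ F tt fF).
have /satN := completion_psf MF (psf_infinite #|fin_field_of he|).
apply; exact: fin_field_card_eq.
Qed.

Lemma completion_equiv (F1 F2 : structure Lring) : model C F1 -> model C F2 ->
  forall f, sentence f -> holds F1 f -> holds F2 f.
Proof.
case: HC => _ _ _ dec M1 M2 f /dec[/M2//|/M1/satN nf hf]; by case: nf.
Qed.

(** Otherwise the negation of the conjunction of [l] would hold in all finite fields, hence belong
    to the theory of pseudo-finite fields and to [C], against the consistency of [C]. *)
Lemma completion_finite l : List.Forall C l ->
  exists F, [/\ model field_theory F, finite_structure F & List.Forall (holds F) l].
Proof.
move=> Cl; case: HC => Csent psfC [F0 MF0] _.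
apply: contrapT => nF.
have : psf_field_theory (Neg (Conj l)).
  apply: psf_of_finite => [|F H fF].
    rewrite /sentence scopedN; apply: scoped_Conj.
    by apply: List.Forall_impl Cl => f /Csent.
  by apply/satN => /sat_Conj hl; apply: nF; exists F.
move=> /psfC/MF0/satN; apply; apply/sat_Conj.
by apply: List.Forall_impl Cl => f; exact: MF0.
Qed.

End Completions.

Lemma Th_completion (F : structure Lring) : pseudofinite field_theory F ->
  completion psf_field_theory (Th F).
Proof.
move=> pF; split.
- by move=> f [].
- by move=> f [sf hf]; split=> //; exact: hf.
- by exists F => f [].
- move=> f sf; have [h|h] := pselect (holds F f); [by left|right].
  by split; [rewrite /sentence scopedN|exact/satN].
Qed.

(** * Complete theories *)

Lemma Kred_card_eq w (N : structure (LQ w)) n :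
  inhabited (N K) -> holds N (card_eq (S:=LQ w) K n) <-> holds (Kred N) (card_eq (S:=Lring) tt n).
Proof. by move=> inh; rewrite (card_eqP _ inh) (@card_eqP Lring (Kred N) tt n inh). Qed.

Lemma base_sem w (N : structure (LQ w)) : model (T0 w) N -> T0_Q_sem N.
Proof. by move=> /T0_T0_Q/T0_Q_sem_of_model. Qed.

Lemma subr0_iff (V : zmodType) (x y : V) : x - y = 0 <-> x = y.
Proof. by split=> [/subr0_eq|->]; last exact: subrr. Qed.

(** The system has a single member: an isomorphism is total on both sides and need not grow. *)
Lemma finite_field_system (F1 F2 : structure Lring) n :
  model field_theory F1 -> model field_theory F2 -> holds F1 char2 -> holds F2 char2 ->
  holds F1 (card_eq (S:=Lring) tt n) -> holds F2 (card_eq (S:=Lring) tt n) ->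
  exists G, @field_system F1 F2 G.
Proof.
move=> H1 H2 c1 c2 /(card_eq_fin_field H1)[e1 [he1 n1]] /(card_eq_fin_field H2)[e2 [he2 n2]].
have [r [[r1 rD rN rM r0] [rl rr]]] := @fin_field_iso (fin_field_of he1) (fin_field_of he2)
  (fcar_char2 H1 c1) (fcar_char2 H2 c2) (etrans n1 (esym n2)).
exists (eq r); split.
- by exists r.
- by move=> _ <-; have := rD _ _ _ _ r1 (rN _ _ r1); rewrite !subrr.
- by move=> _ <-.
- by move=> _ <-; exact: rD.
- by move=> _ <-; exact: rN.
- by move=> _ <-; exact: rM.
- move=> _ <- a a' b b' ra rb; have := r0 _ _ (rD _ _ _ _ ra (rN _ _ rb)).
  by rewrite !subr0_iff.
- by move=> _ <- a; have [a' ra] := rl a; exists r, a'.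
- by move=> _ <- a'; have [a ra] := rr a'; exists r, a.
Qed.

Lemma complete_finite w n (N1 N2 : structure (LQ w)) :
  model (T0 w) N1 -> model (T0 w) N2 ->
  holds N1 (card_eq (S:=LQ w) K n) -> holds N2 (card_eq (S:=LQ w) K n) ->
  inhabited (N1 Q) -> inhabited (N2 Q) ->
  (forall m, holds N1 (dim_ge w m)) -> (forall m, holds N2 (dim_ge w m)) ->
  forall f, holds N1 f <-> holds N2 f.
Proof.
move=> H1 H2 /(Kred_card_eq _ (K_inh N1)) e1 /(Kred_card_eq _ (K_inh N2)) e2 Q1 Q2 d1 d2.
have S1 := base_sem H1; have S2 := base_sem H2.
have [G GS] := finite_field_system (t_field S1) (t_field S2) (t_char2 S1) (t_char2 S2) e1 e2.
have f1 := card_eq_finite (t_field S1) e1; have f2 := card_eq_finite (t_field S2) e2.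
apply: (complete_of_field_system H1 H2 GS _ _ _ Q1 Q2); last by right.
- exact: finite_perfect (t_field S1) (t_char2 S1) f1.
- exact: finite_perfect (t_field S2) (t_char2 S2) f2.
- exact: finite_artin_schreier (t_field S2) f2.
Qed.

Lemma ultrapower_holds S (N : structure S) U f : UltraFilter U -> (forall s, inhabited (N s)) ->
  holds (@ultraproduct S nat (fun=> N) U) f <-> holds N f.
Proof.
move=> UU inh; rewrite (@ultraproduct_holds S nat (fun=> N) U UU (fun=> inh)).
split=> [h|h]; last by apply: filterS filterT.
by have [] := filter_ex h.
Qed.

Lemma complete_psf w C (N1 N2 : structure (LQ w)) : completion psf_field_theory C ->
  model (T0 w) N1 -> model (T0 w) N2 ->
  model C (Kred N1) -> model C (Kred N2) ->
  inhabited (N1 Q) -> inhabited (N2 Q) ->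
  (exists n, holds N1 (dim_eq w (2 * n)) /\ holds N2 (dim_eq w (2 * n))) \/
    ((forall n, holds N1 (dim_ge w n)) /\ forall n, holds N2 (dim_ge w n)) ->
  forall f, holds N1 f <-> holds N2 f.
Proof.
move=> HC H1 H2 C1 C2 Q1 Q2 dims f.
have EF := elementary_EFeq (completion_equiv HC C1 C2).
have [U [UU hU]] := ultraFilterLemma eventually_filter.
have U_inf n : U [set i | (n <= i)%N] by apply: hU; exists n.
have GS := ultrapower_field_system UU U_inf EF.
pose P (N : structure (LQ w)) := @ultraproduct (LQ w) nat (fun=> N) U.
have inh (N : structure (LQ w)) : inhabited (N Q) -> model (T0 w) N -> forall s, inhabited (N s).
  by move=> iQ /base_sem _ [] //; [exact: K_inh|exact: V_inh].
have h1 g : holds (P N1) g <-> holds N1 g := ultrapower_holds g UU (inh N1 Q1 H1).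
have h2 g : holds (P N2) g <-> holds N2 g := ultrapower_holds g UU (inh N2 Q2 H2).
have M1 : model (T0 w) (P N1) by move=> g /H1/h1.
have M2 : model (T0 w) (P N2) by move=> g /H2/h2.
have K1 : model psf_field_theory (Kred (P N1)).
  by move=> g /(completion_psf HC C1)/holds_K/h1/holds_K.
have K2 : model psf_field_theory (Kred (P N2)).
  by move=> g /(completion_psf HC C2)/holds_K/h2/holds_K.
rewrite -h1 -h2.
(* The field of the ultrapower is the ultrapower of the field, again by conversion. *)
have GS' : @field_system (Kred (P N1)) (Kred (P N2)) (@forced_system (Kred N1) (Kred N2) U).
  by case: GS => *; constructor.
apply: (complete_of_field_system M1 M2 GS').
- exact: (perfect_sentenceP _).1 (K1 _ psf_perfect) (t_char2 (base_sem M1)).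
- exact: (perfect_sentenceP _).1 (K2 _ psf_perfect) (t_char2 (base_sem M2)).
- exact: (artin_schreier_sentenceP _).1 (K2 _ psf_artin_schreier).
- by apply/nonemptyP/h1/nonemptyP.
- by apply/nonemptyP/h2/nonemptyP.
case: dims => [[n [d1 d2]]|[d1 d2]]; [left; exists n|right].
  by split; [exact/h1|exact/h2].
by split=> n; [exact/h1|exact/h2].
Qed.

Lemma axiomatized_of_complete S (T A : theory S) (M : structure S) :
  (forall f, T f -> sentence f) -> (forall f, A f -> sentence f) ->
  model T M -> model A M ->
  (forall N, model T N -> model A N -> forall f, holds M f <-> holds N f) ->
  axiomatized_modulo T (Th M) A.
Proof.
move=> sT sA TM AM complete N; split.
  by move=> /model_setU[TN AN] f [_ hf]; exact/(complete N TN AN).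
move=> h; apply/model_setU; split=> f hf; apply: h.
  by split; [exact: sT|exact: TM].
by split; [exact: sA|exact: AM].
Qed.

(** * Realizations *)

Lemma qindep_injective D n (t : nat -> qV D) : qindep n t -> {in iota 0 n &, injective t}.
Proof.
move=> ht i j; rewrite !mem_iota0 => lti ltj tij.
have E l : (l < n)%N -> \sum_(m < n) (m == l :> nat)%:R *: t m = t l.
  move=> ltl; rewrite (bigD1 (Ordinal ltl)) //= eqxx scale1r big1 ?addr0 // => m.
  by rewrite -val_eqE /= => /negPf->; rewrite scale0r.
have := qindep_inj (a := fun m => (m == i)%:R) (b := fun m => (m == j)%:R) ht.
move=> /(_ _ i lti); rewrite !E // => /(_ tij); rewrite eqxx.
by case: (eqVneq i j) => // _ /eqP; rewrite oner_eq0.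
Qed.

Lemma infinite_of_dim w (N : structure (LQ w)) : T0_Q_sem N ->
  inhabited (N Q) -> (forall n, holds N (dim_ge w n)) -> ~ finite_structure N.
Proof.
move=> H [q0] inf fN.
have /finite_seqP[e he] : finite_set [set: vcar H] := @finite_sort _ N V fN.
have /(dim_geP H)[t] := inf (size e).+1.
move=> /(@rindep_qindep w N H q0)/qindep_injective tI.
have : (size [seq (t i : vcar H) | i <- iota 0 (size e).+1] <= size e)%N.
  apply: uniq_leq_size; first by rewrite map_inj_in_uniq ?iota_uniq.
  by move=> x _; have : [set: vcar H] x by []; rewrite he.
by rewrite size_map size_iota ltnn.
Qed.

Lemma infinite_of_completion w C (N : structure (LQ w)) : completion psf_field_theory C ->
  model (K_theory (w:=w) C) N -> ~ finite_structure N.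
Proof. by move=> HC /model_K/(completion_infinite HC) h /Kred_finite. Qed.

(** Finitely many axioms have to hold together in one hyperbolic space of dimension [2 * d j]. The
    bound [m] accommodates [d = id], which produces infinite dimension; a constant [d] keeps the
    dimension fixed. *)
Lemma exist_pseudofinite w (C : theory Lring) (A : theory (LQ w)) (d : nat -> nat) :
  (forall l, List.Forall C l -> exists F, [/\ model field_theory F, holds F char2,
    finite_structure F & List.Forall (holds F) l]) ->
  (forall f, A f -> exists m l, List.Forall C l /\ forall j, (m <= j)%N ->
    forall N, model (T0 w) N -> inhabited (N Q) -> holds N (dim_eq w (2 * d j)) ->
      List.Forall (holds (Kred N)) l -> holds N f) ->
  exists M, [/\ model (T0 w) M, model A M & forall f, holds M f ->
    exists N, [/\ model (T0 w) N, finite_structure N & holds N f]].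
Proof.
move=> finC hA; apply: pseudofinite_compactness => fs Afs.
have [m [l [Cl hl]]] : exists m l, List.Forall C l /\ forall j, (m <= j)%N ->
    forall N, model (T0 w) N -> inhabited (N Q) -> holds N (dim_eq w (2 * d j)) ->
      List.Forall (holds (Kred N)) l -> List.Forall (holds N) fs.
  elim: Afs => [|f {}fs /hA[m1 [l1 [C1 h1]]] _ [m2 [l2 [C2 h2]]]]; first by exists 0%N, [::].
  exists (maxn m1 m2), (l1 ++ l2); split; first exact/Forall_app_iff.
  move=> j; rewrite geq_max => /andP[j1 j2] N HN iQ dN /Forall_app_iff[g1 g2].
  by constructor; [exact: (h1 j)|exact: (h2 j)].
have [F [HF c2 fF hF]] := finC l Cl.
have [N [HN fN iQ dN KN]] := @finite_model w F (d m) HF c2 fF.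
exists N; split=> //.
  by case=> //; [exact: K_inh|exact: V_inh].
apply: hl (leqnn m) _ HN iQ dN _.
by apply: List.Forall_impl hF => f /KN.
Qed.

Lemma completion_finite_char2 C l : completion psf_field_theory C -> C char2 ->
  List.Forall C l -> exists F, [/\ model field_theory F, holds F char2,
    finite_structure F & List.Forall (holds F) l].
Proof.
move=> HC c2 Cl; have [F [HF fF]] := completion_finite HC (List.Forall_cons _ c2 Cl).
by move=> /List.Forall_cons_iff[]; exists F.
Qed.

Lemma dim_ge_of_dim_eq w (N : structure (LQ w)) i j : model (T0 w) N -> inhabited (N Q) ->
  (i <= j)%N -> holds N (dim_eq w (2 * j)) -> holds N (dim_ge w i).
Proof.
move=> HN [q0] ij /(dim_eqP (base_sem HN))[h _].
apply/(qdim_geP HN q0); apply: (@qdim_ge_le _ i (2 * j)); first by lia.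
by apply/(qdim_geP HN q0)/(dim_geP (base_sem HN)).
Qed.

Local Open Scope nat_scope.

(** * Axiomatizations *)

Section Axiomatizations.
Variable w : bool.
Implicit Types (M N : structure (LQ w)) (C : theory Lring).

Lemma theory_finiteP k N : T0_Q_sem N -> model (theory_finite w k) N <->
  [/\ holds N (card_eq (S:=LQ w) K (2 ^ k)), inhabited (N Q) & forall n, holds N (dim_ge w n)].
Proof.
move=> H; split=> [h|[h1 h2 h3] f].
  split; first by apply: h; left; left.
    by apply/nonemptyP; apply: h; left; right.
  by move=> n; apply: h; right; exists n.
by case=> [[->//|->]|[n _ <-]//]; exact/nonemptyP.
Qed.

Lemma theory_psf_finite_dimP C n N : model (theory_psf_finite_dim w C n) N <->
  [/\ model C (Kred N), inhabited (N Q) & holds N (dim_eq w (2 * n))].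
Proof.
split=> [h|[h1 h2 h3] f].
  split; first by apply/model_K => f hf; apply: h; left.
    by apply/nonemptyP; apply: h; right; left.
  by apply: h; right; right.
by case=> [hf|[->|->//]]; [exact: (model_K _ _).2 h1 f hf|exact/nonemptyP].
Qed.

Lemma theory_psf_infinite_dimP C N : model (theory_psf_infinite_dim w C) N <->
  [/\ model C (Kred N), inhabited (N Q) & forall n, holds N (dim_ge w n)].
Proof.
split=> [h|[h1 h2 h3] f].
  split; first by apply/model_K => f hf; apply: h; left; left.
    by apply/nonemptyP; apply: h; left; right.
  by move=> n; apply: h; right; exists n.
by case=> [[hf|->]|[n _ <-]//]; [exact: (model_K _ _).2 h1 f hf|exact/nonemptyP].
Qed.

Lemma axiomatized_finite k M : model (T0 w) M -> model (theory_finite w k) M ->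
  axiomatized_modulo (T0 w) (Th M) (theory_finite w k).
Proof.
move=> HM AM; apply: axiomatized_of_complete => //.
- exact: T0_sentence.
- by move=> f [[->|->]|[n _ <-]]; [exact: card_eq_sentence| |exact: dim_ge_sentence].
move=> N HN AN; have [c1 q1 d1] := (theory_finiteP k (base_sem HM)).1 AM.
have [c2 q2 d2] := (theory_finiteP k (base_sem HN)).1 AN.
exact: complete_finite HM HN c1 c2 q1 q2 d1 d2.
Qed.

Lemma axiomatized_psf_finite_dim C n M : completion psf_field_theory C ->
  model (T0 w) M -> model (theory_psf_finite_dim w C n) M ->
  axiomatized_modulo (T0 w) (Th M) (theory_psf_finite_dim w C n).
Proof.
move=> HC HM AM; apply: axiomatized_of_complete => //.
- exact: T0_sentence.
- have [sC _ _ _] := HC.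
  by move=> f [[g /sC sg <-]|[->|->]]; [exact: K_sentence| |exact: dim_eq_sentence].
move=> N HN AN; have [c1 q1 d1] := (theory_psf_finite_dimP C n M).1 AM.
have [c2 q2 d2] := (theory_psf_finite_dimP C n N).1 AN.
by apply: (complete_psf HC HM HN c1 c2 q1 q2); left; exists n.
Qed.

Lemma axiomatized_psf_infinite_dim C M : completion psf_field_theory C ->
  model (T0 w) M -> model (theory_psf_infinite_dim w C) M ->
  axiomatized_modulo (T0 w) (Th M) (theory_psf_infinite_dim w C).
Proof.
move=> HC HM AM; apply: axiomatized_of_complete => //.
- exact: T0_sentence.
- have [sC _ _ _] := HC.
  by move=> f [[[g /sC sg <-]|->]|[n _ <-]]; [exact: K_sentence| |exact: dim_ge_sentence].
move=> N HN AN; have [c1 q1 d1] := (theory_psf_infinite_dimP C M).1 AM.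
have [c2 q2 d2] := (theory_psf_infinite_dimP C N).1 AN.
by apply: (complete_psf HC HM HN c1 c2 q1 q2); right.
Qed.

(** The last clause excludes a finite field with a finite dimension from the infinite models. *)
Lemma dim_cases M : model (T0 w) M -> inhabited (M Q) ->
  (forall n, holds M (dim_ge w n)) \/
  exists n, holds M (dim_eq w (2 * n)) /\ (finite_set [set: M K] -> finite_structure M).
Proof.
move=> HM [q0]; have H := T0_Q_sem_of_model (T0_T0_Q HM).
have [inf|[B [sB fB]]] := frame_dichotomy (qspace_of (T0_Q_sem_of_model (T0_T0_Q HM)) q0).
  by left=> n; apply/(qdim_geP HM q0).
right; exists (fsize B); split; last by move=> fK; exact: finite_of_frame fK fB.
have [h1 h2] := full_frame_dim sB fB.
apply/(dim_eqP H); split; first exact/(dim_geP H)/(qdim_geP HM q0).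
by move=> /(dim_geP H)/(qdim_geP HM q0).
Qed.

Lemma Kred_pseudofinite M : pseudofinite (T0 w) M -> ~ finite_set [set: M K] ->
  pseudofinite field_theory (Kred M).
Proof.
move=> [HM _ pM] infK; split.
- exact: t_field (base_sem HM).
- by move=> fK; apply: infK; exact: (@finite_sort _ (Kred M) tt fK).
- move=> f sf /holds_K hf; have [N [HN fN /holds_K hN]] := pM _ (K_sentence w sf) hf.
  by exists (Kred N); split=> //; [exact: t_field (base_sem HN)|exact: Kred_finite].
Qed.

Lemma axiomatization M : pseudofinite (T0 w) M -> inhabited (M Q) ->
  (exists k : nat, 1 <= k /\ axiomatized_modulo (T0 w) (Th M) (theory_finite w k)) \/
  (exists C : theory Lring, completion psf_field_theory C /\
     ((exists n : nat, axiomatized_modulo (T0 w) (Th M) (theory_psf_finite_dim w C n)) \/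
      axiomatized_modulo (T0 w) (Th M) (theory_psf_infinite_dim w C))).
Proof.
move=> pM iQ; have [HM infM _] := pM; have H := base_sem HM.
have [fK|infK] := pselect (finite_set [set: M K]); [left|right].
  have inf : forall n, holds M (dim_ge w n).
    by have [//|[n [_ /(_ fK)]]] := dim_cases HM iQ.
  have [e he] := finite_field_enum (t_field H) fK.
  have [k k0 kE] := card_pchar2 (fcar_char2 (t_field H) (t_char2 H) : _ \in [pchar (fin_field_of he)]%R).
  exists k; split=> //; apply: axiomatized_finite => //; apply/(theory_finiteP k H); split=> //.
  by apply/(Kred_card_eq _ (K_inh M)); rewrite -kE; exact: fin_field_card_eq.
have HC := Th_completion (Kred_pseudofinite pM infK).
exists (Th (Kred M)); split=> //.
have [inf|[n [dn _]]] := dim_cases HM iQ; [right|left; exists n].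
  apply: axiomatized_psf_infinite_dim => //; apply/theory_psf_infinite_dimP; split=> //.
  by move=> f [].
apply: axiomatized_psf_finite_dim => //; apply/theory_psf_finite_dimP; split=> //.
by move=> f [].
Qed.

Lemma pseudofinite_of_transfer M : model (T0 w) M -> ~ finite_structure M ->
  (forall f, holds M f -> exists N, [/\ model (T0 w) N, finite_structure N & holds N f]) ->
  pseudofinite (T0 w) M.
Proof. by move=> HM infM tr; split=> // f _; exact: tr. Qed.

Lemma realization_finite k : 1 <= k ->
  exists M, [/\ pseudofinite (T0 w) M, inhabited (M Q)
    & axiomatized_modulo (T0 w) (Th M) (theory_finite w k)].
Proof.
move=> k1; have [F F2 cF] := pPrimePowerField (isT : prime 2) k1.
(* The zero-dimensional space serves to view the field [F] as a structure for the language of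
   rings. *)
pose E := Kred (str false (std F2 0) false).
have HE := str_field false (std F2 0) false.
have c2 : holds E char2 := t_char2 (str_T0_Q_sem false (std F2 0) false).
have fE : finite_structure E by apply: Kred_finite; exact: str_finite.
have cE : holds E (card_eq (S:=Lring) tt (2 ^ k)).
  by rewrite -cF; apply: (@finType_card_eq Lring E tt F 0%R id); exists id.
(* The field [E] satisfies every finite part of its own theory; only the dimension grows. *)
have [||M [HM AM tr]] := @exist_pseudofinite w (Th E) (theory_finite w k) id.
- move=> l hl; exists E; split=> //.
  by apply: List.Forall_impl hl => f [].
- move=> f [[->|->]|[n _ <-]].
  + exists 0, [:: card_eq (S:=Lring) tt (2 ^ k)]; split.
      by repeat constructor=> //; exact: card_eq_sentence.
    move=> j _ N HN _ _ /List.Forall_cons_iff[h _].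
    by apply/(Kred_card_eq _ (K_inh N)).
  + by exists 0, [::]; split=> // j _ N _ iQ _ _; exact/nonemptyP.
  + exists n, [::]; split=> // j nj N HN iQ dN _; exact: dim_ge_of_dim_eq HN iQ nj dN.
have [_ iQ inf] := (theory_finiteP k (base_sem HM)).1 AM.
exists M; split=> //; last exact: axiomatized_finite.
by apply: pseudofinite_of_transfer => //; exact: infinite_of_dim (base_sem HM) iQ inf.
Qed.

(** The field of every model of [T0] has characteristic two, so only completions containing [char2]
    can be realized. The finite approximations all have dimension [2 * n], and the model is infinite
    because its field is. *)
Lemma realization_psf_finite_dim C n : completion psf_field_theory C -> C char2 ->
  exists M, [/\ pseudofinite (T0 w) M, inhabited (M Q)
    & axiomatized_modulo (T0 w) (Th M) (theory_psf_finite_dim w C n)].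
Proof.
move=> HC c2.
have [||M [HM AM tr]] := @exist_pseudofinite w C (theory_psf_finite_dim w C n) (fun=> n).
- by move=> l; exact: completion_finite_char2.
- move=> f [[g Cg <-]|[->|->]].
  + exists 0, [:: g]; split; first by repeat constructor.
    by move=> j _ N _ _ _ /List.Forall_cons_iff[h _]; exact/holds_K.
  + by exists 0, [::]; split=> // j _ N _ iQ _ _; exact/nonemptyP.
  + by exists 0, [::].
have [CM iQ _] := (theory_psf_finite_dimP C n M).1 AM.
exists M; split=> //; last exact: axiomatized_psf_finite_dim.
apply: pseudofinite_of_transfer => //; apply: infinite_of_completion HC _.
exact/model_K.
Qed.

Lemma realization_psf_infinite_dim C : completion psf_field_theory C -> C char2 ->
  exists M, [/\ pseudofinite (T0 w) M, inhabited (M Q)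
    & axiomatized_modulo (T0 w) (Th M) (theory_psf_infinite_dim w C)].
Proof.
move=> HC c2.
have [||M [HM AM tr]] := @exist_pseudofinite w C (theory_psf_infinite_dim w C) id.
- by move=> l; exact: completion_finite_char2.
- move=> f [[[g Cg <-]|->]|[n _ <-]].
  + exists 0, [:: g]; split; first by repeat constructor.
    by move=> j _ N _ _ _ /List.Forall_cons_iff[h _]; exact/holds_K.
  + by exists 0, [::]; split=> // j _ N _ iQ _ _; exact/nonemptyP.
  + exists n, [::]; split=> // j nj N HN iQ dN _; exact: dim_ge_of_dim_eq HN iQ nj dN.
have [CM iQ _] := (theory_psf_infinite_dimP C M).1 AM.
exists M; split=> //; last exact: axiomatized_psf_infinite_dim.
apply: pseudofinite_of_transfer => //; apply: infinite_of_completion HC _.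
exact/model_K.
Qed.

End Axiomatizations.

Theorem theorem2p13 (w : bool) :
  [/\ forall M : structure (LQ w), pseudofinite (T0 w) M -> inhabited (M Q) ->
        (exists k : nat, 1 <= k /\
           axiomatized_modulo (T0 w) (Th M) (theory_finite w k)) \/
        (exists C : theory Lring, completion psf_field_theory C /\
           ((exists n : nat,
               axiomatized_modulo (T0 w) (Th M) (theory_psf_finite_dim w C n)) \/
            axiomatized_modulo (T0 w) (Th M) (theory_psf_infinite_dim w C))),
      forall k : nat, 1 <= k ->
        exists M : structure (LQ w), [/\ pseudofinite (T0 w) M, inhabited (M Q)
          & axiomatized_modulo (T0 w) (Th M) (theory_finite w k)],
      forall (C : theory Lring) (n : nat), completion psf_field_theory C -> C char2 ->
        exists M : structure (LQ w), [/\ pseudofinite (T0 w) M, inhabited (M Q)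
          & axiomatized_modulo (T0 w) (Th M) (theory_psf_finite_dim w C n)]
    & forall C : theory Lring, completion psf_field_theory C -> C char2 ->
        exists M : structure (LQ w), [/\ pseudofinite (T0 w) M, inhabited (M Q)
          & axiomatized_modulo (T0 w) (Th M) (theory_psf_infinite_dim w C)]].
Proof.
split.
- exact: axiomatization.
- exact: realization_finite.
- move=> C n; exact: realization_psf_finite_dim.
- exact: realization_psf_infinite_dim.
Qed.
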